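(* Let $(k_{a,c}, p_{a,c}, \varphi_{a,c})$, $(a,c)\in(-a_0,a_0)\times(-c_0,c_0)$, be the family of small periodic solutions described in the context, and let $$\mathcal B_{a,c} = \partial_z^2\left(k_{a,c}^4\partial_z^4+k_{a,c}^2\partial_z^2-c+p_{a,c}\right).$$ Let $c_3\in(0,c_0]$, $a_3\in(0,a_0]$ and, for all $c\in(-c_3,c_3)\setminus\{0\}$ and $a\in(-a_3,a_3)\setminus\{0\}$, $\Lambda_{a,c}>0$ be constants such that for all such $a,c$ and all $\Lambda\in(0,\Lambda_{a,c})$ the operator $\Lambda\partial_z-\mathcal B_{a,c}$ acting in $L^2(0,2\pi)$ with domain $H^6_{\mathrm{per}}(0,2\pi)$ has a simple negative eigenvalue (such constants exist). Then for any $c\in(-c_3,c_3)\setminus\{0\}$, any $a\in(-a_3,a_3)\setminus\{0\}$ and any $\Lambda\in(0,\Lambda_{a,c})$, the linear operator $\Lambda\partial_z-\mathcal B_{a,c}$ acting in $L^2(\mathbb R)$ with domain $H^6(\mathbb R)$ has negative essential spectrum, i.e. its essential spectrum contains a negative real number. Consequently, for these $a$ and $c$, the periodic wave $\varphi_{a,c}$ is transversely essentially unstable with respect to localized longitudinal perturbations.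
   Context: Equation. The fifth-order KP equation is $\partial_t\partial_x u = \partial_x^2(\partial_x^4 u+\partial_x^2u+\frac12u^2)+\partial_y^2u$. Its line traveling waves of speed $c$ considered here are, in a comoving frame, solutions $u=u(x)$ of $$\partial_x^4 u + \partial_x^2 u - cu + \tfrac12 u^2 = 0. \qquad ( * )$$ Function spaces. $H^j_{\mathrm{per}}(0,2\pi)=\{f\in H^j_{\mathrm{loc}}(\mathbb R): f(z+2\pi)=f(z)\ \forall z\in\mathbb R\}$. Periodic waves (previously known existence result). There exist positive constants $c_0,a_0$ such that for any $c\in(-c_0,c_0)$ equation $( * )$ has a one-parameter family of even periodic solutions $(\varphi_{a,c})_{a\in(-a_0,a_0)}$ of the form $\varphi_{a,c}(x)=p_{a,c}(k_{a,c}x)$, $x\in\mathbb R$, such that: (i) the real-valued map $(a,c)\mapsto k_{a,c}$ is analytic on $(-a_0,a_0)\times(-c_0,c_0)$ and $k_{a,c}=k_0(c)+c\,\widetilde k(a,c)$, with $k_0(c)=\left(\frac{1+\sqrt{1+4c}}{2}\right)^{1/2}$ and $\widetilde k(a,c)=\sum_{n\ge1}\widetilde k_{2n}(c)a^{2n}$, where $|\widetilde k_{2n}(c)|\le K_0/\rho_0^{2n}$ for all $n\ge1$ and some positive constants $K_0,\rho_0$; (ii) the map $(a,c)\mapsto p_{a,c}$ is analytic on $(-a_0,a_0)\times(-c_0,c_0)$ with values in $H^6_{\mathrm{per}}(0,2\pi)$ and $$p_{a,c}(z)=ac\cos(z)+c\sum_{n,m\ge0,\ n+m\ge2,\ n-m\ne\pm1}\widetilde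 p_{n,m}(c)\,e^{i(n-m)z}a^{n+m},$$ where the $\widetilde p_{n,m}(c)$ are real, $\widetilde p_{n,m}(c)=\widetilde p_{m,n}(c)$, and $|\widetilde p_{n,m}(c)|\le C_0/\rho_0^{n+m}$ for all $c\in(-c_0,c_0)$ and some positive constant $C_0$; (iii) the Fourier coefficients $\widehat p_q(a,c)$ of $p_{a,c}(z)=\sum_{q\in\mathbb Z}\widehat p_q(a,c)e^{iqz}$ are real, $\widehat p_0(a,c)=O(ca^2)$ and $\widehat p_q(a,c)=O(c|a|^{|q|})$ for $q\ne0$, as $a\to0$; $a\mapsto\widehat p_q(a,c)$ is even (resp. odd) for even (resp. odd) $q$, so that $p_{-a,c}(z)=p_{a,c}(z+\pi)$. The family is fixed once and for all. Operators. In expressions such as $\mathcal B_{a,c}$, functions act by multiplication, i.e. $\mathcal B_{a,c}f=\partial_z^2(k_{a,c}^4\partial_z^4f+k_{a,c}^2\partial_z^2f-cf+p_{a,c}f)$. With $\mathcal A_{a,c}=\partial_x^2(\partial_x^4+\partial_x^2-c+\varphi_{a,c})$, the change of variables $z=k_{a,c}x$, $\lambda=k_{a,c}\Lambda$ transforms $\lambda\partial_x-\mathcal A_{a,c}$ into $k_{a,c}^2(\Lambda\partial_z-\mathcal B_{a,c})$. Essential spectrum. For a closed operator $T$, $\sigma_{\mathrm{ess}}(T)=\{\nu\in\mathbb C: T-\nu \text{ is not Fredholm with index } 0\}$. Instability notion. $\varphi_{a,c}$ is called transversely essentially unstable with respect to localized longitudinal perturbations if there exist $\lambda\in\mathbb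 C$ with $\Re\lambda>0$ and $\omega\in\mathbb R$ such that $-\omega^2$ is negative and belongs to the essential spectrum of $\lambda\partial_x-\mathcal A_{a,c}$ acting in $L^2(\mathbb R)$ with domain $H^6(\mathbb R)$. *)

(* Defs.v *)
From HB Require Import structures.
From mathcomp Require Import all_boot all_order all_algebra.
From mathcomp Require Import complex.
From mathcomp Require Import all_classical all_reals all_analysis.

Set Implicit Arguments.
Unset Strict Implicit.
Unset Printing Implicit Defensive.
Import Order.TTheory GRing.Theory Num.Theory.
Import numFieldNormedType.Exports.
Import Normc.

Local Open Scope classical_set_scope.
Local Open Scope ring_scope.
Local Open Scope complex_scope.

Definition cis (R : realType) (t : R) : R[i] := cos t +i* sin t.

Definition cvgC (R : realType) (u : nat -> R[i]) (l : R[i]) : Prop :=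
  (fun n => normc (u n - l)) @ \oo --> (0 : R).

Definition Cintegral (R : realType) (D : set R) (f : R -> R[i]) : R[i] :=
  (\int[@lebesgue_measure R]_(x in D) complex.Re (f x))
  +i* (\int[@lebesgue_measure R]_(x in D) complex.Im (f x)).

(* Elements of the Lebesgue and Sobolev spaces are represented by functions;
   elements of [L2on D] are to be read modulo [null_on D]. *)

Definition L2on (R : realType) (D : set R) : set (R -> R[i]) :=
  [set f : R -> R[i] | [/\ measurable_fun D (fun x : R => complex.Re (f x)),
               measurable_fun D (fun x : R => complex.Im (f x)) &
               (@lebesgue_measure R).-integrable D
                 (fun x : R => (normc (f x) ^+ 2)%:E)]].

Definition null_on (R : realType) (D : set R) : set (R -> R[i]) :=
  [set f : R -> R[i] | ae_eq (@lebesgue_measure R) D f (fun=> 0)].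

Definition L2dist (R : realType) (D : set R) (f g : R -> R[i]) : R :=
  Num.sqrt (\int[@lebesgue_measure R]_(x in D) (normc (f x - g x) ^+ 2)).

Definition L2loc (R : realType) : set (R -> R[i]) :=
  [set f : R -> R[i] | forall M : R, L2on `[- M, M] f].

Definition test_function (R : realType) : set (R -> R) :=
  [set phi : R -> R | (forall (n : nat) (x : R), derivable (derive1n n phi) x 1) /\
             exists M : R, forall x : R, M < `|x| -> phi x = 0].

Definition loc_integrableC (R : realType) (f : R -> R[i]) : Prop :=
  locally_integrable [set: R] (fun x : R => complex.Re (f x)) /\
  locally_integrable [set: R] (fun x : R => complex.Im (f x)).

(* Testing against real-valued functions is enough, by linearity. *)
Definition weak_deriv (R : realType) (j : nat) (f g : R -> R[i]) : Prop :=
  [/\ loc_integrableC f, loc_integrableC g &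
      forall phi : R -> R, test_function phi ->
        Cintegral [set: R] (fun x => f x * (derive1n j phi x)%:C) =
        (-1) ^+ j * Cintegral [set: R] (fun x => g x * (phi x)%:C)].

(* The weak derivative, unique up to a null set; it is meaningless when no weak
   derivative exists and is only applied to elements of Sobolev spaces. *)
Definition wD (R : realType) (j : nat) (f : R -> R[i]) : R -> R[i] :=
  xget (fun=> 0) [set g | weak_deriv j f g].

Definition Hline (R : realType) (j : nat) : set (R -> R[i]) :=
  [set f : R -> R[i] | forall i, (i <= j)%N -> exists2 g, L2on [set: R] g & weak_deriv i f g].

Definition Hloc (R : realType) (j : nat) : set (R -> R[i]) :=
  [set f : R -> R[i] | forall i, (i <= j)%N -> exists2 g, L2loc g & weak_deriv i f g].

Definition period_cell (R : realType) : set R := `]0, (2 * pi)[.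
Arguments period_cell : clear implicits.

(* Periodicity is required everywhere, not almost everywhere: every class has such
   a representative. *)
Definition Hper (R : realType) (j : nat) : set (R -> R[i]) :=
  [set f : R -> R[i] | Hloc j f /\ forall z : R, f (z + 2 * pi) = f z].

Definition Hper_norm (R : realType) (j : nat) (f : R -> R[i]) : R :=
  Num.sqrt (\sum_(i < j.+1)
    \int[@lebesgue_measure R]_(x in period_cell R) (normc (wD i f x) ^+ 2)).

Definition of_real (R : realType) (q : R -> R) : R -> R[i] := fun z => (q z)%:C.

(* An unbounded operator in [L2on D], given by its graph. *)
Definition operator (R : realType) := (R -> R[i]) -> (R -> R[i]) -> Prop.

(* [E / (E `&` N)] has dimension [n]. *)
Definition dim_mod (K : fieldType) (V : lmodType K) (E N : set V) (n : nat) : Prop :=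
  exists e : 'I_n -> V,
    [/\ forall i, E (e i),
        forall u, E u -> exists a : 'I_n -> K, N (u - \sum_(i < n) a i *: e i) &
        forall a : 'I_n -> K, N (\sum_(i < n) a i *: e i) -> forall i, a i = 0].

Section Operators.
Variables (R : realType) (D : set R).
Implicit Types (T : operator R) (nu : R[i]).

Definition shift_op T nu : operator R :=
  fun f g => exists2 h, T f h & g = (fun x => h x - nu * f x).

Definition range_op T : set (R -> R[i]) := [set g | exists f, T f g].

(* The kernel of the [n]-th power; the domain of [T ^ n.+1] consists of the [f]
   in the domain of [T] such that [T f] is in the domain of [T ^ n]. *)
Fixpoint ker_pow T (n : nat) : set (R -> R[i]) :=
  if n is m.+1 then [set f | exists2 g, T f g & ker_pow T m g] else null_on D.

Definition closed_range T : Prop :=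
  forall (g_ : nat -> R -> R[i]) (g : R -> R[i]),
    (forall n, range_op T (g_ n)) -> L2on D g ->
    (fun n => L2dist D (g_ n) g) @ \oo --> (0 : R) -> range_op T g.

Definition fredholm_of_index T (i : int) : Prop :=
  exists d e : nat,
    [/\ closed_range T,
        dim_mod (ker_pow T 1) (null_on D) d,
        dim_mod (L2on D) (range_op T) e &
        i = d%:Z - e%:Z].

Definition ess_spectrum T : set R[i] :=
  [set nu | ~ fredholm_of_index (shift_op T nu) 0].

(* The algebraic multiplicity is the dimension of the generalized eigenspace; it
   is at least one exactly when [nu] is an eigenvalue. *)
Definition simple_eigenvalue T nu : Prop :=
  dim_mod (\bigcup_n ker_pow (shift_op T nu) n) (null_on D) 1.

End Operators.

(* The graph of [L * d_z - d_z^2 (k^4 d_z^4 + k^2 d_z^2 - c + q)] acting in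
   [L2on D] with domain [dom]. For [q] and [f] in the Sobolev spaces of order 6
   used below, the weak derivative [h] always exists. *)
Definition KPop (R : realType) (D : set R) (dom : set (R -> R[i]))
    (L : R[i]) (k c : R) (q : R -> R) : operator R :=
  fun f g =>
    [/\ dom f, L2on D g &
        exists2 h,
          weak_deriv 2 (fun z => (k ^+ 4)%:C * wD 4 f z + (k ^+ 2)%:C * wD 2 f z
                                 - c%:C * f z + (q z)%:C * f z) h &
          ae_eq (@lebesgue_measure R) D g (fun z => L * wD 1 f z - h z)].

Definition KPop_per (R : realType) (L : R[i]) (k c : R) (q : R -> R) : operator R :=
  KPop (period_cell R) (Hper 6) L k c q.

Definition KPop_line (R : realType) (L : R[i]) (k c : R) (q : R -> R) : operator R :=
  KPop [set: R] (Hline 6) L k c q.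

(* [KPop_line lam 1 c phi] is [lam * d_x - d_x^2 (d_x^4 + d_x^2 - c + phi)]. *)
Definition transversely_essentially_unstable (R : realType) (c : R) (phi : R -> R) :
    Prop :=
  exists (lam : R[i]) (omega : R),
    [/\ 0 < complex.Re lam,
        - omega ^+ 2 < 0 &
        ess_spectrum [set: R] (KPop_line lam 1 c phi) ((- omega ^+ 2)%:C)].

(* Real analyticity on [(-a0, a0) x (-c0, c0)] of a map with values in the
   subspace [S] normed by [N]. Boundedness of [N (q n m) * r ^+ (n + m)] makes the
   double power series converge absolutely, so the order of summation is
   irrelevant. *)
Definition analytic2 (R : realType) (V : lmodType R) (S : set V) (N : V -> R)
    (a0 c0 : R) (F : R -> R -> V) : Prop :=
  forall a1 c1 : R, `|a1| < a0 -> `|c1| < c0 ->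
    exists (r M : R) (q : nat -> nat -> V),
      [/\ 0 < r,
          forall n m, S (q n m) /\ N (q n m) * r ^+ (n + m) <= M &
          forall a c : R, `|a| < a0 -> `|c| < c0 -> `|a - a1| < r -> `|c - c1| < r ->
            (fun n0 => N (F a c - \sum_(n < n0) \sum_(m < n0)
                           ((a - a1) ^+ n * (c - c1) ^+ m) *: q n m))
              @ \oo --> (0 : R)].

Definition solves_wave_eq (R : realType) (c : R) (u : R -> R) : Prop :=
  (forall (n : nat) (x : R), (n < 4)%N -> derivable (derive1n n u) x 1) /\
  forall x : R, derive1n 4 u x + derive1n 2 u x - c * u x + 2^-1 * u x ^+ 2 = 0.

(* [Num.sqrt] vanishes on negative numbers; in [KP_family] the analyticity of [k]
   at [(0, c)] excludes [c <= - 1 / 4]. *)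
Definition k_zero (R : realType) (c : R) : R :=
  Num.sqrt ((1 + Num.sqrt (1 + 4 * c)) / 2).

Definition wave (R : realType) (k : R -> R -> R) (p : R -> R -> R -> R) (a c : R) :
  R -> R := fun x => p a c (k a c * x).

Definition fourier_coef (R : realType) (f : R -> R) (q : int) : R[i] :=
  ((2 * pi)^-1)%:C *
  Cintegral (period_cell R) (fun z => (f z)%:C * cis (- (q%:~R * z))).

(* [n + m >= 2] and [n - m <> 1, -1]. *)
Definition p_index (n m : nat) : bool :=
  [&& (2 <= n + m)%N, n != m.+1 & m != n.+1].

(* The double series of [KP_expansions] is summed over squares; it converges
   absolutely for [`|a| < rho0]. The bounds in the two [O]-estimates are uniform in
   [c]. *)
Record KP_family (R : realType) (a0 c0 : R) (k : R -> R -> R)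
    (p : R -> R -> R -> R) : Prop := {
  KP_a0_gt0 : 0 < a0;
  KP_c0_gt0 : 0 < c0;
  KP_even : forall a c x : R, `|a| < a0 -> `|c| < c0 ->
    wave k p a c (- x) = wave k p a c x;
  KP_solution : forall a c : R, `|a| < a0 -> `|c| < c0 ->
    solves_wave_eq c (wave k p a c);
  KP_k_analytic : @analytic2 R R^o setT (fun x => `|x|) a0 c0 k;
  KP_p_Hper : forall a c : R, `|a| < a0 -> `|c| < c0 ->
    Hper 6 (of_real (p a c));
  KP_p_analytic :
    @analytic2 R (R -> R^o) [set q | Hper 6 (of_real q)]
      (fun q => Hper_norm 6 (of_real q)) a0 c0 p;
  KP_expansions : exists rho0 K0 C0 : R, [/\ 0 < rho0, 0 < K0, 0 < C0,
    (* [kt n] is the coefficient of index [2 n] *)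
    exists kt : nat -> R -> R,
      (forall (n : nat) (c : R), (1 <= n)%N -> `|c| < c0 ->
         `|kt n c| <= K0 / rho0 ^+ (2 * n)) /\
      (forall a c : R, `|a| < a0 -> `|c| < c0 ->
         exists2 ktilde : R,
           (fun n0 => \sum_(1 <= n < n0) kt n c * a ^+ (2 * n)) @ \oo --> ktilde &
           k a c = k_zero c + c * ktilde) &
    exists pt : nat -> nat -> R -> R,
      (forall (n m : nat) (c : R), p_index n m -> `|c| < c0 ->
         pt n m c = pt m n c /\ `|pt n m c| <= C0 / rho0 ^+ (n + m)) /\
      (forall a c z : R, `|a| < a0 -> `|c| < c0 ->
         exists2 S : R[i],
           cvgC (fun n0 => \sum_(n < n0) \sum_(m < n0 | p_index n m)
                  (pt n m c)%:C * cis ((n%:R - m%:R) * z) * (a ^+ (n + m))%:C) S &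
           (p a c z)%:C = (a * c * cos z)%:C + c%:C * S)];
  KP_fourier_real : forall (a c : R) (q : int), `|a| < a0 -> `|c| < c0 ->
    complex.Im (fourier_coef (p a c) q) = 0;
  KP_fourier_zero : exists M d : R, 0 < d /\
    forall a c : R, `|a| < a0 -> `|c| < c0 -> `|a| < d ->
      normc (fourier_coef (p a c) 0) <= M * (`|c| * a ^+ 2);
  KP_fourier_nonzero : forall q : int, q != 0 -> exists M d : R, 0 < d /\
    forall a c : R, `|a| < a0 -> `|c| < c0 -> `|a| < d ->
      normc (fourier_coef (p a c) q) <= M * (`|c| * `|a| ^+ `|q|%N);
  KP_fourier_parity : forall (a c : R) (q : int), `|a| < a0 -> `|c| < c0 ->
    fourier_coef (p (- a) c) q = (-1) ^+ `|q|%N * fourier_coef (p a c) q;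
  KP_half_period : forall a c z : R, `|a| < a0 -> `|c| < c0 ->
    p (- a) c z = p a c (z + pi)
}.

(* Main.v *)
Require Import Defs.
From HB Require Import structures.
From mathcomp Require Import all_boot all_order all_algebra.
From mathcomp Require Import complex.
From mathcomp Require Import all_classical all_reals all_analysis.
From mathcomp Require Import measurable_realfun.
From mathcomp Require Import ring lra zify.
Set Implicit Arguments.
Unset Strict Implicit.
Unset Printing Implicit Defensive.
Import Order.TTheory GRing.Theory Num.Theory.
Import numFieldNormedType.Exports.
Local Open Scope classical_set_scope.
Local Open Scope ring_scope.

(** An eigenfunction of the periodic problem is a bounded periodic solution [f] of
    [T f = nu f] on the line, where [T] is the operator with periodic coefficients, and
    this forces [nu] into the essential spectrum of [T]. Suppose indeed that [T - nu] is
    Fredholm on the line.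

    - Its kernel is finite dimensional and invariant under translation by the period. If
      it were nonzero, the translation would have an eigenvector in it; but a
      square-integrable function tends to zero along almost every arithmetic progression,
      in both directions, and an eigenvector of a translation cannot
      ([translation_invariant_null]). So [T - nu] is injective.
    - Let [s] be the logistic function. The product [s f] is not square integrable, but
      [(T - nu)(s f)] is, since it involves only derivatives of [s]; it is the limit of
      the images of [(s(x) - s(e x)) f], which do belong to the domain. As the range is
      closed, [(T - nu)(s f) = (T - nu) u] for some [u] in the domain. The function
      [w = s f - u] is then periodic by injectivity, as its translation difference is in
      the domain. But [w] behaves like [f] at plus infinity and tends to zero at minus
      infinity, so [f = 0].

    This is [periodic_eigenfunction_not_fredholm]; it requires smooth coefficients. If
    the wave number [k] is nonzero, the profile is a dilation of the wave, and the wave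
    is smooth because its equation expresses the fourth derivative by lower ones
    ([wave_smooth]). The first assertion follows. For the second one, dilate by [|k|],
    which is allowed since the wave is even: if [nu] is the eigenvalue for [L], then
    [k ^ 2 * nu = - omega ^ 2] is in the essential spectrum of the operator in the
    original variable for [lam = |k| * L] ([KPform_dilation], [wave_unstable]).

    There remains to show that [k] is nonzero ([wave_number_neq0]). For fixed [c] it is
    an analytic function of the amplitude, positive at zero amplitude, so its zeros are
    isolated ([zeros_isolated]) and a zero is a limit of amplitudes for which the profile
    is smooth and satisfies [k^4 p'''' + k^2 p'' - c p + p^2 / 2 = 0]. In the limit
    [p^2 = 2 c p], and differentiation gives [(p - c) p' = 0]. As [p = c] contradicts the
    first equation when [c] is nonzero, [p' = 0] and [p] is constant
    ([degenerate_wave_cst]). The periodic operator then has constant coefficients and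
    order two, and an energy argument shows that it has no negative eigenvalue
    ([periodic_constant_coefficients]), contrary to the hypothesis.

    All coefficients are real, so complex functions are split into real and imaginary
    parts, and elements of the domains are represented by chains [F 0], ..., [F 6] of
    real functions, each the weak derivative of the preceding one. *)

(** * Affine changes of variables *)
Section AffineChange.
Context {R : realType}.
Local Notation mu := (@lebesgue_measure R).

(** Selects, among the measurable structures on the real numbers, the one on which the
    Lebesgue measure is defined. *)
Lemma measurable_itvR (i : interval R) :
  @measurable _ (measurableTypeR R) [set` i].
Proof. exact: measurable_itv. Qed.

Lemma ae_weaken (P Q : R -> Prop) : (forall x, P x -> Q x) ->
  {ae mu, forall x, P x} -> {ae mu, forall x, Q x}.
Proof. by move=> PQ aP; apply: (@filterS _ _ (ae_filter_ringOfSetsType mu) _ _ PQ). Qed.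

Lemma ae_weaken2 (P Q S : R -> Prop) : (forall x, P x -> Q x -> S x) ->
  {ae mu, forall x, P x} -> {ae mu, forall x, Q x} -> {ae mu, forall x, S x}.
Proof.
by move=> PQS aP aQ; apply: (@filterS2 _ _ (ae_filter_ringOfSetsType mu) _ _ _ PQS).
Qed.

Definition affine (al be : R) : R -> R := fun x => al * x + be.

Lemma measurable_affine (al be : R) :
  measurable_fun [set: measurableTypeR R] (affine al be : _ -> measurableTypeR R).
Proof. by apply: measurable_funD => //; exact: measurable_funM. Qed.

(* The pushforward is a measure only once the map is known to be measurable. *)
Local Notation image_measure al be :=
  (measure_function_pushforward__canonical__measure_function_Measure mu
     (measurable_affine al be)).

(** Both sides are measures, and they agree on half-open intervals. *)
Lemma lebesgue_measure_affine (al be : R) (A : set R) : 0 < al -> measurable A ->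
  mu A = (al%:E * mu (affine al be @^-1` A))%E.
Proof.
move=> al0 mA.
pose m := mscale (NngNum (ltW al0)) (image_measure al be).
suff : mu A = m A by [].
apply/lebesgue_measure_unique => //= _ [[a b]] _ <-.
rewrite /m /mscale /=.
rewrite (_ : pushforward _ _ _ = mu `](a - be) / al, (b - be) / al]%classic); last first.
  congr (mu _); apply/seteqP; split => x /=;
    by rewrite !in_itv/= ltr_pdivrMr// ler_pdivlMr// /affine ltrBlDr lerBrDr [x * _]mulrC.
rewrite !lebesgue_measure_itv/= !lte_fin ltr_pM2r ?invr_gt0// ltrD2r.
case: ifP => _; last by rewrite mule0.
by rewrite -!EFinB -EFinM; congr (_%:E); field; rewrite gt_eqF.
Qed.

Lemma ge0_integral_affine (al be : R) (D : set R) (F : R -> \bar R) : 0 < al ->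
  measurable D -> measurable_fun D F -> (forall x, D x -> (0 <= F x)%E) ->
  (\int[mu]_(x in D) F x = al%:E * \int[mu]_(x in affine al be @^-1` D) F (affine al be x))%E.
Proof.
move=> al0 mD mF F0.
rewrite -(ge0_integral_pushforward (measurable_affine al be))//; last first.
  by move=> y; rewrite inE; exact: F0.
have := @ge0_integral_mscale _ _ R (image_measure al be) D mD (NngNum (ltW al0)) F mF F0.
move=> /= <-.
by apply: eq_measure_integral => A mA _; exact: lebesgue_measure_affine.
Qed.

Lemma ae_affine (al be : R) (Q : set R) : 0 < al ->
  {ae mu, forall x, Q x} -> {ae mu, forall x, Q (affine al be x)}.
Proof.
move=> al0 [N [mN N0 sN]].
exists (affine al be @^-1` N); split.
- by rewrite -[X in measurable X]setTI; exact: (measurable_affine al be).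
- apply/eqP; rewrite -measure_le0 -(@lee_pmul2l _ al%:E)// ?lte_fin// mule0.
  by rewrite -lebesgue_measure_affine// N0.
- by move=> x /= nQ; apply: sN.
Qed.

Lemma ae_translate (h : R) (Z : R -> Prop) : {ae mu, forall x, Z x} ->
  {ae mu, forall x, Z (x + h)}.
Proof.
by move=> /(ae_affine h ltr01); apply: ae_weaken => x; rewrite /affine mul1r.
Qed.

Lemma integrable_affine (al be : R) (D : set R) (F : R -> \bar R) : 0 < al ->
  measurable D -> mu.-integrable D F ->
  mu.-integrable (affine al be @^-1` D) (F \o affine al be).
Proof.
move=> al0 mD /integrableP[mF iF].
have mD' : measurable (affine al be @^-1` D).
  by rewrite -[X in measurable X]setTI; exact: (measurable_affine al be).
apply/integrableP; split.
  by apply: (measurable_comp mD) => //;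
   [move=> _ [x + <-]|exact: measurable_funS (measurable_affine al be)].
move: iF; rewrite (@ge0_integral_affine al be)//; last exact: measurableT_comp.
have [al1|] := ltP (\int[mu]_(x in affine al be @^-1` D) `|(F \o affine al be) x|)%E +oo%E.
  by [].
by rewrite leye_eq => /eqP; rewrite /comp => ->; rewrite gt0_muley// lte_fin.
Qed.

Lemma integral_affine (al be : R) (D : set R) (F : R -> \bar R) : 0 < al ->
  measurable D -> mu.-integrable D F ->
  (\int[mu]_(x in D) F x = al%:E * \int[mu]_(x in affine al be @^-1` D) F (affine al be x))%E.
Proof.
move=> al0 mD iF; have mF := measurable_int mu iF.
have iG := integrable_affine be al0 mD iF.
have mD' : measurable (affine al be @^-1` D).
  by rewrite -[X in measurable X]setTI; exact: (measurable_affine al be).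
have pos := ge0_integral_affine be al0 mD (measurable_funepos mF)
  (fun x _ => funepos_ge0 F x).
have neg := ge0_integral_affine be al0 mD (measurable_funeneg mF)
  (fun x _ => funeneg_ge0 F x).
have E : (\int[mu]_(x in affine al be @^-1` D) F (affine al be x) =
    \int[mu]_(x in affine al be @^-1` D) F^\+ (affine al be x) -
    \int[mu]_(x in affine al be @^-1` D) F^\- (affine al be x))%E.
  have := integralE mu (affine al be @^-1` D) (F \o affine al be).
  by rewrite funepos_comp funeneg_comp.
have H := @integrable_add_def _ _ _ mu _ mD' _ iG.
rewrite funepos_comp funeneg_comp in H.
by rewrite E integralE pos neg -(muleBr _ H).
Qed.

Lemma Rintegral_affine (al be : R) (D : set R) (F : R -> R) : 0 < al ->
  measurable D -> mu.-integrable D (EFin \o F) ->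
  \int[mu]_(x in D) F x = al * \int[mu]_(x in affine al be @^-1` D) F (affine al be x).
Proof.
move=> al0 mD iF; rewrite /Rintegral (@integral_affine al be)//.
have mD' : measurable (affine al be @^-1` D).
  by rewrite -[X in measurable X]setTI; exact: (measurable_affine al be).
rewrite fineM//; apply: integrable_fin_num => //.
exact: (integrable_affine be al0 mD iF).
Qed.

Lemma measurable_fun_affine (al be : R) (F : R -> R) :
  measurable_fun [set: R] F -> measurable_fun [set: R] (F \o affine al be).
Proof. by move=> mF; exact: measurableT_comp mF (measurable_affine al be). Qed.

End AffineChange.

(** * Smooth functions and test functions *)
Section Smooth.
Context {R : realType}.
Implicit Types (f g a : R -> R) (A B : nat -> R -> R).

Definition smooth f := forall (n : nat) (x : R), derivable (derive1n n f) x 1.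

(** A function together with all its derivatives, so that each derivative can be
    given by a closed formula. *)
Definition derivs A := forall (n : nat) (x : R), is_derive x (1 : R) (A n) (A n.+1 x).

Lemma smooth_derivs f : smooth f -> derivs (fun n => derive1n n f).
Proof.
move=> sf n x; rewrite derive1nS derive1E; exact/derivableP/sf.
Qed.

Lemma derive1nE A n : derivs A -> derive1n n (A 0%N) = A n.
Proof.
move=> dA; elim: n => [|n IH]; first by rewrite derive1n0.
by rewrite derive1nS IH; apply/funext => x; rewrite derive1E; have [_ ->] := dA n x.
Qed.

Lemma derivs_smooth A : derivs A -> smooth (A 0%N).
Proof. by move=> dA n x; rewrite derive1nE//; case: (dA n x). Qed.

Lemma derivs_shift A : derivs A -> derivs (fun n => A n.+1).
Proof. by move=> dA n x; exact: dA. Qed.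

Lemma derivs_continuous A n : derivs A -> continuous (A n).
Proof.
move=> dA x; apply/differentiable_continuous/derivable1_diffP.
by case: (dA n x).
Qed.

Lemma smooth_continuous f : smooth f -> continuous f.
Proof. by move=> /smooth_derivs/(@derivs_continuous _ 0%N). Qed.

Lemma smooth_derive1 f : smooth f -> smooth (derive1 f).
Proof. by move=> sf n x; rewrite -derive1Sn; exact: sf. Qed.

Lemma derivs_cst (k : R) : derivs (fun n => if n is 0%N then cst k else cst 0).
Proof. by move=> [|n] x; exact: is_derive_cst. Qed.

Lemma derivs_affine (al be : R) A : derivs A ->
  derivs (fun n x => al ^+ n * A n (al * x + be)).
Proof.
move=> dA n x; rewrite exprSr -mulrA; apply: is_deriveZ.
have d1 : is_derive x 1 (fun y : R => al * y + be) al.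
  have h : is_derive x 1 (fun y : R => al * y) (al * 1) by exact: is_deriveZ.
  by have := is_deriveD h (is_derive_cst be x 1); rewrite mulr1 addr0.
by rewrite [al * A _ _]mulrC; exact: (@is_derive1_comp _ (A n) (fun y => al * y + be) x _ _ (dA n _) d1).
Qed.

Definition leibniz A B : nat -> R -> R :=
  fun n x => \sum_(i < n.+1) 'C(n, i)%:R * (A (n - i)%N x * B i x).

(** Pascal's rule turns the derivative of the Leibniz sum of order [n] into the one of
    order [n + 1]. *)
Lemma leibniz_step (u v : nat -> R) (n : nat) :
  \sum_(i < n.+1) 'C(n, i)%:R * (u (n - i).+1%N * v i + u (n - i)%N * v i.+1) =
  \sum_(i < n.+2) 'C(n.+1, i)%:R * (u (n.+1 - i)%N * v i).
Proof.
under eq_bigr do rewrite mulrDr; rewrite big_split/= [RHS]big_ord_recl/=.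
rewrite bin0 mul1r subn0.
under [in RHS]eq_bigr do rewrite /bump/= add1n binS natrD mulrDl subSS.
rewrite big_split/= addrA; congr (_ + _).
rewrite [X in _ = _ + X]big_ord_recr/= (@bin_small n n.+1)// mul0r addr0.
rewrite [LHS]big_ord_recl/= bin0 mul1r subn0; congr (_ + _).
apply: eq_bigr => i _; rewrite /bump/= add1n; congr (_ * (u _ * _)).
by have := ltn_ord i; lia.
Qed.

Lemma is_derive_leibniz A B n (x : R) :
  (forall i, (i <= n)%N -> is_derive x (1 : R) (A i) (A i.+1 x)) ->
  (forall i, (i <= n)%N -> is_derive x (1 : R) (B i) (B i.+1 x)) ->
  is_derive x (1 : R) (leibniz A B n) (leibniz A B n.+1 x).
Proof.
move=> dA dB; rewrite /leibniz -(leibniz_step (A ^~ x) (B ^~ x)).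
have -> : (fun y => \sum_(i < n.+1) 'C(n, i)%:R * (A (n - i)%N y * B i y)) =
  \sum_(i < n.+1) (fun y => 'C(n, i)%:R * (A (n - i)%N y * B i y)).
  by apply/funext => y; rewrite fct_sumE.
apply: is_derive_sum => i; apply: is_deriveZ.
have := is_deriveM (dA (n - i)%N (leq_subr _ _)) (dB i (ltn_ord i)).
by rewrite /GRing.scale/= addrC [_ * A _ x]mulrC; apply.
Qed.

Lemma derivs_leibniz A B : derivs A -> derivs B -> derivs (leibniz A B).
Proof. by move=> dA dB n x; exact: is_derive_leibniz. Qed.

Lemma leibniz0 A B : leibniz A B 0%N = fun x => A 0%N x * B 0%N x.
Proof. by apply/funext => x; rewrite /leibniz big_ord1 bin0 mul1r. Qed.

Lemma smoothM f g : smooth f -> smooth g -> smooth (fun x => f x * g x).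
Proof.
move=> /smooth_derivs df /smooth_derivs dg.
by have := derivs_smooth (derivs_leibniz df dg); rewrite leibniz0.
Qed.

Lemma smooth_affine (al be : R) f : smooth f -> smooth (fun x => f (al * x + be)).
Proof.
move=> /smooth_derivs df; have := derivs_smooth (derivs_affine al be df).
by under eq_fun do rewrite expr0 mul1r.
Qed.

Lemma derive1M f g x : smooth f -> smooth g ->
  derive1 (fun x => f x * g x) x = derive1 f x * g x + f x * derive1 g x.
Proof.
move=> sf sg; rewrite !derive1E.
have [_ ->] := is_deriveM (derivableP (sf 0%N x)) (derivableP (sg 0%N x)).
by rewrite /GRing.scale/= addrC mulrC.
Qed.

Lemma derive1_affine f (al be : R) x : smooth f ->
  derive1 (fun x => f (al * x + be)) x = al * derive1 f (al * x + be).
Proof.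
move=> sf; have := derivs_affine al be (smooth_derivs sf).
move=> /(_ 0%N x) [_]; rewrite expr0 expr1 derive1E => <-.
by congr ('D_1 _ x); apply/funext => y; rewrite mul1r.
Qed.

Lemma test_functionE (phi : R -> R) : test_function phi <->
  smooth phi /\ exists2 M : R, 0 < M & forall x, M <= `|x| -> phi x = 0.
Proof.
split=> -[sphi].
  move=> [M hM]; split => //; exists (`|M| + 1) => [|x Mx].
    by rewrite ltr_wpDl.
  by apply: hM; rewrite (lt_le_trans _ Mx)// (le_lt_trans (ler_norm _))// ltrDl.
by move=> [M _ hM]; split => //; exists M => x /ltW; exact: hM.
Qed.

Lemma test_smooth (phi : R -> R) : test_function phi -> smooth phi.
Proof. by move=> /test_functionE[]. Qed.

Lemma derive1_eq0 f (M : R) : (forall x, M < `|x| -> f x = 0) ->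
  forall x, M < `|x| -> derive1 f x = 0.
Proof.
move=> f0 x Mx; rewrite derive1E -(derive_cst (0 : R) x 1).
apply: near_eq_derive.
have : \forall y \near x, M < `|y|.
  have c : Num.norm y @[y --> x] --> `|x| by exact: norm_continuous.
  exact: cvgr_gt c _ Mx.
by apply: filterS => y; exact: f0.
Qed.

Lemma test_derive1 (phi : R -> R) : test_function phi -> test_function (derive1 phi).
Proof.
move=> [sphi [M hM]]; split; first exact: smooth_derive1.
by exists M; exact: derive1_eq0.
Qed.

Lemma test_derive1n n (phi : R -> R) : test_function phi -> test_function (derive1n n phi).
Proof.
by move=> tphi; elim: n => [//|n IH]; rewrite derive1nS; exact: test_derive1.
Qed.

Lemma testM a (phi : R -> R) : smooth a -> test_function phi ->
  test_function (fun x => a x * phi x).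
Proof.
move=> sa [sphi [M hM]]; split; first exact: smoothM.
by exists M => x /hM ->; rewrite mulr0.
Qed.

Lemma test_affine (al be : R) (phi : R -> R) : al != 0 -> test_function phi ->
  test_function (fun x => phi (al * x + be)).
Proof.
move=> al0 [sphi [M hM]]; split; first exact: smooth_affine.
exists ((M + `|be|) / `|al|) => x.
rewrite ltr_pdivrMr ?normr_gt0// => Mx; apply: hM.
have := ler_normB (al * x + be) be; rewrite addrK normrM => h.
by move: Mx; rewrite mulrC => Mx; have := lt_le_trans Mx h; rewrite ltrD2r.
Qed.

End Smooth.

(** * Bump functions *)
Section Bump.
Context {R : realType}.
Implicit Types (P Q : {poly R}).

(** Take the [k]-th power of [1 + t <= exp t] at [t = y / k]. *)
Lemma exprn_le_expR (k : nat) (y : R) : 0 <= y -> y ^+ k <= k%:R ^+ k * expR y.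
Proof.
case: k => [|k] y0; first by rewrite !expr0 mul1r; apply: le_trans (expR_ge1Dx y); rewrite lerDl.
have k0 : 0 < k.+1%:R :> R by rewrite ltr0n.
have -> : expR y = expR (y / k.+1%:R) ^+ k.+1.
  by rewrite -expRM_natl mulrC divfK// gt_eqF.
rewrite -exprMn lerXn2r ?nnegrE ?mulr_ge0 ?expR_ge0 ?(ltW k0)//.
rewrite -ler_pdivrMl// mulrC; apply: le_trans (expR_ge1Dx _).
by rewrite lerDr.
Qed.

(** With [y = 1 / x], this controls the derivatives of [exp (- 1 / x)] near the
    origin. *)
Lemma horner_le_expR Q : exists C : R, 0 <= C /\ forall y : R, 0 <= y -> `|Q.[y]| <= C * expR y.
Proof.
exists (\sum_(i < size Q) `|Q`_i| * i%:R ^+ i); split.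
  by apply: sumr_ge0 => i _; rewrite mulr_ge0// exprn_ge0.
move=> y y0; rewrite horner_coef (le_trans (ler_norm_sum _ _ _))// mulr_suml.
apply: ler_sum => i _; rewrite normrM -mulrA ler_wpM2l//.
by rewrite ger0_norm ?exprn_ge0// exprn_le_expR.
Qed.

(** Used at the origin, where the two branches of the bump function meet. *)
Lemma is_derive_quadratic (f : R -> R) (x C : R) :
  (forall h, `|f (x + h) - f x| <= C * h ^+ 2) -> is_derive x (1 : R) f 0.
Proof.
move=> fC; have C0 : 0 <= C.
  by have := le_trans (normr_ge0 _) (fC 1); rewrite expr1n mulr1.
have cv : (fun h : R => h^-1 *: (f (h *: (1 : R) + x) - f x)) @ 0^' --> (0 : R).
  apply/cvgr0Pnorm_le => e e0; near=> h.
  have h0 : 0 < `|h| by rewrite normr_gt0; near: h; exact: nbhs_dnbhs_neq.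
  have hC : `|h| <= e / (C + 1).
    by apply: ltW; near: h; apply: dnbhs0_lt; rewrite divr_gt0// ltr_wpDl.
  rewrite /GRing.scale/= mulr1 [h + x]addrC normrM normfV ler_pdivrMl//.
  apply: le_trans (fC h) _; rewrite -[h ^+ 2]real_normK ?num_real// expr2 mulrCA.
  rewrite ler_wpM2l// (le_trans (ler_wpM2l C0 hC))// mulrCA ler_piMr ?(ltW e0)//.
  by rewrite ler_pdivrMr ?ltr_wpDl// mul1r lerDl.
split; first by apply/cvg_ex; exists 0.
exact: cvg_lim.
Unshelve. all: by end_near. Qed.

Definition bump_poly (n : nat) : {poly R} := iter n (fun P => 'X^2 * (P - P^`())) 1.

(** The [n]-th derivative of the function equal to [exp (- 1 / x)] for positive
    [x] and to [0] otherwise. *)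
Definition halfbump (n : nat) (x : R) : R :=
  if 0 < x then (bump_poly n).[x^-1] * expR (- x^-1) else 0.

(** The exponential bound is applied to ['X^2 * bump_poly n] to gain the factor [x ^
    2]. *)
Lemma halfbump_bound n : exists C : R, forall x, `|halfbump n x| <= C * x ^+ 2.
Proof.
have [C [C0 hC]] := horner_le_expR ('X^2 * bump_poly n).
exists C => x; rewrite /halfbump; case: ifPn => x0; last first.
  by rewrite normr0 mulr_ge0// sqr_ge0.
have := hC x^-1; rewrite invr_ge0 (ltW x0) => /(_ isT).
rewrite hornerM hornerXn normrM ger0_norm ?exprn_ge0 ?invr_ge0 ?(ltW x0)// => h.
rewrite normrM (ger0_norm (expR_ge0 _)) expRN ler_pdivrMr ?expR_gt0//.
rewrite -mulrA [X in _ <= _ * X]mulrC mulrA -ler_pdivrMr ?exprn_gt0//.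
by rewrite mulrC -exprVn.
Qed.

Lemma halfbump_derivs : derivs halfbump.
Proof.
move=> n x; have [x0|x0|->] := ltgtP x 0.
- rewrite {2}/halfbump ltNge (ltW x0)/=.
  apply: (near_eq_is_derive _ (is_derive_cst (0 : R) x 1)).
  have : \forall y \near x, y < 0 by exact: lt_nbhsl.
  by apply: filterS => y y0; rewrite /halfbump ltNge (ltW y0).
- rewrite {2}/halfbump x0.
  have xn0 : x != 0 by rewrite gt_eqF.
  have dV : is_derive x (1 : R) (fun y : R => y^-1) (- x ^- 2 *: 1) by exact: is_deriveV.
  have dP := is_derive1_comp (is_derive_poly (bump_poly n) x^-1) dV.
  have dN : is_derive x (1 : R) (fun y : R => - y^-1) (- (- x ^- 2 *: 1)) := is_deriveN dV.
  have dE := @is_derive1_comp _ expR (fun y => - y^-1) x _ _ (is_derive_expR _) dN.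
  have D : is_derive x (1 : R) (fun y => (bump_poly n).[y^-1] * expR (- y^-1))
      ((bump_poly n.+1).[x^-1] * expR (- x^-1)).
    apply: is_derive_eq (is_deriveM dP dE) _.
    rewrite /bump_poly iterS -/(bump_poly n) hornerM hornerXn hornerD hornerN /GRing.scale/=.
    by rewrite exprVn; ring.
  apply: (near_eq_is_derive _ D).
  have : \forall y \near x, 0 < y by exact: lt_nbhsr.
  by apply: filterS => y y0; rewrite /halfbump y0.
- rewrite {2}/halfbump ltxx.
  have [C hC] := halfbump_bound n; apply: (@is_derive_quadratic _ _ C) => h.
  by rewrite add0r {2}/halfbump ltxx subr0.
Qed.

Lemma halfbump0E x : halfbump 0 x = if 0 < x then expR (- x^-1) else 0.
Proof. by rewrite /halfbump /bump_poly /= hornerC mul1r. Qed.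

Lemma halfbump0_itv x : 0 <= halfbump 0 x <= 1.
Proof.
rewrite halfbump0E; case: ifPn => x0; last by rewrite lexx ler01.
by rewrite expR_ge0/= -expR0 ler_expR oppr_le0 invr_ge0 ltW.
Qed.

(** Test functions converging boundedly to the indicator function of [`]al, be[]. *)
Definition bumpfun (al be : R) (n : nat) (x : R) : R :=
  halfbump 0 (n.+1%:R * (x - al)) * halfbump 0 (n.+1%:R * (be - x)).

Lemma bumpfun_out al be n x : ~ (al < x < be) -> bumpfun al be n x = 0.
Proof.
move=> /negP; rewrite negb_and -!leNgt => h; rewrite /bumpfun !halfbump0E.
case/orP: h => h.
  by rewrite pmulr_rgt0 ?ltr0n// subr_gt0 ltNge h mul0r.
by rewrite [X in _ * X]ifF ?mulr0// pmulr_rgt0 ?ltr0n// subr_gt0 ltNge h.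
Qed.

Lemma bumpfun_test al be n : test_function (bumpfun al be n).
Proof.
split.
  have := smoothM (smooth_affine (al := n.+1%:R) (be := - (n.+1%:R * al)) (derivs_smooth halfbump_derivs))
    (smooth_affine (al := - n.+1%:R) (be := n.+1%:R * be) (derivs_smooth halfbump_derivs)).
  suff -> : (fun x => halfbump 0 (n.+1%:R * x + - (n.+1%:R * al)) *
      halfbump 0 (- n.+1%:R * x + n.+1%:R * be)) = bumpfun al be n by [].
  by apply/funext => x; rewrite /bumpfun mulrBr mulrBr mulNr [- _ + _]addrC.
exists (`|al| + `|be|) => x Mx; apply: bumpfun_out => /andP[ax xb].
move: Mx; apply/negP; rewrite -leNgt ler_norml; apply/andP; split.
  rewrite (le_trans _ (ltW ax))// lerNl (le_trans (ler_norm _))// normrN lerDl//.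
by rewrite (le_trans (ltW xb))// (le_trans (ler_norm _))// lerDr.
Qed.

Lemma bumpfun_itv al be n x : 0 <= bumpfun al be n x <= 1.
Proof.
have /andP[a0 a1] := halfbump0_itv (n.+1%:R * (x - al)).
have /andP[b0 b1] := halfbump0_itv (n.+1%:R * (be - x)).
by rewrite /bumpfun mulr_ge0//= mulr_ile1.
Qed.

Lemma bumpfun_cvg al be x : (fun n => bumpfun al be n x) @ \oo --> (\1_(`]al, be[) x : R).
Proof.
have half t : 0 < t -> (fun n => halfbump 0 (n.+1%:R * t)) @ \oo --> (1 : R).
  move=> t0; under eq_fun do rewrite halfbump0E pmulr_rgt0 ?ltr0n// t0 invfM mulrC.
  have h : (fun n => t^-1 * n.+1%:R^-1) @ \oo --> t^-1 * 0.
    by apply: cvgM; [exact: cvg_cst|exact: cvg_harmonic].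
  rewrite mulr0 in h.
  have := continuous_cvg _ (@continuous_expR R (- 0)) (cvgN h).
  by rewrite oppr0 expR0 => H; exact: H.
rewrite indicE; have [/[!inE]/=|/negP] := boolP (x \in `]al, be[%classic).
  rewrite in_itv/= => /andP[ax xb]; rewrite -[X in _ --> X]mulr1.
  by apply: cvgM; apply: half; rewrite subr_gt0.
rewrite inE/= in_itv/= => h; under eq_fun do rewrite bumpfun_out//; exact: cvg_cst.
Qed.

End Bump.

(** * Locally integrable functions and test functions *)
Section LocallyIntegrable.
Context {R : realType}.
Local Notation mu := (@lebesgue_measure R).
Implicit Types (F G a phi : R -> R).

Notation locint F := (locally_integrable [set: R] F).

Lemma locint_measurable F : locint F -> measurable_fun [set: R] F.
Proof. by case. Qed.

Lemma locint_itv F (x y : R) : locint F -> mu.-integrable `[x, y] (EFin \o F).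
Proof.
move=> [mF _ iF]; apply/integrableP; split.
  by apply/measurable_EFinP; exact: measurable_funS mF.
by apply: (iF `[x, y]%classic) => //; exact: segment_compact.
Qed.

Lemma itv_locint F : measurable_fun [set: R] F ->
  (forall M : R, mu.-integrable `[- M, M] (EFin \o F)) -> locint F.
Proof.
move=> mF iF; split => //; first exact: openT.
move=> K _ cK; have [M [Mr hM]] := compact_bounded cK.
have KM : K `<=` `[- (`|M| + 1), `|M| + 1].
  move=> x Kx /=; rewrite in_itv/= -ler_norml; apply: (hM (`|M| + 1)) => //.
  by rewrite (le_lt_trans (ler_norm _))// ltrDl.
have /integrableP[_] := iF (`|M| + 1).
apply: le_lt_trans; apply: ge0_subset_integral => //=.
- exact: compact_measurable.
- by apply/measurable_EFinP; apply: measurableT_comp => //; exact: measurable_funS mF.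
Qed.

Lemma locint_continuous F : continuous F -> locint F.
Proof.
move=> cF; apply: itv_locint; first exact: continuous_measurable_fun.
move=> M; apply: continuous_compact_integrable; first exact: segment_compact.
exact: continuous_subspaceT.
Qed.

Lemma itv_bounded F (x y : R) : continuous F -> exists2 B : R, 0 <= B &
  forall t, x <= t <= y -> `|F t| <= B.
Proof.
move=> cF; have := @segment_compact R x y.
have cf : {within `[x, y], continuous F} by exact: continuous_subspaceT.
move=> /(continuous_compact cf)/compact_bounded[M [Mr hM]].
exists (`|M| + 1) => [|t xty]; first by rewrite addr_ge0.
apply: (hM (`|M| + 1)); first by rewrite (le_lt_trans (ler_norm _))// ltrDl.
by exists t => //=; rewrite in_itv.
Qed.

Lemma locint_mul a F : continuous a -> locint F -> locint (fun x => a x * F x).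
Proof.
move=> ca lF; apply: itv_locint.
  by apply: measurable_funM; [exact: continuous_measurable_fun|exact: locint_measurable].
move=> M; have [B B0 hB] := itv_bounded (- M) M ca.
have := integrableZl (measurable_itvR _) B (integrable_abse (locint_itv (- M) M lF)).
apply: le_integrable => //.
  apply/measurable_EFinP; apply: measurable_funM; apply: measurable_funTS.
    exact: continuous_measurable_fun.
  exact: locint_measurable.
move=> x /=; rewrite in_itv/= => xM; rewrite lee_fin !normrM (ger0_norm B0) normr_id.
by rewrite ler_wpM2r// hB.
Qed.

Lemma locintZ (k : R) F : locint F -> locint (fun x => k * F x).
Proof. by apply: locint_mul => x; exact: cvg_cst. Qed.

Lemma locintD F G : locint F -> locint G -> locint (fun x => F x + G x).
Proof. exact: locally_integrableD. Qed.

Lemma locint_sum (n : nat) (H : nat -> R -> R) : (forall i, (i < n)%N -> locint (H i)) ->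
  locint (fun x => \sum_(i < n) H i x).
Proof.
elim: n => [|n IH] lH.
  by under eq_fun do rewrite big_ord0; apply: locint_continuous => x; exact: cvg_cst.
under eq_fun do rewrite big_ord_recr/=.
by apply: locintD; [apply: IH => i ni; apply: lH; rewrite ltnS ltnW|exact: lH].
Qed.

Lemma locint_ae F G : measurable_fun [set: R] G -> ae_eq mu [set: R] F G ->
  locint F -> locint G.
Proof.
move=> mG FG lF; apply: itv_locint => // M.
have /integrableP[mF iF] := locint_itv (- M) M lF.
apply/integrableP; split; first by apply/measurable_EFinP; exact: measurable_funS mG.
suff <- : (\int[mu]_(x in `[(- M)%R, M]) `|(F x)%:E| =
    \int[mu]_(x in `[(- M)%R, M]) `|(G x)%:E|)%E by [].
apply: ae_eq_integral => //.
- exact: measurableT_comp.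
- by apply: measurableT_comp => //; apply/measurable_EFinP; exact: measurable_funS mG.
- by apply: ae_weaken FG => x /(_ I) -> .
Qed.

Lemma locint_affine (al be : R) F : 0 < al -> locint F ->
  locint (fun x => F (al * x + be)).
Proof.
move=> al0 lF; apply: itv_locint.
  exact: (@measurable_fun_affine _ al be F (locint_measurable lF)).
move=> M.
have := integrable_affine be al0 (measurable_itvR _)
  (locint_itv (al * - M + be) (al * M + be) lF).
rewrite (_ : _ @^-1` _ = `[- M, M]%classic)//.
apply/seteqP; split => x /=; rewrite !in_itv/= /affine !lerD2r !ler_pM2l//.
Qed.

(** Only integrals over the support of a test function matter. *)
Lemma integrable_mul_test F phi : locint F -> test_function phi ->
  mu.-integrable [set: R] (EFin \o (fun x => F x * phi x)).
Proof.
move=> lF /test_functionE[sphi [M M0 hM]].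
have := (integrable_mkcond _ (measurable_itvR _)).1
  (locint_itv (- M) M (locint_mul (smooth_continuous sphi) lF)).
 apply: eq_integrable => // x _.
rewrite /= patchE; case: ifPn => [_|]; first by rewrite /= mulrC.
rewrite notin_setE/= in_itv/= -ler_norml => /negP; rewrite -ltNge => /ltW/hM ->.
by rewrite mulr0.
Qed.

Lemma Rintegral_ae (D : set R) F G : measurable D -> measurable_fun D F ->
  measurable_fun D G -> ae_eq mu D F G ->
  \int[mu]_(x in D) F x = \int[mu]_(x in D) G x.
Proof.
move=> mD mF mG FG; rewrite /Rintegral; congr fine.
apply: ae_eq_integral => //; try exact/measurable_EFinP.
by apply: ae_weaken FG => x + Dx => /(_ Dx) ->.
Qed.

(** The balls of radius [1 / (n + 1)] shrink nicely. *)
Lemma ball_averages_cvg F (x : R) : locint F -> lebesgue_pt F x ->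
  (fun n => (mu (ball x n.+1%:R^-1))^-1 * \int[mu]_(y in ball x n.+1%:R^-1) (F y)%:E)%E
    @ \oo --> (F x)%:E.
Proof.
move=> lF Lx; pose E (z : R) (n : nat) : set R := ball z n.+1%:R^-1.
have hE z : nicely_shrinking z (E z).
  split=> [n|]; first exact: measurable_ball.
  exists (1, fun n => PosNum (ltac:(by rewrite invr_gt0 ltr0n) : 0 < n.+1%:R^-1 :> R)).
  split => //=.
  - exact: cvg_harmonic.
  - by move=> n y.
  - by move=> n; rewrite mul1e.
by have := nice_lebesgue_differentiation hE lF Lx.
Qed.

(** Bump functions exhaust every bounded interval, so that all integrals over
    intervals vanish, and almost every point is a Lebesgue point. *)
Lemma du_bois_reymond F : locint F ->
  (forall phi, test_function phi -> \int[mu]_x (F x * phi x) = 0) ->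
  ae_eq mu [set: R] F (cst 0).
Proof.
move=> lF F0.
have itv0 (al be : R) : (\int[mu]_(x in `]al, be[) (F x)%:E = 0)%E.
  pose f_ n x := (F x * bumpfun al be n x)%:E.
  pose f x := (F x * \1_(`]al, be[) x)%:E.
  have mf_ n : measurable_fun [set: R] (f_ n).
    apply/measurable_EFinP; apply: measurable_funM; first exact: locint_measurable.
    exact: continuous_measurable_fun (smooth_continuous (test_smooth (bumpfun_test _ _ _))).
  have mf : measurable_fun [set: R] f.
    apply/measurable_EFinP; apply: measurable_funM; first exact: locint_measurable.
    exact: measurable_indic.
  have cvf : {ae mu, forall x, [set: R] x -> f_ n x @[n --> \oo] --> f x}.
    apply: aeW => x _; apply: cvg_EFin; first exact: nearW.
    by apply: cvgM; [exact: cvg_cst|exact: bumpfun_cvg].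
  have ig : mu.-integrable [set: R] (fun x => (`|F x| * \1_(`[al, be]) x)%:E).
    have := (integrable_mkcond _ (measurable_itvR _)).1 (integrable_abse (locint_itv al be lF)).
    apply: eq_integrable => // x _; rewrite /= patchE indicE.
    by case: ifPn => _; rewrite ?mulr1 ?mulr0.
  have dom : {ae mu, forall x n, [set: R] x ->
      (`|f_ n x| <= (`|F x| * \1_(`[al, be]) x)%:E)%E}.
    apply: aeW => x n _; rewrite lee_fin normrM ler_wpM2l// indicE.
    have [xab|xab] := pselect (al < x < be).
      rewrite mem_set/=; last by rewrite in_itv/=; case/andP: xab => /ltW -> /ltW ->.
      by have /andP[b0 b1] := bumpfun_itv al be n x; rewrite ger0_norm.
    by rewrite bumpfun_out// normr0; case: (_ \in _).
  have [_ _] := @dominated_convergence _ _ _ mu _ measurableT _ _ _ mf_ mf cvf ig dom.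
  have -> : (fun n => \int[mu]_x f_ n x)%E = cst 0%E.
    apply/funext => n; rewrite -[LHS]fineK; last first.
      apply: integrable_fin_num => //; exact: (integrable_mul_test lF (bumpfun_test al be n)).
    by have := F0 _ (bumpfun_test al be n); rewrite /Rintegral => ->.
  move=> /cvg_unique/(_ (cvg_cst _)) => E.
  rewrite integral_mkcond (_ : _ \_ _ = f); first exact: E.
  apply/funext => x; rewrite patchE /f indicE.
  by case: ifPn => _; rewrite ?mulr1 ?mulr0.
have ld : {ae mu, forall x, lebesgue_pt F x} := lebesgue_differentiation lF.
apply: ae_weaken ld => x Lx _; have := ball_averages_cvg lF Lx.
have -> : (fun n => (mu (ball x n.+1%:R^-1))^-1 *
    \int[mu]_(y in ball x n.+1%:R^-1) (F y)%:E)%E = cst 0%E.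
  by apply/funext => n; rewrite ball_itv itv0 mule0.
move=> /(cvg_lim (@ereal_hausdorff R)); rewrite lim_cst; last exact: ereal_hausdorff.
by move=> [].
Qed.

End LocallyIntegrable.

(** * Weak derivatives of real functions *)
Section WeakDerivative.
Context {R : realType}.
Local Notation mu := (@lebesgue_measure R).
Local Notation locint F := (locally_integrable [set: R] F).
Implicit Types (f g h : R -> R) (phi : R -> R) (F G A : nat -> R -> R).

(** The real counterpart of [weak_deriv]. *)
Definition wder (j : nat) f g : Prop :=
  [/\ locint f, locint g & forall phi, test_function phi ->
      \int[mu]_x (f x * derive1n j phi x) = (-1) ^+ j * \int[mu]_x (g x * phi x)].

Lemma RintegralD_test f g phi psi : locint f -> locint g ->
  test_function phi -> test_function psi ->
  \int[mu]_x (f x * phi x + g x * psi x) =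
  \int[mu]_x (f x * phi x) + \int[mu]_x (g x * psi x).
Proof. by move=> *; rewrite RintegralD//; exact: integrable_mul_test. Qed.

Lemma RintegralZ_test (k : R) f phi : locint f -> test_function phi ->
  \int[mu]_x (k * (f x * phi x)) = k * \int[mu]_x (f x * phi x).
Proof. by move=> *; rewrite RintegralZl//; exact: integrable_mul_test. Qed.

(** The difference is orthogonal to all test functions. *)
Lemma wder_unique j f g h : wder j f g -> wder j f h -> ae_eq mu [set: R] g h.
Proof.
move=> [lf lg fg] [_ lh fh].
have lgh : locint (fun x => g x + -1 * h x) by apply: locintD => //; exact: locintZ.
suff : ae_eq mu [set: R] (fun x => g x + -1 * h x) (cst 0).
  by apply: ae_weaken => x /(_ I)/eqP; rewrite mulN1r subr_eq0 => /eqP.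
apply: du_bois_reymond => // phi tphi.
have -> : (fun x => (g x + -1 * h x) * phi x) =
    (fun x => g x * phi x + h x * ((-1) * phi x)).
  by apply/funext => x; rewrite mulrDl mulrCA mulrA.
have tN : test_function (fun x => -1 * phi x).
  by apply: (testM (a := cst (-1)) _ tphi); exact: (derivs_smooth (derivs_cst (-1))).
rewrite RintegralD_test//.
under [X in _ + X]eq_Rintegral do rewrite mulrCA.
rewrite RintegralZ_test// mulN1r; apply/eqP; rewrite subr_eq0; apply/eqP.
have := fg _ tphi; rewrite fh// => /(mulfI _) -> //.
by rewrite signr_eq0.
Qed.

Lemma Rintegral_mul_ae f g phi : locint f -> locint g -> ae_eq mu [set: R] f g ->
  test_function phi -> \int[mu]_x (f x * phi x) = \int[mu]_x (g x * phi x).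
Proof.
move=> lf lg fg tphi.
have mphi := continuous_measurable_fun (smooth_continuous (test_smooth tphi)).
apply: Rintegral_ae => //.
- by apply: measurable_funM => //; exact: locint_measurable.
- by apply: measurable_funM => //; exact: locint_measurable.
- by apply: ae_weaken fg => x /(_ I) ->.
Qed.

Lemma wder_ae j f g f' g' : measurable_fun [set: R] f' -> measurable_fun [set: R] g' ->
  ae_eq mu [set: R] f f' -> ae_eq mu [set: R] g g' -> wder j f g -> wder j f' g'.
Proof.
move=> mf mg ff gg [lf lg fg].
have lf' := locint_ae mf ff lf; have lg' := locint_ae mg gg lg.
split=> // phi tphi.
rewrite -(Rintegral_mul_ae lf lf' ff (test_derive1n _ tphi)) fg//.
by rewrite (Rintegral_mul_ae lg lg').
Qed.

Lemma wder0 f : locint f -> wder 0 f f.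
Proof. by move=> lf; split => // phi tphi; rewrite derive1n0 expr0 mul1r. Qed.

Lemma wderZ j (k : R) f g : wder j f g -> wder j (fun x => k * f x) (fun x => k * g x).
Proof.
move=> [lf lg fg]; split; [exact: locintZ|exact: locintZ|] => phi tphi.
under eq_Rintegral do rewrite -mulrA.
under [in RHS]eq_Rintegral do rewrite -mulrA.
rewrite !RintegralZ_test//; last exact: test_derive1n.
by rewrite fg// mulrCA.
Qed.

Lemma wderD j f g f' g' : wder j f g -> wder j f' g' ->
  wder j (fun x => f x + f' x) (fun x => g x + g' x).
Proof.
move=> [lf lg fg] [lf' lg' fg']; split; [exact: locintD|exact: locintD|] => phi tphi.
under eq_Rintegral do rewrite mulrDl.
under [in RHS]eq_Rintegral do rewrite mulrDl.
rewrite !RintegralD_test//; try exact: test_derive1n.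
by rewrite fg// fg'// mulrDr.
Qed.

Lemma wderN j f g : wder j f g -> wder j (fun x => - f x) (fun x => - g x).
Proof.
have NE u : (fun x => - u x) = (fun x => -1 * u x) :> (R -> R).
  by apply/funext => x; rewrite mulN1r.
by rewrite !NE; exact: wderZ.
Qed.

Lemma wderB j f g f' g' : wder j f g -> wder j f' g' ->
  wder j (fun x => f x - f' x) (fun x => g x - g' x).
Proof. by move=> fg /wderN; exact: wderD. Qed.

Lemma wder_cst0 j : wder j (cst 0) (cst 0).
Proof.
have l0 : locint (cst (0 : R)) by apply: locint_continuous => x; exact: cvg_cst.
split=> // phi tphi; under eq_Rintegral do rewrite mul0r.
under [in RHS]eq_Rintegral do rewrite mul0r.
by rewrite Rintegral_cst// mul0r mulr0.
Qed.

Lemma wder_sum j n F G : (forall i, (i < n)%N -> wder j (F i) (G i)) ->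
  wder j (fun x => \sum_(i < n) F i x) (fun x => \sum_(i < n) G i x).
Proof.
elim: n => [|n IH] FG.
  under eq_fun do rewrite big_ord0.
  by under [X in wder _ _ X]eq_fun do rewrite big_ord0; exact: wder_cst0.
under eq_fun do rewrite big_ord_recr/=.
under [X in wder _ _ X]eq_fun do rewrite big_ord_recr/=.
by apply: wderD; [apply: IH => i ni; apply: FG; rewrite ltnS ltnW|exact: FG].
Qed.

Lemma derive1nD i j phi : derive1n (i + j) phi = derive1n i (derive1n j phi).
Proof. by rewrite /derive1n iterD. Qed.

Lemma wder_trans i j f g h : wder i f g -> wder j g h -> wder (i + j) f h.
Proof.
move=> [lf lg fg] [_ lh gh]; split => // phi tphi.
by rewrite derive1nD fg ?gh ?mulrA ?exprD//; exact: test_derive1n.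
Qed.

(** The derivatives of a test function are test functions. *)
Lemma wder_cancel i j f g h : wder i f g -> wder (i + j) f h -> wder j g h.
Proof.
move=> [lf lg fg] [_ lh fh]; split => // phi tphi.
have := fh _ tphi; rewrite derive1nD fg; last exact: test_derive1n.
by rewrite exprD -mulrA => /(mulfI _); apply; rewrite signr_eq0.
Qed.

(** For a test function [phi], the product [A 0 * phi] is a test function too. *)
Lemma wder_mul A f g : derivs A -> wder 1 f g ->
  wder 1 (fun x => A 0%N x * f x) (fun x => A 1%N x * f x + A 0%N x * g x).
Proof.
move=> dA [lf lg fg]; have cA n : continuous (A n) by exact: derivs_continuous.
have sA : smooth (A 0%N) := derivs_smooth dA.
have sA1 : smooth (A 1%N) := derivs_smooth (derivs_shift dA).
split; [exact: locint_mul|by apply: locintD; exact: locint_mul|] => phi tphi.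
have tA := testM sA tphi; have tA1 := testM sA1 tphi; have tphi1 := test_derive1 tphi.
have := fg _ tA; rewrite expr1 !mulN1r derive1n1.
have -> : (fun x => f x * derive1 (fun y => A 0%N y * phi y) x) =
    (fun x => f x * (A 0%N x * derive1 phi x) + f x * (A 1%N x * phi x)).
  apply/funext => x; rewrite derive1M//; last exact: test_smooth.
  have -> : derive1 (A 0%N) x = A 1%N x by rewrite derive1E; case: (dA 0%N x).
  by rewrite -mulrDr addrC.
rewrite RintegralD_test//; last exact: testM.
have -> : (fun x => (A 1%N x * f x + A 0%N x * g x) * phi x) =
    (fun x => f x * (A 1%N x * phi x) + g x * (A 0%N x * phi x)).
  by apply/funext => x; rewrite mulrDl; congr (_ + _); rewrite mulrAC mulrC.
rewrite RintegralD_test// derive1n1 opprD.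
have -> : (fun x => f x * (A 0%N x * derive1 phi x)) =
    (fun x => A 0%N x * f x * derive1 phi x).
  by apply/funext => x; rewrite mulrCA mulrA.
by move=> <-; rewrite addrCA addNr addr0.
Qed.

Lemma derive1n_affine j (al be : R) phi : smooth phi ->
  derive1n j (fun x => phi (al * x + be)) = (fun x => al ^+ j * derive1n j phi (al * x + be)).
Proof.
move=> sphi; have := derive1nE j (derivs_affine al be (smooth_derivs sphi)).
by move=> <-; congr derive1n; apply/funext => x; rewrite expr0 mul1r.
Qed.

(** Test functions are composed with the inverse affine map. *)
Lemma wder_affine j (al be : R) f g : 0 < al -> wder j f g ->
  wder j (fun x => f (al * x + be)) (fun x => al ^+ j * g (al * x + be)).
Proof.
move=> al0 [lf lg fg]; have aln0 : al != 0 by rewrite gt_eqF.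
split; [exact: locint_affine|by apply: locintZ; exact: locint_affine|] => phi tphi.
pose psi x := phi (al^-1 * x + - (be / al)).
have psiE x : psi (al * x + be) = phi x.
  by rewrite /psi; congr phi; field.
have tpsi : test_function psi by apply: test_affine => //; rewrite invr_eq0.
have dpsiE x : derive1n j phi x = al ^+ j * derive1n j psi (al * x + be).
  rewrite derive1n_affine; last exact: test_smooth.
  rewrite mulrA -exprMn divff// expr1n mul1r; congr (derive1n j phi _).
  by field.
have aff_int (u v : R -> R) : locint u -> test_function v ->
    mu.-integrable [set: R] (EFin \o (fun x => u (al * x + be) * v (al * x + be))).
  move=> lu tv.
  have := @integrable_affine _ al be [set: R] _ al0 measurableT (integrable_mul_test lu tv).
  by rewrite preimage_setT.
have change (u v : R -> R) : locint u -> test_function v ->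
    \int[mu]_x (u (al * x + be) * v (al * x + be)) = al^-1 * \int[mu]_x (u x * v x).
  move=> lu tv; rewrite [in RHS](Rintegral_affine be al0)//; last exact: integrable_mul_test.
  by rewrite preimage_setT mulKf.
under eq_Rintegral do rewrite dpsiE mulrCA.
rewrite RintegralZl//; last exact: aff_int (test_derive1n _ tpsi).
rewrite change//; last exact: test_derive1n.
rewrite fg//; under [in RHS]eq_Rintegral do rewrite -psiE -mulrA.
rewrite RintegralZl//; last exact: aff_int.
by rewrite change//; ring.
Qed.

Definition weak_chain (n : nat) F := forall i, (i < n)%N -> wder 1 (F i) (F i.+1).

Lemma weak_chain_wder n F i : weak_chain n F -> locint (F 0%N) -> (i <= n)%N ->
  wder i (F 0%N) (F i).
Proof.
move=> cF lF; elim: i => [_|i IH ni]; first exact: wder0.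
by have := wder_trans (IH (ltnW ni)) (cF _ ni); rewrite addn1.
Qed.

Lemma weak_chain_wder2 n F i j : weak_chain n F -> (forall i, (i <= n)%N -> locint (F i)) ->
  (i + j <= n)%N -> wder j (F i) (F (i + j)%N).
Proof.
move=> cF lF; elim: j => [ni|j IH ni]; first by rewrite addn0; apply/wder0/lF; lia.
have ijn : (i + j < n)%N by lia.
by have := wder_trans (IH (ltnW ijn)) (cF _ ijn); rewrite addn1 addnS.
Qed.

Lemma weak_chain_leibniz n A F : derivs A -> weak_chain n F ->
  weak_chain n (leibniz A F).
Proof.
move=> dA cF j jn; rewrite /leibniz.
under [X in wder _ _ X]eq_fun do rewrite -(leibniz_step (A ^~ _) (F ^~ _)).
apply: (@wder_sum 1 j.+1 (fun i x => 'C(j, i)%:R * (A (j - i)%N x * F i x))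
  (fun i x => 'C(j, i)%:R * (A (j - i).+1 x * F i x + A (j - i)%N x * F i.+1 x))) => i ij.
apply: wderZ.
have dS : derivs (fun m => A (j - i + m)%N).
  by move=> m x; rewrite addnS; exact: dA.
have := wder_mul dS (cF i _); rewrite addn0 addn1; apply.
by lia.
Qed.

Lemma weak_chain_affine n (al be : R) F : 0 < al -> weak_chain n F ->
  weak_chain n (fun i x => al ^+ i * F i (al * x + be)).
Proof.
move=> al0 cF i ni; have := wderZ (al ^+ i) (wder_affine be al0 (cF i ni)).
by under [X in wder _ _ X -> _]eq_fun do rewrite expr1 mulrA -exprSr.
Qed.

Lemma weak_chainB n F G : weak_chain n F -> weak_chain n G ->
  weak_chain n (fun i x => F i x - G i x).
Proof. by move=> cF cG i ni; apply: wderB; [exact: cF|exact: cG]. Qed.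

End WeakDerivative.

(** * Square-integrable functions *)
Section SquareIntegrable.
Context {R : realType}.
Local Notation mu := (@lebesgue_measure R).
Local Notation locint F := (locally_integrable [set: R] F).
Implicit Types (D : set R) (f g : R -> R).

Lemma integrable_addr D f g : measurable D -> mu.-integrable D (fun x => (f x)%:E) ->
  mu.-integrable D (fun x => (g x)%:E) -> mu.-integrable D (fun x => (f x + g x)%:E).
Proof. by move=> mD jf jg; exact: (@integrableD _ _ _ mu D mD _ _ jf jg). Qed.

Lemma integrable_mull D (k : R) f : measurable D -> mu.-integrable D (fun x => (f x)%:E) ->
  mu.-integrable D (fun x => (k * f x)%:E).
Proof. by move=> mD jf; exact: (@integrableZl _ _ _ mu D mD k _ jf). Qed.

Definition L2r D f : Prop :=
  measurable_fun D f /\ mu.-integrable D (fun x => (f x ^+ 2)%:E).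

Lemma L2r_measurable D f : L2r D f -> measurable_fun D f.
Proof. by case. Qed.

Lemma L2r_dom D f g : measurable D -> measurable_fun D f ->
  mu.-integrable D (fun x => (g x)%:E) ->
  {ae mu, forall x, D x -> f x ^+ 2 <= g x} -> L2r D f.
Proof.
move=> mD mf ig fg; split => //.
have mf2 : measurable_fun D (fun x => (f x ^+ 2)%:E).
  by apply/measurable_EFinP; exact: measurable_funX.
apply/integrableP; split => //.
have /integrableP[mg] := ig; apply: le_lt_trans.
apply: ae_ge0_le_integral => //.
- exact: measurableT_comp.
- exact: measurableT_comp.
apply: ae_weaken fg => x fg Dx; rewrite !abse_EFin lee_fin ger0_norm ?sqr_ge0//.
by rewrite (le_trans (fg Dx))// ler_norm.
Qed.

Lemma L2r_ae D f g : measurable D -> measurable_fun D g -> ae_eq mu D f g ->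
  L2r D f -> L2r D g.
Proof.
move=> mD mg fg [mf if2]; apply: (L2r_dom mD mg if2).
by apply: ae_weaken fg => x fg Dx; rewrite fg.
Qed.

Lemma L2rZ D (k : R) f : measurable D -> L2r D f -> L2r D (fun x => k * f x).
Proof.
move=> mD [mf if2]; apply: (@L2r_dom _ _ (fun x => k ^+ 2 * f x ^+ 2)) => //.
- exact: measurable_funM.
- exact: integrable_mull.
- by apply: aeW => x _; rewrite exprMn.
Qed.

Lemma L2rD D f g : measurable D -> L2r D f -> L2r D g -> L2r D (fun x => f x + g x).
Proof.
move=> mD [mf if2] [mg ig2].
apply: (@L2r_dom _ _ (fun x => 2 * f x ^+ 2 + 2 * g x ^+ 2)) => //.
- exact: measurable_funD.
- by apply: integrable_addr => //; exact: integrable_mull.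
- apply: aeW => x _; rewrite -subr_ge0.
  have -> : 2 * f x ^+ 2 + 2 * g x ^+ 2 - (f x + g x) ^+ 2 = (f x - g x) ^+ 2 by ring.
  exact: sqr_ge0.
Qed.

Lemma L2rB D f g : measurable D -> L2r D f -> L2r D g -> L2r D (fun x => f x - g x).
Proof.
move=> mD Lf /(L2rZ (-1) mD)/(L2rD mD Lf).
by under eq_fun do rewrite mulN1r.
Qed.

Lemma L2r_cst0 D : measurable D -> L2r D (cst 0).
Proof.
move=> mD; split; first exact: measurable_cst.
by rewrite (_ : (fun _ => _) = cst 0%E); [exact: integrable0|apply/funext => x; rewrite expr0n].
Qed.

Lemma L2r_sum D n (F : nat -> R -> R) : measurable D ->
  (forall i, (i < n)%N -> L2r D (F i)) -> L2r D (fun x => \sum_(i < n) F i x).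
Proof.
move=> mD; elim: n => [|n IH] LF.
  by under eq_fun do rewrite big_ord0; exact: L2r_cst0.
under eq_fun do rewrite big_ord_recr/=.
by apply: L2rD => //; [apply: IH => i ni; apply: LF; rewrite ltnS ltnW|exact: LF].
Qed.

Lemma L2rS D E f : measurable D -> measurable E -> D `<=` E -> L2r E f -> L2r D f.
Proof.
by move=> mD mE DE [mf if2]; split; [exact: measurable_funS mf|exact: integrableS if2].
Qed.

Lemma L2r_bounded D f (a : R -> R) (B : R) : measurable D -> measurable_fun D a ->
  (forall x, D x -> `|a x| <= B) -> L2r D f -> L2r D (fun x => a x * f x).
Proof.
move=> mD ma aB [mf if2]; apply: (@L2r_dom _ _ (fun x => B ^+ 2 * f x ^+ 2)) => //.
- exact: measurable_funM.
- exact: integrable_mull.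
- apply: aeW => x Dx; rewrite exprMn ler_wpM2r ?sqr_ge0// -real_normK ?num_real//.
  by rewrite lerXn2r ?nnegrE ?aB// (le_trans _ (aB _ Dx)).
Qed.

(** Compare with [1 + f ^ 2]. *)
Lemma L2r_integrable D f : measurable D -> (mu D < +oo)%E -> L2r D f ->
  mu.-integrable D (EFin \o f).
Proof.
move=> mD Dfin [mf if2].
have i1 : mu.-integrable D (EFin \o cst (1 : R)).
  apply/integrableP; split; first exact/measurable_EFinP/measurable_cst.
  suff -> : (\int[mu]_(x in D) `|(EFin \o cst (1%R : R)) x| = mu D)%E by [].
  transitivity (\int[mu]_(x in D) cst 1%E x)%E; last by rewrite integral_cst//= mul1e.
  by apply: eq_integral => x _; rewrite /= normr1.
apply: (@le_integrable _ _ _ mu _ mD _ _ _ _ (integrable_addr mD i1 if2)).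
  exact/measurable_EFinP.
move=> x Dx; rewrite /= lee_fin (ger0_norm (addr_ge0 ler01 (sqr_ge0 _))).
rewrite -[f x ^+ 2]real_normK ?num_real//.
have [f1|f1] := leP `|f x| 1; first by rewrite (le_trans f1)// lerDl sqr_ge0.
have : `|f x| * 1 <= `|f x| * `|f x| by rewrite ler_wpM2l// ltW.
by rewrite mulr1 -expr2 => /le_trans; apply; rewrite lerDr.
Qed.

Definition L2locr f := measurable_fun [set: R] f /\ forall M : R, L2r `[- M, M] f.

Lemma L2locr_locint f : L2locr f -> locint f.
Proof.
move=> [mf Lf]; apply: itv_locint => // M; apply: L2r_integrable => //.
by have := compact_finite_measure (@segment_compact R (- M) M).
Qed.

Lemma L2locr_itv f (x y : R) : L2locr f -> L2r `[x, y] f.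
Proof.
move=> [mf Lf]; apply: (L2rS _ _ _ (Lf (`|x| + `|y|))) => // z /=; rewrite !in_itv/=.
move=> /andP[xz zy]; rewrite (le_trans _ xz)/=; last first.
  by rewrite lerNl (le_trans (ler_norm _))// normrN lerDl.
by rewrite (le_trans zy)// (le_trans (ler_norm _))// lerDr.
Qed.

Lemma L2locr_ae f g : measurable_fun [set: R] g -> ae_eq mu [set: R] f g ->
  L2locr f -> L2locr g.
Proof.
move=> mg fg [mf Lf]; split => // M; apply: (L2r_ae _ _ _ (Lf M)) => //.
- exact: measurable_funS mg.
- by apply: ae_weaken fg => x /(_ I).
Qed.

Lemma L2locrZ (k : R) f : L2locr f -> L2locr (fun x => k * f x).
Proof. by move=> [mf Lf]; split => [|M]; [exact: measurable_funM|exact: L2rZ]. Qed.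

Lemma L2locr_affine (al be : R) f : 0 < al -> L2locr f ->
  L2locr (fun x => f (al * x + be)).
Proof.
move=> al0 lf; have mf : measurable_fun [set: R] (fun x => f (al * x + be)).
  by case: lf => mf _; exact: (@measurable_fun_affine _ al be f mf).
split=> // M; split; first exact: measurable_funS mf.
have [_ if2] := L2locr_itv (al * - M + be) (al * M + be) lf.
have := integrable_affine be al0 (measurable_itvR _) if2.
rewrite (_ : _ @^-1` _ = `[- M, M]%classic)//.
by apply/seteqP; split => x /=; rewrite !in_itv/= /affine !lerD2r !ler_pM2l.
Qed.

Lemma L2r_translate (h : R) f : L2r [set: R] f -> L2r [set: R] (fun x => f (x + h)).
Proof.
have E : (fun x => f (x + h)) = (fun x => f (1 * x + h)).
  by apply/funext => x; rewrite mul1r.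
move=> [mf if2]; rewrite E; split; first exact: (@measurable_fun_affine _ 1 h f mf).
by have := @integrable_affine _ 1 h [set: R] _ ltr01 measurableT if2; rewrite preimage_setT.
Qed.

End SquareIntegrable.

(** * The operator on real and imaginary parts *)
Section ComplexParts.
Context {R : realType}.
Local Notation mu := (@lebesgue_measure R).
Local Notation locint F := (locally_integrable [set: R] F).
Implicit Types (D : set R) (F G : R -> R[i]).

Definition re F : R -> R := fun x => complex.Re (F x).
Definition im F : R -> R := fun x => complex.Im (F x).

Lemma eq_ReIm (z w : R[i]) : complex.Re z = complex.Re w -> complex.Im z = complex.Im w ->
  z = w.
Proof. by case: z => a b; case: w => c d /= -> ->. Qed.

Lemma ReM_real (a : R) (z : R[i]) : complex.Re (a%:C%C * z) = a * complex.Re z.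
Proof. by case: z => u v /=; rewrite mul0r subr0. Qed.

Lemma ImM_real (a : R) (z : R[i]) : complex.Im (a%:C%C * z) = a * complex.Im z.
Proof. by case: z => u v /=; rewrite mul0r addr0. Qed.

Lemma L2on_parts D F : measurable D -> L2on D F <-> L2r D (re F) /\ L2r D (im F).
Proof.
move=> mD; have nE x : Normc.normc (F x) ^+ 2 = re F x ^+ 2 + im F x ^+ 2.
  by rewrite /re /im; case: (F x) => a b /=; rewrite sqr_sqrtr// addr_ge0 ?sqr_ge0.
split.
  move=> [mr mi iF]; split; apply: (L2r_dom mD _ iF) => //;
  by apply: aeW => x _; rewrite nE ?lerDl ?lerDr ?sqr_ge0.
move=> [[mr ir] [mi ii]]; split => //.
have := integrable_addr mD ir ii; congr (mu.-integrable _ _).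
by apply/funext => x; rewrite nE.
Qed.

Lemma null_on_parts D F : null_on D F <->
  ae_eq mu D (re F) (cst 0) /\ ae_eq mu D (im F) (cst 0).
Proof.
split=> [F0|[r0 i0]].
  by split; apply: ae_weaken F0 => x F0 Dx; rewrite /re /im F0.
by apply: ae_weaken2 r0 i0 => x r0 i0 Dx; apply: eq_ReIm; [exact: r0|exact: i0].
Qed.

(** Test functions are real, so real and imaginary parts decouple. *)
Lemma weak_deriv_parts j F G : weak_deriv j F G <->
  wder j (re F) (re G) /\ wder j (im F) (im G).
Proof.
have sg (z : R[i]) : (-1) ^+ j * z = ((-1) ^+ j)%:C%C * z.
  by rewrite rmorphXn rmorphN1.
have re_int (H : R -> R[i]) (phi : R -> R) : complex.Re (Cintegral [set: R] (fun x => H x * (phi x)%:C%C)) =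
    \int[mu]_x (re H x * phi x).
  rewrite /Cintegral /=; apply: eq_Rintegral => x _.
  by rewrite mulrC ReM_real mulrC.
have im_int (H : R -> R[i]) (phi : R -> R) : complex.Im (Cintegral [set: R] (fun x => H x * (phi x)%:C%C)) =
    \int[mu]_x (im H x * phi x).
  rewrite /Cintegral /=; apply: eq_Rintegral => x _.
  by rewrite mulrC ImM_real mulrC.
split=> [[[lr li] [lr' li'] FG]|[[lr lr' r] [li li' i]]].
  split; split => // phi /FG E.
    by have /(congr1 (@complex.Re R)) := E; rewrite sg ReM_real !re_int.
  by have /(congr1 (@complex.Im R)) := E; rewrite sg ImM_real !im_int.
split=> // phi tphi; apply: eq_ReIm; rewrite sg.
  by rewrite ReM_real !re_int r.
by rewrite ImM_real !im_int i.
Qed.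

Lemma wD_weak_deriv j F G : weak_deriv j F G -> weak_deriv j F (wD j F).
Proof. by move=> FG; exact: (@xgetPex _ (fun=> 0) [set g | weak_deriv j F g] (ex_intro _ G FG)). Qed.

End ComplexParts.

(** * The operator in terms of chains of weak derivatives *)
Section OperatorChains.
Context {R : realType}.
Local Notation mu := (@lebesgue_measure R).
Local Notation locint F := (locally_integrable [set: R] F).
Variables (k c L : R) (Q : nat -> R -> R).
Hypothesis dQ : derivs Q.
Implicit Types (D : set R) (F : nat -> R -> R) (P : (R -> R) -> Prop).

(** [k^4 u'''' + k^2 u'' - c u + q u] and its second derivative, for [F] the
    sequence of derivatives of [u] and [q = Q 0]. *)
Definition bracket F : R -> R := fun x =>
  k ^+ 4 * F 4%N x + k ^+ 2 * F 2%N x - c * F 0%N x + Q 0%N x * F 0%N x.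

Definition bracket2 F : R -> R := fun x =>
  k ^+ 4 * F 6%N x + k ^+ 2 * F 4%N x - c * F 2%N x + leibniz Q F 2%N x.

Definition KPform F : R -> R := fun x => L * F 1%N x - bracket2 F x.

(** The order of the operator is six; [P] is square integrability, on the line or on
    bounded intervals. *)
Definition sobolev_chain P F f : Prop :=
  [/\ F 0%N = f, weak_chain 6 F & forall i, (i <= 6)%N -> P (F i) /\ locint (F i)].

Lemma bracket_wder F : weak_chain 6 F -> (forall i, (i <= 6)%N -> locint (F i)) ->
  wder 2 (bracket F) (bracket2 F).
Proof.
move=> cF lF; apply: wderD.
  apply: wderB; last by apply: wderZ; exact: (weak_chain_wder2 (i := 0) (j := 2) cF lF).
  apply: wderD; apply: wderZ; first exact: (weak_chain_wder2 (i := 4) (j := 2) cF lF).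
  exact: (weak_chain_wder2 (i := 2) (j := 2) cF lF).
have cQ := weak_chain_leibniz dQ cF.
have := wder_trans (cQ 0%N isT) (cQ 1%N isT); rewrite leibniz0; exact.
Qed.

(** Derivatives given separately for every order form a chain, by uniqueness. The
    chain starts at [f] itself, with which [G 0] agrees only almost everywhere. *)
Lemma dom_chain P (f : R -> R) (G : nat -> R -> R) :
  (forall g h, measurable_fun [set: R] h -> ae_eq mu [set: R] g h -> P g -> P h) ->
  locint f -> (forall i, (i <= 6)%N -> P (G i) /\ wder i f (G i)) ->
  exists F, sobolev_chain P F f.
Proof.
move=> Pae lf PG.
have Pf : P f.
  have [PG0 fG0] := PG 0%N isT.
  apply: Pae PG0; first exact: locint_measurable.
  exact: (wder_unique fG0 (wder0 lf)).
exists (fun i => if i is 0%N then f else G i); split => //.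
  move=> i i6; have [_ fi1] := PG i.+1 i6.
  case: i i6 fi1 => [//|i] i6 fi1; have [_ fi] := PG i.+1 (ltnW i6).
  by apply: wder_cancel fi _; rewrite addn1.
by case=> [//|i] i6; have [? [_ ? _]] := PG _ i6.
Qed.

(** Domains of complex functions are described by chains of real functions, for the
    real and for the imaginary part. *)
Lemma sobolev_parts (P2 : (R -> R[i]) -> Prop) P (u : R -> R[i]) :
  (forall g h, measurable_fun [set: R] h -> ae_eq mu [set: R] g h -> P g -> P h) ->
  (forall g, loc_integrableC g -> P2 g -> P (re g) /\ P (im g)) ->
  (forall i, (i <= 6)%N -> exists2 g, P2 g & weak_deriv i u g) ->
  exists F1 F2, sobolev_chain P F1 (re u) /\ sobolev_chain P F2 (im u).
Proof.
move=> Pae P2P uP.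
have {uP} uP i : exists g : R -> R[i], (i <= 6)%N -> P2 g /\ weak_deriv i u g.
  have [i6|_] := boolP (i <= 6)%N; last by exists (cst 0).
  by have [g P2g ug] := uP i i6; exists g.
have [g ug] := choice uP.
have lu : loc_integrableC u by have [_ []] := ug 0%N isT.
have [F1 F1P] : exists F1, sobolev_chain P F1 (re u).
  apply: (@dom_chain P (re u) (fun i => re (g i))) => //; first by case: lu.
  move=> i i6; have [P2g ugi] := ug i i6; have [_ lg _] := ugi.
  by split; [case: (P2P _ lg P2g)|case: ((weak_deriv_parts _ _ _).1 ugi)].
have [F2 F2P] : exists F2, sobolev_chain P F2 (im u).
  apply: (@dom_chain P (im u) (fun i => im (g i))) => //; first by case: lu.
  move=> i i6; have [P2g ugi] := ug i i6; have [_ lg _] := ugi.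
  by split; [case: (P2P _ lg P2g)|case: ((weak_deriv_parts _ _ _).1 ugi)].
by exists F1, F2.
Qed.

Lemma Hline_parts (u : R -> R[i]) : Hline 6 u ->
  exists F1 F2, sobolev_chain (L2r [set: R]) F1 (re u) /\
                sobolev_chain (L2r [set: R]) F2 (im u).
Proof.
apply: sobolev_parts => [g h mh gh|g _]; first exact: L2r_ae.
by move=> /(L2on_parts _ measurableT).
Qed.

Lemma Hloc_parts (u : R -> R[i]) : Hloc 6 u ->
  exists F1 F2, sobolev_chain L2locr F1 (re u) /\ sobolev_chain L2locr F2 (im u).
Proof.
apply: sobolev_parts => [g h mh gh|g [lr li] Lg]; first exact: L2locr_ae.
by split; (split; first exact: locint_measurable) => M;
  have [] := (L2on_parts g (measurable_itv _)).1 (Lg M).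
Qed.

Definition cplx (f g : R -> R) : R -> R[i] := fun x => (f x +i* g x)%C.

Lemma Hline_cplx F1 F2 f1 f2 : sobolev_chain (L2r [set: R]) F1 f1 ->
  sobolev_chain (L2r [set: R]) F2 f2 -> Hline 6 (cplx f1 f2).
Proof.
move=> [e1 c1 l1] [e2 c2 l2] i i6; exists (cplx (F1 i) (F2 i)).
  by apply/L2on_parts => //; split; [case: (l1 i i6)|case: (l2 i i6)].
apply/weak_deriv_parts; split.
  by rewrite -e1; apply: (weak_chain_wder c1) => //; case: (l1 0%N isT).
by rewrite -e2; apply: (weak_chain_wder c2) => //; case: (l2 0%N isT).
Qed.

(* The expression of which the operator takes the second weak derivative. *)
Let expr (q : R -> R) (u : R -> R[i]) : R -> R[i] := fun z =>
  (k ^+ 4)%:C%C * wD 4 u z + (k ^+ 2)%:C%C * wD 2 u z - c%:C%C * u z + (q z)%:C%C * u z.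

Let expr_ae (u : R -> R[i]) P1 P2 F1 F2 : sobolev_chain P1 F1 (re u) ->
  sobolev_chain P2 F2 (im u) ->
  [/\ ae_eq mu [set: R] (re (expr (Q 0%N) u)) (bracket F1),
      ae_eq mu [set: R] (im (expr (Q 0%N) u)) (bracket F2),
      measurable_fun [set: R] (re (expr (Q 0%N) u)),
      measurable_fun [set: R] (im (expr (Q 0%N) u)) &
      ae_eq mu [set: R] (re (wD 1 u)) (F1 1%N) /\
      ae_eq mu [set: R] (im (wD 1 u)) (F2 1%N)].
Proof.
move=> [e1 c1 l1] [e2 c2 l2].
have l01 : locint (F1 0%N) by case: (l1 0%N isT).
have l02 : locint (F2 0%N) by case: (l2 0%N isT).
have W j : (j <= 6)%N -> weak_deriv j u (wD j u).
  move=> j6; apply: (@wD_weak_deriv _ _ _ (cplx (F1 j) (F2 j))).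
  by apply/weak_deriv_parts; rewrite -e1 -e2; split; exact: (@weak_chain_wder _ 6).
have W1 j : (j <= 6)%N -> wder j (F1 0%N) (re (wD j u)) /\ ae_eq mu [set: R] (re (wD j u)) (F1 j).
  move=> j6; have [+ _] := (weak_deriv_parts _ _ _).1 (W j j6); rewrite -e1 => w; split => //.
  by apply: (wder_unique w); exact: (@weak_chain_wder _ 6).
have W2 j : (j <= 6)%N -> wder j (F2 0%N) (im (wD j u)) /\ ae_eq mu [set: R] (im (wD j u)) (F2 j).
  move=> j6; have [_ +] := (weak_deriv_parts _ _ _).1 (W j j6); rewrite -e2 => w; split => //.
  by apply: (wder_unique w); exact: (@weak_chain_wder _ 6).
have mQ : measurable_fun [set: R] (Q 0%N).
  by apply: continuous_measurable_fun; exact: derivs_continuous.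
have reE : re (expr (Q 0%N) u) = fun x => k ^+ 4 * re (wD 4 u) x + k ^+ 2 * re (wD 2 u) x
    - c * F1 0%N x + Q 0%N x * F1 0%N x.
  by apply/funext => x; rewrite /re /expr !raddfD/= raddfN/= !ReM_real e1.
have imE : im (expr (Q 0%N) u) = fun x => k ^+ 4 * im (wD 4 u) x + k ^+ 2 * im (wD 2 u) x
    - c * F2 0%N x + Q 0%N x * F2 0%N x.
  by apply/funext => x; rewrite /im /expr !raddfD/= raddfN/= !ImM_real e2.
have lq f : locint f -> locint (fun x => Q 0%N x * f x).
  by apply: locint_mul; exact: derivs_continuous.
split.
- rewrite reE; apply: ae_weaken2 (W1 4%N isT).2 (W1 2%N isT).2 => x w4 w2 _.
  by rewrite w4// w2.
- rewrite imE; apply: ae_weaken2 (W2 4%N isT).2 (W2 2%N isT).2 => x w4 w2 _.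
  by rewrite w4// w2.
- rewrite reE; apply: locint_measurable.
  have [[_ l4 _] _] := W1 4%N isT; have [[_ l2' _] _] := W1 2%N isT.
  apply: locintD; last exact: lq.
  by apply: locally_integrableB; [apply: locintD|]; exact: locintZ.
- rewrite imE; apply: locint_measurable.
  have [[_ l4 _] _] := W2 4%N isT; have [[_ l2' _] _] := W2 2%N isT.
  apply: locintD; last exact: lq.
  by apply: locally_integrableB; [apply: locintD|]; exact: locintZ.
- by have [] := W1 1%N isT; have [] := W2 1%N isT.
Qed.

(** All coefficients are real, so the operator acts separately on real and imaginary
    parts, and there it is [KPform]. *)
Lemma KPop_parts D dom (u v : R -> R[i]) P F1 F2 :
  sobolev_chain P F1 (re u) -> sobolev_chain P F2 (im u) ->
  KPop D dom L%:C%C k c (Q 0%N) u v ->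
  ae_eq mu D (re v) (KPform F1) /\ ae_eq mu D (im v) (KPform F2).
Proof.
move=> s1 s2 [_ _ [h /weak_deriv_parts[w1 w2] vh]].
have [b1 b2 m1 m2 [d1 d2]] := expr_ae s1 s2.
have [e1 c1 l1] := s1; have [e2 c2 l2] := s2.
have B1 := bracket_wder c1 (fun i i6 => (l1 i i6).2).
have B2 := bracket_wder c2 (fun i i6 => (l2 i i6).2).
have h1 : ae_eq mu [set: R] (re h) (bracket2 F1).
  apply: (wder_unique _ B1); apply: (wder_ae _ _ b1 (ae_eq_refl _ _ _) w1).
    by apply: locint_measurable; case: B1.
  by apply: locint_measurable; case: w1.
have h2 : ae_eq mu [set: R] (im h) (bracket2 F2).
  apply: (wder_unique _ B2); apply: (wder_ae _ _ b2 (ae_eq_refl _ _ _) w2).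
    by apply: locint_measurable; case: B2.
  by apply: locint_measurable; case: w2.
split.
  have := ae_weaken2 (fun x a b => conj a b) h1 d1.
  apply: ae_weaken2 vh => x vh [hx dx] Dx.
  by rewrite /re vh// raddfD raddfN/= ReM_real -/(re (wD 1 u) x) -/(re h x) hx// dx.
have := ae_weaken2 (fun x a b => conj a b) h2 d2.
apply: ae_weaken2 vh => x vh [hx dx] Dx.
by rewrite /im vh// raddfD raddfN/= ImM_real -/(im (wD 1 u) x) -/(im h x) hx// dx.
Qed.

Lemma KPop_cplx D dom (u v : R -> R[i]) P F1 F2 : dom u -> L2on D v ->
  sobolev_chain P F1 (re u) -> sobolev_chain P F2 (im u) ->
  ae_eq mu D (re v) (KPform F1) -> ae_eq mu D (im v) (KPform F2) ->
  KPop D dom L%:C%C k c (Q 0%N) u v.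
Proof.
move=> du Lv s1 s2 v1 v2; split => //.
have [b1 b2 m1 m2 [d1 d2]] := expr_ae s1 s2.
have [e1 c1 l1] := s1; have [e2 c2 l2] := s2.
have B1 := bracket_wder c1 (fun i i6 => (l1 i i6).2).
have B2 := bracket_wder c2 (fun i i6 => (l2 i i6).2).
exists (cplx (bracket2 F1) (bracket2 F2)).
  apply/weak_deriv_parts; split.
    apply: (wder_ae _ _ (ae_eq_sym b1) (ae_eq_refl _ _ _) B1) => //.
    by apply: locint_measurable; case: B1.
  apply: (wder_ae _ _ (ae_eq_sym b2) (ae_eq_refl _ _ _) B2) => //.
  by apply: locint_measurable; case: B2.
have d : {ae mu, forall x, re (wD 1 u) x = F1 1%N x /\ im (wD 1 u) x = F2 1%N x}.
  by apply: ae_weaken2 d1 d2 => x d1 d2; split; [exact: d1|exact: d2].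
have := ae_weaken2 (fun x a b => conj a b) v1 v2.
apply: ae_weaken2 d => x [dx1 dx2] [vx1 vx2] Dx; apply: eq_ReIm.
  by rewrite -/(re v x) vx1// raddfD raddfN/= ReM_real -/(re (wD 1 u) x) dx1.
by rewrite -/(im v x) vx2// raddfD raddfN/= ImM_real -/(im (wD 1 u) x) dx2.
Qed.

End OperatorChains.

(** * Periodic functions and translates of square-integrable functions *)
Section Translates.
Context {R : realType}.
Local Notation mu := (@lebesgue_measure R).
Implicit Types (f : R -> R) (b : nat -> R).

Lemma cells_trivIset (al P : R) b : (forall i j, i != j -> P <= `|b i - b j|) ->
  trivIset [set: nat] (fun j => `[al + b j, al + b j + P[%classic).
Proof.
move=> bP; apply/trivIsetP => i j _ _ /bP ij.
rewrite -subset0 => x [] /=; rewrite !in_itv/= => /andP[i1 i2] /andP[j1 j2].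
move: ij; apply/negP; rewrite -ltNge ltr_norml; apply/andP; split; lra.
Qed.

Lemma progression_dist (P : R) (i j : nat) : 0 < P -> i != j ->
  P <= `|i%:R * P - j%:R * P|.
Proof.
move=> P0 ij; rewrite -mulrBl normrM (gtr0_norm P0) ler_peMl ?(ltW P0)//.
have [lij|lij] := leqP i j.
  rewrite distrC ger0_norm ?subr_ge0 ?ler_nat// -natrB// ler1n subn_gt0.
  by rewrite ltn_neqAle ij.
by rewrite ger0_norm ?subr_ge0 ?ler_nat ?(ltnW lij)// -natrB ?(ltnW lij)// ler1n subn_gt0.
Qed.

Lemma periodic_cell (P x : R) : 0 < P -> exists n : nat,
  n%:R * P <= x < n%:R * P + P \/ - (n.+1%:R * P) <= x < - (n.+1%:R * P) + P.
Proof.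
move=> P0.
have fl : (Num.floor (x / P))%:~R * P <= x by rewrite -ler_pdivlMr// Num.Theory.floor_le_tmp.
have fr : x < (Num.floor (x / P))%:~R * P + P.
  rewrite -[X in _ + X]mul1r -mulrDl -ltr_pdivrMr//.
  by have := Num.Theory.floorD1_gt (x / P); rewrite intrD.
case: (Num.floor (x / P)) fl fr => n fl fr; exists n; first by left; rewrite fl fr.
by right; move: fl fr; rewrite NegzE mulrNz mulNr => -> ->.
Qed.

Lemma integral_cell (al P h : R) f : measurable_fun [set: R] f -> (forall x, 0 <= f x) ->
  (\int[mu]_(x in `[(al + h)%R, (al + h + P)%R[) (f x)%:E =
   \int[mu]_(x in `[al, (al + P)%R[) (f (x + h)%R)%:E)%E.
Proof.
move=> mf f0; rewrite (@ge0_integral_affine _ 1 h)//; last first.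
- by move=> x _; rewrite lee_fin.
- by apply/measurable_EFinP; exact: measurable_funS mf.
rewrite mul1e (_ : _ @^-1` _ = `[al, al + P[%classic).
  by apply: eq_integral => x _; rewrite /affine mul1r.
by apply/seteqP; split => x /=; rewrite !in_itv/= /affine mul1r lerD2r addrAC ltrD2r.
Qed.

Lemma nneseries_cvg0 (u : nat -> R) : (forall n, 0 <= u n) ->
  (\sum_(0 <= i <oo) (u i)%:E < +oo)%E -> u @ \oo --> (0 : R).
Proof.
move=> u0 su; apply: cvg_series_cvg_0; apply: nondecreasing_is_cvgn.
  apply/nondecreasing_seqP => n; rewrite seriesEnat/= big_nat_recr//=.
  by rewrite lerDl.
exists (fine (\sum_(0 <= i <oo) (u i)%:E)) => _ [n _ <-].
rewrite -lee_fin fineK; last first.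
  by rewrite ge0_fin_numE// nneseries_ge0// => i _ _; rewrite lee_fin.
rewrite seriesEnat/= -sumEFin; apply: nneseries_lim_ge => i _.
by rewrite lee_fin.
Qed.

(** The integrals of an integrable function over disjoint translates of a cell have
    a finite sum. *)
Lemma tail_cell (al P : R) b f : (forall i j, i != j -> P <= `|b i - b j|) ->
  (forall x, 0 <= f x) -> mu.-integrable [set: R] (EFin \o f) ->
  {ae mu, forall x, al <= x < al + P -> (fun n => f (x + b n)) @ \oo --> (0 : R)}.
Proof.
move=> bP f0 jf.
have mf : measurable_fun [set: R] f by apply/measurable_EFinP; case/integrableP: jf.
pose C j := `[al + b j, al + b j + P[%classic.
have mfb n : measurable_fun [set: R] (fun x => f (x + b n)).
  have -> : (fun x => f (x + b n)) = f \o affine 1 (b n).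
    by apply/funext => x; rewrite /affine/= mul1r.
  exact: measurable_fun_affine.
have fin : (\int[mu]_(x in `[al, (al + P)%R[) \sum_(0 <= n <oo) (f (x + b n)%R)%:E < +oo)%E.
  rewrite integral_nneseries//; last 2 first.
  - by move=> n; apply/measurable_EFinP; exact: measurable_funS (mfb n).
  - by move=> n x _; rewrite lee_fin.
  under eq_eseriesr do rewrite -integral_cell//.
  rewrite -(@ge0_integral_bigcup _ _ _ mu C)//; last 4 first.
  - by move=> j; exact: measurable_itvR.
  - by apply/measurable_EFinP; exact: measurable_funS mf.
  - by move=> x _; rewrite lee_fin.
  - exact: cells_trivIset.
  have /integrableP[_] := jf; apply: le_lt_trans.
  under [in leRHS]eq_integral do rewrite /= ger0_norm//.
  apply: ge0_subset_integral => //; last by move=> x _; rewrite lee_fin.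
  - by apply: bigcup_measurable => j _; exact: measurable_itvR.
  - exact/measurable_EFinP.
have meas : measurable_fun `[al, al + P[ (fun x => \sum_(0 <= n <oo) (f (x + b n)%R)%:E)%E.
  apply: ge0_emeasurable_sum => [n x _ _|n _]; first by rewrite lee_fin.
  by apply/measurable_EFinP; exact: measurable_funS (mfb n).
have jS : mu.-integrable `[al, al + P[ (fun x => \sum_(0 <= n <oo) (f (x + b n)%R)%:E)%E.
  apply/integrableP; split => //.
  suff <- : (\int[mu]_(x in `[al, (al + P)%R[) \sum_(0 <= n <oo) (f (x + b n)%R)%:E =
      \int[mu]_(x in `[al, (al + P)%R[) `|\sum_(0 <= n <oo) (f (x + b n)%R)%:E|)%E by [].
  apply: eq_integral => x _; rewrite gee0_abs//.
  by apply: nneseries_ge0 => n _ _; rewrite lee_fin.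
have := integrable_ae (measurable_itvR _) jS.
apply: ae_weaken => x H xC; apply: nneseries_cvg0 => //.
by rewrite -ge0_fin_numE; [apply: H; rewrite /= in_itv|apply: nneseries_ge0 => n _ _; rewrite lee_fin].
Qed.

Lemma ae_cells (P : R) (Z : R -> Prop) : 0 < P ->
  (forall al : R, {ae mu, forall x, al <= x < al + P -> Z x}) -> {ae mu, forall x, Z x}.
Proof.
move=> P0 aeZ.
have pos := ae_foralln (fun n : nat => aeZ (n%:R * P)).
have neg := ae_foralln (fun n : nat => aeZ (- (n%:R * P))).
apply: ae_weaken2 pos neg => x px nx.
by have [n [|]] := periodic_cell x P0; [exact: px|exact: nx].
Qed.

(** For almost every starting point, the squares of the values along the progression
    have a finite sum. *)
Lemma L2r_tails (P : R) f : 0 < P -> L2r [set: R] f ->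
  {ae mu, forall x, (fun n => f (x + n%:R * P)) @ \oo --> (0 : R) /\
                    (fun n => f (x - n%:R * P)) @ \oo --> (0 : R)}.
Proof.
move=> P0 [mf jf]; apply: (ae_cells P0) => al.
have sq0 (u : nat -> R) : (fun n => u n ^+ 2) @ \oo --> (0 : R) -> u @ \oo --> (0 : R).
  move=> u2; apply/norm_cvg0P.
  have := continuous_cvg _ (@sqrt_continuous R 0) u2; rewrite sqrtr0.
  have -> : (fun n => `|u n|) = (fun n => Num.sqrt (u n ^+ 2)); last exact.
  by apply/funext => n; rewrite sqrtr_sqr.
have dist (i j : nat) := @progression_dist P i j P0.
have f20 x : 0 <= f x ^+ 2 by rewrite sqr_ge0.
have pos := @tail_cell al P (fun n => n%:R * P) (fun x => f x ^+ 2) dist f20 jf.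
have dist' (i j : nat) : i != j -> P <= `|- (i%:R * P) - - (j%:R * P)|.
  by move=> ij; rewrite -opprD normrN dist.
have neg := @tail_cell al P (fun n => - (n%:R * P)) (fun x => f x ^+ 2) dist' f20 jf.
by apply: ae_weaken2 pos neg => x px nx xC; split; apply: sq0; [exact: px|exact: nx].
Qed.

Lemma ae_periodic_iter (P : R) f : (ae_eq mu [set: R] (fun x => f (x + P)) f) ->
  {ae mu, forall x, forall n : nat, f (x + n%:R * P) = f x /\ f (x - n%:R * P) = f x}.
Proof.
move=> fP.
have pos (n : nat) : {ae mu, forall x, f (x + n%:R * P) = f x}.
  elim: n => [|n IH]; first by apply: aeW => x; rewrite mul0r addr0.
  have fP' : {ae mu, forall x, f (x + n%:R * P + P) = f (x + n%:R * P)}.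
    by apply: ae_weaken (ae_translate (n%:R * P) fP) => x; apply.
  apply: ae_weaken2 fP' IH => x h1 h2.
  by rewrite -natr1 mulrDl mul1r addrA h1.
apply: ae_foralln => n.
have neg : {ae mu, forall x, f (x - n%:R * P) = f x}.
  by apply: ae_weaken (ae_translate (- (n%:R * P)) (pos n)) => x; rewrite subrK => ->.
by apply: ae_weaken2 (pos n) neg.
Qed.

(** The weight [1 / (1 + |x|)] makes locally square-integrable periodic functions
    square-integrable. *)
Definition decay (x : R) : R := (1 + `|x|)^-1.

Lemma decay_gt0 x : 0 < decay x.
Proof. by rewrite invr_gt0 ltr_pwDl. Qed.

Lemma measurable_decay : measurable_fun [set: R] decay.
Proof.
apply: continuous_measurable_fun => x; apply: cvgV.
  by rewrite gt_eqF// ltr_pwDl.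
by apply: cvgD; [exact: cvg_cst|exact: norm_continuous].
Qed.

Lemma sum_decay_le (n : nat) : \sum_(0 <= j < n) (j.+1%:R * j.+2%:R)^-1 <= 1 :> R.
Proof.
suff -> : \sum_(0 <= j < n) (j.+1%:R * j.+2%:R)^-1 = 1 - n.+1%:R^-1 :> R.
  by rewrite lerBlDr lerDl invr_ge0.
elim: n => [|n IH]; first by rewrite big_nil invr1 subrr.
rewrite big_nat_recr//= IH -(natr1 n.+1).
have : n.+1%:R != 0 :> R by rewrite pnatr_eq0.
have : n.+1%:R + 1 != 0 :> R by rewrite natr1 pnatr_eq0.
by move: (n.+1%:R) => t h1 h2; field; rewrite h1 h2.
Qed.

(** On the [j]-th cell the squared weight is of order [1 / j ^ 2], which is bounded by
    a telescoping sequence. *)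
Lemma decay_cell (P x : R) (j : nat) (h : R) : 0 < P -> j%:R * P <= `|x + h| ->
  decay (x + h) ^+ 2 <= 4 * (1 + P^-2) * (j.+1%:R * j.+2%:R)^-1.
Proof.
move=> P0 jx; rewrite /decay exprVn -lef_pV2 ?posrE ?invr_gt0 ?exprn_gt0 ?ltr_pwDl//; last first.
  rewrite mulr_gt0 ?invr_gt0 ?mulr_gt0 ?ltr0n// ltr_pwDl// ?invr_ge0 ?exprn_ge0 ?(ltW P0)//.
rewrite invfM !invrK.
rewrite ler_pdivrMl; last first.
  by rewrite mulr_gt0// ltr_pwDl// invr_ge0 exprn_ge0// ltW.
have j0 : 0 <= j%:R :> R by [].
have le1 : 1 + (j%:R * P) ^+ 2 <= (1 + `|x + h|) ^+ 2.
  rewrite sqrrD expr1n -addrA lerD2l mul1r ler_wpDl ?mulrn_wge0//.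
  by rewrite lerXn2r ?nnegrE// mulr_ge0// ltW.
have P2 : 0 < P ^+ 2 by rewrite exprn_gt0.
have le2 : 1 + j%:R ^+ 2 <= (1 + P^-2) * (1 + (j%:R * P) ^+ 2).
  have -> : (1 + P^-2) * (1 + (j%:R * P) ^+ 2) =
     1 + j%:R ^+ 2 + (P^-2 + (j%:R * P) ^+ 2) by field; rewrite gt_eqF.
  by rewrite lerDl addr_ge0 ?sqr_ge0// invr_ge0 ltW.
have le3 : j.+1%:R * j.+2%:R <= 4 * (1 + j%:R ^+ 2) :> R.
  rewrite -(natr1 j.+1) -(natr1 j); have := sqr_ge0 (j%:R - 2^-1 : R); nra.
apply: le_trans le3 _; rewrite -mulrA ler_pM2l//; apply: le_trans le2 _.
by rewrite ler_wpM2l// addr_ge0// invr_ge0 exprn_ge0// ltW.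
Qed.

(** Cut the line into period cells and sum the bounds on the weight; the factor [8] is
    twice the [4] of [decay_cell], one for each half-line. *)
Lemma periodic_weighted_le (P : R) f : 0 < P -> measurable_fun [set: R] f ->
  ae_eq mu [set: R] (fun x => f (x + P)) f ->
  (\int[mu]_x ((decay x * f x) ^+ 2)%:E <=
   (8 * (1 + P^-2))%:E * \int[mu]_(x in `[0%R, P[) (f x ^+ 2)%:E)%E.
Proof.
move=> P0 mf fP.
have mg : measurable_fun [set: R] (fun x => decay x * f x).
  by apply: measurable_funM => //; exact: measurable_decay.
pose g x := (decay x * f x) ^+ 2.
have mg2 : measurable_fun [set: R] g by exact: measurable_funX.
have g0 x : 0 <= g x by rewrite sqr_ge0.
pose K := 4 * (1 + P^-2) : R.
have K0 : 0 <= K by rewrite mulr_ge0// addr_ge0// invr_ge0 exprn_ge0// ltW.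
pose I := (\int[mu]_(x in `[0%R, P[) (f x ^+ 2)%:E)%E.
have I0 : (0 <= I)%E by apply: integral_ge0 => x _; rewrite lee_fin sqr_ge0.
have half b : (forall i j, i != j -> P <= `|b i - b j|) ->
    (forall n, {ae mu, forall x, f (x + b n) = f x}) ->
    (forall n x, 0 <= x < P -> n%:R * P <= `|x + b n|) ->
    (\int[mu]_(x in \bigcup_j `[(0 + b j)%R, (0 + b j + P)%R[%classic) (g x)%:E <= K%:E * I)%E.
  move=> bP fb bd.
  rewrite (@ge0_integral_bigcup _ _ _ mu (fun j => `[0 + b j, 0 + b j + P[%classic))//; last 3 first.
  - by apply/measurable_EFinP; exact: measurable_funS mg2.
  - by move=> x _; rewrite lee_fin.
  - exact: cells_trivIset.
  apply: lime_le.
    by apply: is_cvg_nneseries => n _ _; apply: integral_ge0 => x _; rewrite lee_fin.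
  apply: nearW => n.
  have -> : (K%:E * I = K%:E * I * 1)%E by rewrite mule1.
  have S1 := sum_decay_le n.
  apply: (@le_trans _ _ (K%:E * I * (\sum_(0 <= j < n) (j.+1%:R * j.+2%:R)^-1)%:E)%E); last first.
    by rewrite lee_wpmul2l ?mule_ge0 ?lee_fin.
  rewrite -sumEFin ge0_sume_distrr; last by move=> i _; rewrite lee_fin invr_ge0 mulr_ge0.
  apply: lee_sum => j _; rewrite integral_cell// add0r.
  rewrite muleAC -EFinM -ge0_integralZl//; last 3 first.
  - by apply/measurable_EFinP; apply: measurable_funX; exact: measurable_funS mf.
  - by move=> x _; rewrite lee_fin sqr_ge0.
  - by rewrite lee_fin mulr_ge0// invr_ge0 mulr_ge0.
  apply: ae_ge0_le_integral => //.
  - by move=> x _; rewrite lee_fin.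
  - apply/measurable_EFinP; have -> : (fun x => g (x + b j)) = g \o affine 1 (b j).
      by apply/funext => x; rewrite /affine/= mul1r.
    have mga := @measurable_fun_affine _ 1 (b j) g mg2.
    exact: measurable_funS mga.
  - by move=> x _; rewrite mule_ge0 ?lee_fin ?sqr_ge0// mulr_ge0// invr_ge0 mulr_ge0.
  - apply/measurable_EFinP; apply: measurable_funM => //; apply: measurable_funX.
    exact: measurable_funS mf.
  - apply: ae_weaken (fb j) => x fx; rewrite /= in_itv/= => xP.
    rewrite -EFinM lee_fin /g exprMn fx ler_wpM2r ?sqr_ge0//.
    by apply: decay_cell => //; exact: bd.
have dist (i j : nat) := @progression_dist P i j P0.
have per := ae_periodic_iter fP.
have pos := half (fun n => n%:R * P) dist.
have neg := half (fun n => - (n.+1%:R * P)).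
pose U := \bigcup_j `[0 + j%:R * P, 0 + j%:R * P + P[%classic.
pose N := \bigcup_j `[0 + - (j.+1%:R * P), 0 + - (j.+1%:R * P) + P[%classic.
have mU : measurable U by apply: bigcup_measurable => j _; exact: measurable_itvR.
have mN : measurable N by apply: bigcup_measurable => j _; exact: measurable_itvR.
have TUN : [set: R] = U `|` N.
  apply/seteqP; split => x // _.
  have [n [|]] := periodic_cell x P0 => xn; [left|right]; exists n => //=;
    by rewrite in_itv/= !add0r.
have UN0 : U `&` N = set0.
  rewrite -subset0 => x [[i _ /=]]; rewrite in_itv/= !add0r => /andP[i1 _] [j _ /=].
  rewrite in_itv/= !add0r => /andP[_ j2].
  have : 0 <= i%:R * P by rewrite mulr_ge0// ltW.
  have : 0 <= j%:R * P by rewrite mulr_ge0// ltW.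
  move: j2; rewrite -natr1 mulrDl mul1r; lra.
rewrite TUN ge0_integral_setU//; last 3 first.
- by rewrite -TUN; exact/measurable_EFinP.
- by move=> x _; rewrite lee_fin; exact: g0.
- by rewrite disj_set2E UN0.
have -> : ((8 * (1 + P^-2))%:E * I = K%:E * I + K%:E * I)%E.
  by rewrite -ge0_muleDl ?lee_fin// -EFinD; congr (_%:E * _)%E; rewrite /K; ring.
apply: leeD.
  apply: pos => [n|n x /andP[x0 _]].
    by apply: ae_weaken per => x /(_ n)[].
  by rewrite ger0_norm ?addr_ge0 ?mulr_ge0 ?(ltW P0)// lerDr.
apply: neg => [i j ij|n|n x /andP[x0 xP]].
- by rewrite -opprD normrN; apply: dist.
- by apply: ae_weaken per => x /(_ n.+1)[].
- rewrite ler0_norm; last by rewrite subr_le0 -natr1 mulrDl mul1r; have := ltW xP;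
    have : 0 <= n%:R * P by [rewrite mulr_ge0// ltW]; lra.
  by rewrite -natr1 mulrDl mul1r; lra.
Qed.

Lemma periodic_weighted (P : R) f : 0 < P -> L2locr f ->
  ae_eq mu [set: R] (fun x => f (x + P)) f -> L2r [set: R] (fun x => decay x * f x).
Proof.
move=> P0 lf fP; have [mf _] := lf.
have mg : measurable_fun [set: R] (fun x => decay x * f x).
  by apply: measurable_funM => //; exact: measurable_decay.
split=> //; apply/integrableP; split; first exact/measurable_EFinP/measurable_funX.
under eq_integral do rewrite /= ger0_norm ?sqr_ge0//.
apply: le_lt_trans (periodic_weighted_le P0 mf fP) _.
rewrite lte_mul_pinfty ?lee_fin//.
  by rewrite mulr_ge0// addr_ge0// invr_ge0 exprn_ge0// ltW.
have [_ /integrableP[_]] := L2locr_itv 0 P lf; apply: le_lt_trans.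
under [leRHS]eq_integral do rewrite /= ger0_norm ?sqr_ge0//.
apply: ge0_subset_integral => //.
- by apply/measurable_EFinP; apply: measurable_funX; exact: measurable_funS mf.
- by move=> x _; rewrite lee_fin sqr_ge0.
- by apply: subset_itvl; rewrite bnd_simp.
Qed.

End Translates.

(** * The logistic function *)
Section Logistic.
Context {R : realType}.

Definition logistic (x : R) : R := (1 + expR (- x))^-1.

Lemma logistic_gt0 x : 0 < logistic x.
Proof. by rewrite invr_gt0 ltr_pwDl// expR_ge0. Qed.

Lemma logistic_lt1 x : logistic x < 1.
Proof.
have h : 1 < 1 + expR (- x) by rewrite ltrDl expR_gt0.
by rewrite /logistic invf_lt1// (lt_trans ltr01).
Qed.

Lemma is_derive_logistic x : is_derive x (1 : R) logistic (logistic x - logistic x ^+ 2).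
Proof.
have n0 : 1 + expR (- x) != 0 by rewrite gt_eqF// ltr_pwDl// expR_ge0.
have dN : is_derive x (1 : R) (fun y : R => - y) (- 1).
  exact: is_deriveN (is_derive_id x (1 : R)).
have dE := @is_derive1_comp _ expR (fun y => - y) x _ _ (is_derive_expR (- x)) dN.
have dD := is_deriveD (is_derive_cst (1 : R) x (1 : R)) dE.
have dV := @is_deriveV _ (fun y => 1 + expR (- y)) x _ _ n0 dD.
apply: is_derive_eq dV _; rewrite /logistic /GRing.scale/=.
by field.
Qed.

(** Since [s' = s - s ^ 2], every derivative of the logistic function [s] is a
    polynomial in [s]. *)
Definition logistic_poly (n : nat) : {poly R} := iter n (fun p => p^`() * ('X - 'X^2)) 'X.

Definition logistic_n (n : nat) (x : R) : R := (logistic_poly n).[logistic x].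

Lemma logistic_n0 x : logistic_n 0 x = logistic x.
Proof. by rewrite /logistic_n /= hornerX. Qed.

Lemma logistic_derivs : derivs logistic_n.
Proof.
move=> n x.
have := @is_derive1_comp _ _ logistic x _ _
  (is_derive_poly (logistic_poly n) (logistic x)) (is_derive_logistic x).
by move=> /is_derive_eq; apply; rewrite /logistic_n /= !hornerE.
Qed.

Definition heaviside (x : R) : R := if 0 <= x then 1 else 0.

(** The logistic function approaches its limits exponentially fast, hence at the rate
    of [decay]. *)
Lemma logistic_decay x : `|logistic x - heaviside x| <= decay x.
Proof.
have e0 := expR_gt0 (- x); have d0 : 0 < 1 + expR (- x) by rewrite ltr_pwDl// ltW.
rewrite /logistic /decay /heaviside; case: (leP 0 x) => x0.
  rewrite distrC ger0_norm ?subr_ge0 ?invf_le1// ?lerDl ?(ltW e0)// (ger0_norm x0).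
  have -> : 1 - (1 + expR (- x))^-1 = (1 + expR x)^-1.
    rewrite expRN; field; rewrite !gt_eqF ?expR_gt0 ?ltr_pwDl ?expR_ge0//.
  rewrite lef_pV2 ?posrE ?ltr_pwDl ?expR_ge0//.
  by rewrite (le_trans (expR_ge1Dx x))// lerDr.
rewrite subr0 gtr0_norm ?invr_gt0// (ltr0_norm x0).
rewrite lef_pV2 ?posrE ?ltr_pwDl ?oppr_ge0 ?(ltW x0) ?expR_ge0//.
by rewrite lerD2l (le_trans _ (expR_ge1Dx _))// lerDr.
Qed.

Lemma logistic_nS_decay n : exists2 K : R, 0 <= K &
  forall x, `|logistic_n n.+1 x| <= K * decay x.
Proof.
pose p := (logistic_poly n)^`().
exists (\sum_(i < size p) `|p`_i|); first by apply: sumr_ge0.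
move=> x; have s0 := logistic_gt0 x; have s1 := logistic_lt1 x.
rewrite /logistic_n /= hornerM normrM -/p ler_pM//.
  rewrite horner_coef (le_trans (ler_norm_sum _ _ _))// ler_sum// => i _.
  rewrite normrM ler_piMr// normrX exprn_ile1//.
  by rewrite ger0_norm ltW.
rewrite !hornerE; have -> : logistic x - logistic x ^+ 2 = logistic x * (1 - logistic x) by ring.
have := logistic_decay x; rewrite /heaviside; case: (0 <= x) => /= h.
  rewrite normrM distrC (le_trans _ h)// ler_piMl//.
  by rewrite ger0_norm ltW.
rewrite normrM (le_trans _ h)// subr0 ler_piMr//.
by rewrite ger0_norm ?subr_ge0 ?gerBl ltW.
Qed.

Lemma decayZ (e x : R) : 0 < e <= 1 -> e * decay (e * x) <= decay x.
Proof.
move=> /andP[e0 e1]; rewrite /decay normrM (gtr0_norm e0).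
rewrite ler_pdivrMr; last by rewrite ltr_pwDl// mulr_ge0// ltW.
rewrite mulrC ler_pdivlMr ?ltr_pwDl// mulrDr mulr1 lerD2r//.
Qed.

Lemma decayD (P x : R) : 0 <= P -> decay (x + P) <= (1 + P) * decay x.
Proof.
move=> P0; rewrite /decay ler_pdivlMr ?ltr_pwDl// mulrC ler_pdivrMr ?ltr_pwDl//.
have : `|x| <= `|x + P| + P.
  by have := ler_normB (x + P) P; rewrite addrK (ger0_norm P0).
have : 0 <= P * `|x + P| by rewrite mulr_ge0.
lra.
Qed.

Lemma logistic_n_scaled n (e x K : R) : 0 < e <= 1 -> 0 <= K ->
  (forall x, `|logistic_n n.+1 x| <= K * decay x) ->
  `|e ^+ n.+1 * logistic_n n.+1 (e * x)| <= K * decay x /\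
  `|e ^+ n.+1 * logistic_n n.+1 (e * x)| <= K * e.
Proof.
move=> e01 K0 hK; have /andP[e0 e1] := e01.
have le1 : `|e ^+ n.+1 * logistic_n n.+1 (e * x)| <= K * (e * decay (e * x)).
  rewrite normrM normrX (gtr0_norm e0) mulrCA ler_pM ?exprn_ge0 ?(ltW e0)//.
  by rewrite exprS ler_piMr ?(ltW e0)// exprn_ile1// ltW.
split; apply: (le_trans le1); rewrite ler_wpM2l//; first exact: decayZ.
by rewrite ler_piMr ?(ltW e0)// /decay invf_le1 ?ltr_pwDl// lerDl.
Qed.

Definition decaying (A : nat -> R -> R) : Prop :=
  forall n, exists C : R, forall x, `|A n x| <= C * decay x.

(** Cutting the logistic function off by its own dilation, since a dilation has the
    same limits at both infinities. *)
Definition cutoff (e : R) (n : nat) (x : R) : R :=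
  logistic_n n x - e ^+ n * logistic_n n (e * x).

Lemma dilation_derivs (e : R) : derivs (fun n x => e ^+ n * logistic_n n (e * x)).
Proof.
have := derivs_affine e 0 logistic_derivs.
rewrite (_ : (fun n x => _) = (fun n x => e ^+ n * logistic_n n (e * x)))//.
by apply/funext => n; apply/funext => x; rewrite addr0.
Qed.

Lemma derivsB (A B : nat -> R -> R) : derivs A -> derivs B ->
  derivs (fun n x => A n x - B n x).
Proof. by move=> dA dB n x; exact: is_deriveB. Qed.

Lemma cutoff_derivs (e : R) : derivs (cutoff e).
Proof. exact: derivsB logistic_derivs (dilation_derivs e). Qed.

Lemma cutoff_decaying (e : R) : 0 < e <= 1 -> decaying (cutoff e).
Proof.
move=> e01; have /andP[e0 e1] := e01; move=> [|n].
  exists (1 + e^-1) => x; rewrite /cutoff expr0 mul1r !logistic_n0.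
  have -> : logistic x - logistic (e * x) =
    (logistic x - heaviside x) - (logistic (e * x) - heaviside (e * x)).
    rewrite (_ : heaviside (e * x) = heaviside x); first by ring.
    by rewrite /heaviside pmulr_rge0.
  rewrite (le_trans (ler_normB _ _))// mulrDl mul1r lerD ?logistic_decay//.
  by rewrite (le_trans (logistic_decay _))// ler_pdivlMl// decayZ.
have [K K0 hK] := logistic_nS_decay n; exists (K + K) => x.
have [h _] := logistic_n_scaled x e01 K0 hK.
by rewrite /cutoff (le_trans (ler_normB _ _))// mulrDl lerD.
Qed.

Definition logistic_shift (P : R) (n : nat) (x : R) : R := logistic_n n (x + P) - logistic_n n x.

Lemma translate_derivs (P : R) : derivs (fun n x => logistic_n n (x + P)).
Proof.
have := derivs_affine 1 P logistic_derivs.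
rewrite (_ : (fun n x => _) = (fun n x => logistic_n n (x + P)))//.
by apply/funext => n; apply/funext => x; rewrite expr1n !mul1r.
Qed.

Lemma logistic_shift_derivs (P : R) : derivs (logistic_shift P).
Proof. exact: derivsB (translate_derivs P) logistic_derivs. Qed.

Lemma logistic_shift_decaying (P : R) : 0 < P -> decaying (logistic_shift P).
Proof.
move=> P0 [|n]; last first.
  have [K K0 hK] := logistic_nS_decay n; exists (K * (1 + P) + K) => x.
  rewrite /logistic_shift (le_trans (ler_normB _ _))// mulrDl lerD//.
  by rewrite (le_trans (hK _))// -mulrA ler_wpM2l// decayD// ltW.
exists ((1 + P) + 1 + (1 + P)) => x; rewrite /logistic_shift !logistic_n0.
have -> : logistic (x + P) - logistic x =
    (logistic (x + P) - heaviside (x + P)) - (logistic x - heaviside x) +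
    (heaviside (x + P) - heaviside x) by ring.
rewrite (le_trans (ler_normD _ _))// [leRHS]mulrDl lerD//.
  rewrite (le_trans (ler_normB _ _))// [leRHS]mulrDl mul1r lerD ?logistic_decay//.
  by rewrite (le_trans (logistic_decay _))// decayD// ltW.
have D0 : 0 <= (1 + P) * decay x.
  by rewrite mulr_ge0 ?(ltW (decay_gt0 _))// addr_ge0// ltW.
rewrite /heaviside; have [x0|x0] := leP 0 x.
  by rewrite (le_trans x0) ?subrr ?normr0// lerDl ltW.
have [xP|xP] := leP 0 (x + P); last by rewrite subrr normr0.
rewrite subr0 normr1 /decay ler_pdivlMr ?ltr_pwDl// mul1r lerD2l (ltr0_norm x0); lra.
Qed.

Lemma decay_cvg (P x : R) : 0 < P ->
  (fun n : nat => decay (x + n%:R * P)) @ \oo --> (0 : R) /\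
  (fun n : nat => decay (x - n%:R * P)) @ \oo --> (0 : R).
Proof.
move=> P0.
have le h : (forall n : nat, n%:R * P <= `|x + h n| + `|x|) ->
    (fun n : nat => decay (x + h n)) @ \oo --> (0 : R).
  move=> hh; pose C := (1 + P^-1) * (1 + `|x|).
  have C0 : 0 <= C by rewrite mulr_ge0 ?addr_ge0// invr_ge0 ltW.
  apply: (@squeeze_cvgr _ _ _ _ (cst 0) (fun n : nat => C * n.+1%:R^-1)).
  - apply: nearW => n; rewrite (ltW (decay_gt0 _))/= /decay.
    rewrite -[X in X <= _]mul1r ler_pdivrMr ?ltr_pwDl// mulrAC ler_pdivlMr// mul1r.
    have hn := hh n; have y0 := normr_ge0 (x + h n); have x0 := normr_ge0 x.
    have : n%:R <= P^-1 * (`|x + h n| + `|x|) by rewrite mulrC ler_pdivlMr.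
    have Pi : 0 < P^-1 by rewrite invr_gt0.
    rewrite -natr1 /C; set u := `|x + h n| in hn y0 *; set v := `|x| in hn x0 *.
    set w := P^-1 in Pi *; move=> hw.
    have h1 : 0 <= w * (u * v) by rewrite !mulr_ge0// ltW.
    have h2 : 0 <= u * v by rewrite mulr_ge0.
    have h3 : 0 <= w by rewrite ltW.
    nra.
  - exact: cvg_cst.
  - by rewrite -(mulr0 C); apply: cvgM; [exact: cvg_cst|exact: cvg_harmonic].
split; first apply: (le (fun n => n%:R * P)) => n.
  have := ler_normB (x + n%:R * P) x; rewrite addrAC subrr add0r ger0_norm//.
  by rewrite mulr_ge0// ltW.
apply: (le (fun n => - (n%:R * P))) => n.
have := ler_normB (x - n%:R * P) x; rewrite addrAC subrr add0r normrN ger0_norm//.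
by rewrite mulr_ge0// ltW.
Qed.

Lemma logistic_cvg (P x : R) : 0 < P ->
  (fun n : nat => logistic (x + n%:R * P)) @ \oo --> (1 : R) /\
  (fun n : nat => logistic (x - n%:R * P)) @ \oo --> (0 : R).
Proof.
move=> P0; have [d1 d2] := decay_cvg x P0.
have large : \forall n \near \oo, `|x| <= n%:R * P.
  near=> n; rewrite -ler_pdivrMr//; near: n; exact: nbhs_infty_ger.
split.
  apply/cvgrPdist_lt => e e0; have /cvgr0_norm_lt/(_ _ e0) dn := d1.
  near=> n; have xn : `|x| <= n%:R * P by near: n.
  have : `|decay (x + n%:R * P)| < e by near: n.
  rewrite (gtr0_norm (decay_gt0 _)); apply: le_lt_trans.
  have := logistic_decay (x + n%:R * P); rewrite distrC /heaviside.
  rewrite ifT//; have := ler_norm (- x); rewrite normrN; lra.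
apply/cvgrPdist_lt => e e0; have /cvgr0_norm_lt/(_ _ e0) dn := d2.
near=> n; have xn : `|x| < n%:R * P.
  near: n; near=> n; rewrite -ltr_pdivrMr//; near: n; exact: nbhs_infty_gtr.
have : `|decay (x - n%:R * P)| < e by near: n.
rewrite (gtr0_norm (decay_gt0 _)); apply: le_lt_trans.
have := logistic_decay (x - n%:R * P); rewrite distrC /heaviside ifF//.
by apply/negbTE; rewrite -ltNge subr_lt0 (le_lt_trans (ler_norm _)).
Unshelve. all: by end_near. Qed.

End Logistic.

(** * Translation-invariant spaces of square-integrable functions *)
Section TranslationInvariant.
Context {R : realType}.
Local Notation mu := (@lebesgue_measure R).

Lemma normc_le_parts (z : R[i]) : Normc.normc z <= `|complex.Re z| + `|complex.Im z|.
Proof.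
case: z => a b /=; rewrite -[leRHS]ger0_norm ?addr_ge0// -sqrtr_sqr ler_wsqrtr//.
rewrite sqrrD !real_normK ?num_real// -addrA lerD2l lerDr mulrn_wge0// mulr_ge0//.
Qed.

Lemma normc_ge0 (z : R[i]) : 0 <= Normc.normc z.
Proof. by case: z => a b /=; rewrite sqrtr_ge0. Qed.

Lemma L2on_scale (D : set R) (a : R[i]) (u : R -> R[i]) : measurable D -> L2on D u ->
  L2on D (a *: u).
Proof.
move=> mD /(L2on_parts _ mD)[lr li]; apply/(L2on_parts _ mD); split.
  have -> : re (a *: u) = fun x => complex.Re a * re u x - complex.Im a * im u x.
    by apply/funext => x; rewrite /re /im /GRing.scale/=; case: a => a b; case: (u x) => p q.
  by apply: L2rB => //; exact: L2rZ.
have -> : im (a *: u) = fun x => complex.Re a * im u x + complex.Im a * re u x.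
  by apply/funext => x; rewrite /re /im /GRing.scale/=; case: a => a b; case: (u x) => p q.
by apply: L2rD => //; exact: L2rZ.
Qed.

Lemma L2on_add (D : set R) (u v : R -> R[i]) : measurable D -> L2on D u -> L2on D v ->
  L2on D (u + v).
Proof.
move=> mD /(L2on_parts _ mD)[ur ui] /(L2on_parts _ mD)[vr vi]; apply/(L2on_parts _ mD).
split.
  have -> : re (u + v) = fun x => re u x + re v x.
    by apply/funext => x; rewrite /re -raddfD.
  exact: L2rD.
have -> : im (u + v) = fun x => im u x + im v x.
  by apply/funext => x; rewrite /im -raddfD.
exact: L2rD.
Qed.

Lemma L2on_sum (D : set R) (n : nat) (a : 'I_n -> R[i]) (u : 'I_n -> R -> R[i]) :
  measurable D -> (forall i, L2on D (u i)) -> L2on D (\sum_(i < n) a i *: u i).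
Proof.
move=> mD Lu; apply: big_ind => [|v w|i _].
- by apply/(L2on_parts _ mD); split; exact: L2r_cst0.
- exact: L2on_add.
- exact: L2on_scale.
Qed.

(** An eigenvector of a translation grows or decays geometrically along almost every
    arithmetic progression, which square-integrability forbids. *)
Lemma translation_eigenvector_null (P : R) (m : R[i]) (v : R -> R[i]) : 0 < P ->
  L2on [set: R] v -> {ae mu, forall x, v (x + P) = m * v x} -> null_on [set: R] v.
Proof.
move=> P0 /(L2on_parts _ measurableT)[lr li] vP.
have pos (n : nat) : {ae mu, forall x, v (x + n%:R * P) = m ^+ n * v x}.
  elim: n => [|n IH]; first by apply: aeW => x; rewrite mul0r addr0 expr0 mul1r.
  apply: ae_weaken2 (ae_translate (n%:R * P) vP) IH => x h1 h2.
  by rewrite -natr1 mulrDl mul1r addrA h1 h2 mulrA exprS.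
have neg (n : nat) : {ae mu, forall x, v x = m ^+ n * v (x - n%:R * P)}.
  by apply: ae_weaken (ae_translate (- (n%:R * P)) (pos n)) => x; rewrite subrK.
have all := ae_weaken2 (fun x a b => conj a b) (ae_foralln pos) (ae_foralln neg).
have tails := ae_weaken2 (fun x a b => conj a b) (L2r_tails P0 lr) (L2r_tails P0 li).
apply: ae_weaken2 all tails => x [px nx] [[r1 r2] [i1 i2]] _.
have small (w : nat -> R[i]) : (forall n, Normc.normc (v x) <= Normc.normc (w n)) ->
    (fun n => complex.Re (w n)) @ \oo --> (0 : R) ->
    (fun n => complex.Im (w n)) @ \oo --> (0 : R) -> v x = 0.
  move=> le rw iw; apply: Normc.eq0_normc; apply/eqP; rewrite eq_le normc_ge0 andbT.
  have cv : (fun n => `|complex.Re (w n)| + `|complex.Im (w n)|) @ \oo --> (0 + 0 : R).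
    by apply: cvgD; apply/norm_cvg0P.
  rewrite addr0 in cv; rewrite -(cvg_lim _ cv)//.
  apply: limr_ge; first by apply/cvg_ex; exists 0.
  by apply: nearW => n; exact: le_trans (le n) (normc_le_parts _).
have nX n : Normc.normc (m ^+ n) = Normc.normc m ^+ n.
  elim: n => [|n IH]; first by rewrite !expr0 Normc.normc1.
  by rewrite !exprS Normc.normcM IH.
have [m1|m1] := leP 1 (Normc.normc m).
  apply: (small (fun n => v (x + n%:R * P))) => // n.
  by rewrite px Normc.normcM nX ler_peMl ?normc_ge0// exprn_ege1.
apply: (small (fun n => v (x - n%:R * P))) => // n.
by rewrite [in leLHS](nx n) Normc.normcM nX ler_piMl ?normc_ge0// exprn_ile1 ?normc_ge0// ltW.
Qed.

(** An invariant space of finite positive dimension contains an eigenvector of the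
    translation. *)
Lemma translation_invariant_null (P : R) (E : set (R -> R[i])) (d : nat) : 0 < P ->
  (forall u, E u -> L2on [set: R] u) -> (forall u, E u -> E (fun x => u (x + P))) ->
  dim_mod E (null_on [set: R]) d -> forall u, E u -> null_on [set: R] u.
Proof.
move=> P0 EL EP [e [Ee gen ind]].
case: d e Ee gen ind => [|d] e Ee gen ind.
  by move=> u /gen[a]; rewrite big_ord0 subr0.
exfalso.
have [A hA] := choice (fun i => gen _ (EP _ (Ee i))).
(* The matrix of the translation, which has an eigenvector over the complex numbers. *)
pose M : 'M[R[i]]_d.+1 := \matrix_(i, j) A i j.
have [m /eqP] : exists m : R[i], root (char_poly M) m.
  by apply/closed_rootP; rewrite size_char_poly.
move/eqP; rewrite -[_ == 0]/(root (char_poly M) m) -eigenvalue_root_char.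
move=> /eigenvalueP[y yM y0].
pose v : R -> R[i] := \sum_(i < d.+1) y 0 i *: e i.
have vL : L2on [set: R] v by apply: L2on_sum => // i; exact: EL.
have vP : {ae mu, forall x, v (x + P) = m * v x}.
  have aei : {ae mu, forall x, forall i : nat, forall hi : (i < d.+1)%N,
      e (Ordinal hi) (x + P) = \sum_(j < d.+1) A (Ordinal hi) j * e j x}.
    apply: ae_foralln => i; have [hi|hi] := pselect (i < d.+1)%N; last first.
      by apply: aeW => x hi'; case: hi.
    apply: ae_weaken (hA (Ordinal hi)) => x /(_ I) h hi'.
    rewrite (bool_irrelevance hi' hi); apply/eqP; rewrite -subr_eq0; apply/eqP.
    rewrite -[RHS]h; congr (_ - _).
    by rewrite fct_sumE.
  apply: ae_weaken aei => x hx.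
  rewrite /v !fct_sumE.
  transitivity (\sum_(i < d.+1) \sum_(j < d.+1) y 0 i * (A i j * e j x)).
    apply: eq_bigr => i _; rewrite -mulr_sumr /GRing.scale/=; congr (_ * _).
    by have := hx i (ltn_ord i); rewrite (_ : Ordinal _ = i)//; exact: val_inj.
  rewrite exchange_big/= mulr_sumr; apply: eq_bigr => j _.
  rewrite /GRing.scale/= mulrA; have /rowP/(_ j) := yM; rewrite !mxE => <-.
  by rewrite mulr_suml; apply: eq_bigr => i _; rewrite mxE mulrA.
have := ind (fun i => y 0 i) (translation_eigenvector_null P0 vL vP) => y00.
by move/eqP: y0; apply; apply/rowP => i; rewrite y00 mxE.
Qed.

End TranslationInvariant.

(** * Periodic eigenfunctions produce essential spectrum on the line *)
Section EssentialSpectrum.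
Context {R : realType}.
Local Notation mu := (@lebesgue_measure R).
Local Notation locint F := (locally_integrable [set: R] F).
Variables (P k c L nu : R) (Q : nat -> R -> R).
Hypotheses (P0 : 0 < P) (dQ : derivs Q) (QP : forall n x, Q n (x + P) = Q n x).
Implicit Types (F f A U : nat -> R -> R).

Local Notation form := (KPform k c L Q).
Local Notation T := (KPop_line L%:C%C k c (Q 0%N)).
Local Notation S := (shift_op T nu%:C%C).
Local Notation chain F := (sobolev_chain (L2r [set: R]) F (F 0%N)).

Lemma leibnizBr A F G n x :
  leibniz A (fun m y => F m y - G m y) n x = leibniz A F n x - leibniz A G n x.
Proof.
by rewrite /leibniz -sumrB; apply: eq_bigr => i _; rewrite !mulrBr.
Qed.

Lemma KPformB F G x : form (fun m y => F m y - G m y) x = form F x - form G x.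
Proof. by rewrite /KPform /bracket2 leibnizBr; ring. Qed.

Lemma KPform_translate F x : form (fun m y => F m (y + P)) x = form F (x + P).
Proof.
by rewrite /KPform /bracket2 /leibniz; under eq_bigr do rewrite -QP.
Qed.

(** The coefficients of the commutator of the operator with the multiplication by a
    function, when the commutator is applied to [f] and read as a differential
    operator in that function. *)
Definition commutator_coef f (j : nat) (x : R) : R :=
  match j with
  | 1%N => L * f 0%N x - 6 * k ^+ 4 * f 5%N x - 4 * k ^+ 2 * f 3%N x + 2 * c * f 1%N x
         - 2 * (Q 0%N x * f 1%N x) - 2 * (Q 1%N x * f 0%N x)
  | 2%N => c * f 0%N x - 15 * k ^+ 4 * f 4%N x - 6 * k ^+ 2 * f 2%N x - Q 0%N x * f 0%N x
  | 3%N => - (20 * k ^+ 4) * f 3%N x - 4 * k ^+ 2 * f 1%N x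
  | 4%N => - (15 * k ^+ 4) * f 2%N x - k ^+ 2 * f 0%N x
  | 5%N => - (6 * k ^+ 4) * f 1%N x
  | 6%N => - k ^+ 4 * f 0%N x
  | _ => 0
  end.

Definition commutator A f (x : R) : R := \sum_(j < 6) A j.+1 x * commutator_coef f j.+1 x.

Lemma KPform_leibniz A f x :
  form (leibniz A f) x = A 0%N x * form f x + commutator A f x.
Proof.
rewrite /KPform /bracket2 /commutator /leibniz !big_ord_recr !big_ord0 /=.
have binE : ('C(2, 1) = 2%N) * ('C(4, 1) = 4%N) * ('C(4, 2) = 6%N) * ('C(4, 3) = 4%N) *
  ('C(6, 1) = 6%N) * ('C(6, 2) = 15%N) * ('C(6, 3) = 20%N) * ('C(6, 4) = 15%N) *
  ('C(6, 5) = 6%N) by [].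
have subE : (2 - 1 = 1)%N * (4 - 1 = 3)%N * (4 - 2 = 2)%N * (4 - 3 = 1)%N *
  (6 - 1 = 5)%N * (6 - 2 = 4)%N * (6 - 3 = 3)%N * (6 - 4 = 2)%N * (6 - 5 = 1)%N by [].
rewrite !bin0 !binn !binE !subE !subn0 !subnn.
ring.
Qed.

Lemma commutatorB A1 A2 f x :
  commutator (fun n y => A1 n y - A2 n y) f x = commutator A1 f x - commutator A2 f x.
Proof. by rewrite /commutator -sumrB; apply: eq_bigr => i _; rewrite mulrBl. Qed.

Lemma chain0 : chain (fun _ => cst 0 : R -> R).
Proof.
split=> // [i _|i _]; first exact: wder_cst0.
by split; [exact: L2r_cst0|apply: locint_continuous => x; exact: cvg_cst].
Qed.

Lemma KPform0 x : form (fun _ => cst 0) x = 0.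
Proof.
rewrite /KPform /bracket2 /leibniz big1 => [|i _]; last by rewrite /= !mulr0.
by rewrite /=; ring.
Qed.

(** Chains of square-integrable functions give elements of the domain, and
    [shift_op_elim] is the converse. *)
Lemma shift_op_intro F1 F2 (g1 g2 : R -> R) : chain F1 -> chain F2 ->
  L2r [set: R] g1 -> L2r [set: R] g2 ->
  ae_eq mu [set: R] g1 (fun x => form F1 x - nu * F1 0%N x) ->
  ae_eq mu [set: R] g2 (fun x => form F2 x - nu * F2 0%N x) ->
  S (cplx (F1 0%N) (F2 0%N)) (cplx g1 g2).
Proof.
move=> s1 s2 l1 l2 e1 e2.
have lF1 : L2r [set: R] (F1 0%N) by have [_ _ /(_ 0%N isT)[]] := s1.
have lF2 : L2r [set: R] (F2 0%N) by have [_ _ /(_ 0%N isT)[]] := s2.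
exists (cplx (fun x => g1 x + nu * F1 0%N x) (fun x => g2 x + nu * F2 0%N x)).
  apply: (KPop_cplx dQ (P := L2r [set: R]) (F1 := F1) (F2 := F2)) => //.
  - exact: Hline_cplx s1 s2.
  - by apply/L2on_parts => //; split; apply: L2rD => //; exact: L2rZ.
  - by apply: ae_weaken e1 => x /(_ I) e _; rewrite /re/= e subrK.
  - by apply: ae_weaken e2 => x /(_ I) e _; rewrite /im/= e subrK.
apply/funext => x; apply: eq_ReIm.
  by rewrite raddfB/= mul0r subr0 addrK.
by rewrite raddfB/= mul0r addr0 addrK.
Qed.

Lemma shift_op_elim (u v : R -> R[i]) : S u v -> exists F1 F2,
  [/\ chain F1 /\ F1 0%N = re u, chain F2 /\ F2 0%N = im u,
      ae_eq mu [set: R] (re v) (fun x => form F1 x - nu * F1 0%N x) &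
      ae_eq mu [set: R] (im v) (fun x => form F2 x - nu * F2 0%N x)].
Proof.
move=> [h Th vE]; have [du _ _] := Th.
have [F1 [F2 [s1 s2]]] := Hline_parts du.
have [e1 e2] := KPop_parts dQ s1 s2 Th.
have [z1 c1 l1] := s1; have [z2 c2 l2] := s2.
exists F1, F2; split; [by split; first by split|by split; first by split| |].
- apply: ae_weaken e1 => x /(_ I) e _.
  by rewrite /re vE raddfB/= ReM_real -/(re h x) e z1.
- apply: ae_weaken e2 => x /(_ I) e _.
  by rewrite /im vE raddfB/= ImM_real -/(im h x) e z2.
Qed.

Lemma chain_translate F : chain F -> chain (fun n x => F n (x + P)).
Proof.
move=> [_ cF lF]; split=> // [|i i6].
  have := weak_chain_affine P ltr01 cF.
  rewrite (_ : (fun i x => _) = (fun n x => F n (x + P)))//.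
  by apply/funext => n; apply/funext => x; rewrite expr1n !mul1r.
have [l li] := lF i i6; split; first exact: L2r_translate.
have := locint_affine P ltr01 li.
by rewrite (_ : (fun x => _) = (fun x => F i (x + P)))//; apply/funext => x; rewrite mul1r.
Qed.

Lemma chainB F G : chain F -> chain G -> chain (fun n x => F n x - G n x).
Proof.
move=> [_ cF lF] [_ cG lG]; split=> // [|i i6]; first exact: weak_chainB.
have [l1 i1] := lF i i6; have [l2 i2] := lG i i6.
by split; [exact: L2rB|exact: locally_integrableB].
Qed.

(** The kernel is invariant under the translation by the period, because the
    coefficients are periodic. *)
Lemma kernel_null (d : nat) : dim_mod (ker_pow [set: R] S 1) (null_on [set: R]) d ->
  forall F, chain F -> {ae mu, forall x, form F x = nu * F 0%N x} ->
  ae_eq mu [set: R] (F 0%N) (cst 0).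
Proof.
move=> dimd F cF eF.
have nul := @translation_invariant_null _ P _ d P0 _ _ dimd.
have kF : ker_pow [set: R] S 1 (cplx (F 0%N) (cst 0)).
  exists (cplx (cst 0) (cst 0)); last by apply: aeW => x _; apply: eq_ReIm.
  apply: (@shift_op_intro F (fun _ => cst 0)) => //; try exact: L2r_cst0.
  - exact: chain0.
  - by apply: ae_weaken eF => x e _; rewrite e subrr.
  - by apply: aeW => x _; rewrite KPform0 /= mulr0 subr0.
have [||] := (null_on_parts _ _).1 (nul _ _ _ kF) => //.
- move=> u [v /shift_op_elim[F1 [F2 [[s1 e1] [s2 e2] _ _]]] _].
  apply/L2on_parts => //; rewrite -e1 -e2.
  by have [_ _ /(_ 0%N isT)[]] := s1; have [_ _ /(_ 0%N isT)[]] := s2.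
- move=> u [v /shift_op_elim[F1 [F2 [[s1 e1] [s2 e2] v1 v2]]] v0].
  have [r0 i0] := (null_on_parts _ _).1 v0.
  exists (cplx (cst 0) (cst 0)); last by apply: aeW => x _; apply: eq_ReIm.
  have -> : (fun x => u (x + P)) = cplx (fun x => F1 0%N (x + P)) (fun x => F2 0%N (x + P)).
    by apply/funext => x; apply: eq_ReIm; rewrite /= ?e1 ?e2.
  apply: (@shift_op_intro (fun n x => F1 n (x + P)) (fun n x => F2 n (x + P))).
  - exact: chain_translate.
  - exact: chain_translate.
  - exact: L2r_cst0.
  - exact: L2r_cst0.
  - have := ae_translate P (ae_weaken2 (fun x a b => conj a b) v1 r0).
    apply: ae_weaken => x [h1 h2] _; rewrite KPform_translate.
    by rewrite -h1// h2.
  - have := ae_translate P (ae_weaken2 (fun x a b => conj a b) v2 i0).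
    apply: ae_weaken => x [h1 h2] _; rewrite KPform_translate.
    by rewrite -h1// h2.
Qed.

(** ** The eigenfunction *)
Variable f : nat -> R -> R.
Hypotheses (fc : sobolev_chain L2locr f (f 0%N))
  (fP : ae_eq mu [set: R] (fun x => f 0%N (x + P)) (f 0%N))
  (fnu : {ae mu, forall x, form f x = nu * f 0%N x}).

Lemma eigenfunction_periodic i : (i <= 6)%N ->
  ae_eq mu [set: R] (fun x => f i (x + P)) (f i).
Proof.
move=> i6; have [_ cf lf] := fc.
have w : wder i (f 0%N) (f i) by apply: (weak_chain_wder cf) => //; case: (lf 0%N isT).
have tE (u : R -> R) : (fun x => u (1 * x + P)) = (fun x => u (x + P)).
  by apply/funext => x; rewrite mul1r.
have w' : wder i (fun x => f 0%N (x + P)) (fun x => f i (x + P)).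
  have := wder_affine P ltr01 w; rewrite (_ : (fun x => 1 ^+ i * _) = (fun x => f i (x + P))).
    by rewrite tE.
  by apply/funext => x; rewrite expr1n !mul1r.
apply: wder_unique w; have [_ lfi _] := w'.
apply: (wder_ae _ _ fP (ae_eq_refl _ _ _) w') => //.
- by apply: locint_measurable; case: (lf 0%N isT).
- exact: locint_measurable.
Qed.

Definition weighted (g : R -> R) : Prop :=
  measurable_fun [set: R] g /\ L2r [set: R] (fun x => decay x * g x).

Lemma weighted_f i : (i <= 6)%N -> weighted (f i).
Proof.
move=> i6; have [_ _ lf] := fc; have [l li] := lf i i6.
split; first exact: locint_measurable.
exact: periodic_weighted P0 l (eigenfunction_periodic i6).
Qed.

Lemma weightedZ (a : R) g : weighted g -> weighted (fun x => a * g x).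
Proof.
move=> [mg lg]; split; first exact: measurable_funM.
have -> : (fun x => decay x * (a * g x)) = (fun x => a * (decay x * g x)).
  by apply/funext => x; rewrite mulrCA.
exact: L2rZ.
Qed.

Lemma weightedD g h : weighted g -> weighted h -> weighted (fun x => g x + h x).
Proof.
move=> [mg lg] [mh lh]; split; first exact: measurable_funD.
by under eq_fun do rewrite mulrDr; exact: L2rD.
Qed.

Lemma weightedB g h : weighted g -> weighted h -> weighted (fun x => g x - h x).
Proof.
move=> [mg lg] [mh lh]; split; first exact: measurable_funB.
by under eq_fun do rewrite mulrBr; exact: L2rB.
Qed.

Lemma periodic_bounded (u : R -> R) : continuous u -> (forall x, u (x + P) = u x) ->
  exists B : R, forall x, `|u x| <= B.
Proof.
move=> cu uP; have [B B0 hB] := itv_bounded 0 P cu; exists B => x.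
have uPn (n : nat) y : u (y + n%:R * P) = u y.
  elim: n => [|n IH]; first by rewrite mul0r addr0.
  by rewrite -natr1 mulrDl mul1r addrA uP.
have [n [/andP[f1 f2]|/andP[f1 f2]]] := periodic_cell x P0.
  by rewrite -[x](subrK (n%:R * P)) uPn; apply: hB; rewrite subr_ge0 f1/= lerBlDl ltW.
rewrite -(uPn n.+1); apply: hB; move: f1 f2; move: (n.+1%:R * P) => h f1 f2.
by apply/andP; split; lra.
Qed.

Lemma weightedQ n g : weighted g -> weighted (fun x => Q n x * g x).
Proof.
move=> [mg lg]; have cQ : continuous (Q n) by exact: derivs_continuous.
have mQ := continuous_measurable_fun cQ.
have [B hB] := periodic_bounded cQ (QP n).
split; first exact: measurable_funM.
have -> : (fun x => decay x * (Q n x * g x)) = (fun x => Q n x * (decay x * g x)).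
  by apply/funext => x; rewrite mulrCA.
by apply: (L2r_bounded (B := B)) => // x _.
Qed.

Lemma weighted_commutator j : weighted (commutator_coef f j).
Proof.
have Z a i : (i <= 6)%N -> weighted (fun x => a * f i x).
  by move=> i6; apply: weightedZ; exact: weighted_f.
have W0 : weighted (cst 0).
  split; first exact: measurable_cst.
  by under eq_fun do rewrite mulr0; exact: L2r_cst0.
case: j => [|[|[|[|[|[|[|j]]]]]]] //=.
- apply: weightedB; last by apply/weightedZ/weightedQ/weighted_f.
  apply: weightedB; last by apply/weightedZ/weightedQ/weighted_f.
  apply: weightedD; last exact: Z.
  by apply: weightedB; [apply: weightedB|]; exact: Z.
- apply: weightedB; last by apply/weightedQ/weighted_f.
  by apply: weightedB; [apply: weightedB|]; exact: Z.
- by apply: weightedB; exact: Z.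
- by apply: weightedB; exact: Z.
- exact: Z.
- exact: Z.
Qed.

Lemma commutator_periodic :
  {ae mu, forall x, forall j, commutator_coef f j (x + P) = commutator_coef f j x}.
Proof.
have H : {ae mu, forall x, forall i : nat, (i <= 6)%N -> f i (x + P) = f i x}.
  apply: ae_foralln => i; have [i6|i6] := pselect (i <= 6)%N.
    by apply: ae_weaken (eigenfunction_periodic i6) => x h _; exact: h.
  by apply: aeW => x /i6.
apply: ae_weaken H => x h [|[|[|[|[|[|[|j]]]]]]] //=; rewrite ?QP !h//.
Qed.

Lemma decaying_L2r (a g : R -> R) (C : R) : measurable_fun [set: R] a ->
  (forall x, `|a x| <= C * decay x) -> weighted g -> L2r [set: R] (fun x => a x * g x).
Proof.
move=> ma aC [mg lg]; have [_ i2] := L2rZ C measurableT lg.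
apply: (L2r_dom measurableT _ i2); first exact: measurable_funM.
apply: aeW => x _; rewrite -real_normK ?num_real// -[leRHS]real_normK ?num_real//.
rewrite lerXn2r ?nnegrE// mulrA !normrM ler_wpM2r//.
apply: le_trans (aC x) _; rewrite -(ger0_norm (ltW (decay_gt0 x))) normr_id.
by rewrite ler_wpM2r// ler_norm.
Qed.

Lemma chain_leibniz A : derivs A -> decaying A -> chain (leibniz A f).
Proof.
move=> dA hA; have [_ cf lf] := fc; split=> // [|i i6]; first exact: weak_chain_leibniz.
have cA n : continuous (A n) by exact: derivs_continuous.
split.
  apply: (@L2r_sum _ _ i.+1 (fun j x => 'C(i, j)%:R * (A (i - j)%N x * f j x))) => // j ji.
  apply: L2rZ => //; have [C hC] := hA (i - j)%N.
  apply: (decaying_L2r _ hC); first exact: continuous_measurable_fun.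
  by apply: weighted_f; lia.
apply: (@locint_sum _ i.+1 (fun j x => 'C(i, j)%:R * (A (i - j)%N x * f j x))) => j ji.
by apply: locintZ; apply: locint_mul => //; case: (lf j _) => //; lia.
Qed.

Lemma L2r_commutator A : (forall n, continuous (A n)) ->
  (forall n, exists C : R, forall x, `|A n.+1 x| <= C * decay x) ->
  L2r [set: R] (commutator A f).
Proof.
move=> cA hA.
apply: (@L2r_sum _ _ 6 (fun j x => A j.+1 x * commutator_coef f j.+1 x)) => // j _.
have [C hC] := hA j; apply: (decaying_L2r _ hC); first exact: continuous_measurable_fun.
exact: weighted_commutator.
Qed.

Lemma range_leibniz A : derivs A -> decaying A ->
  range_op S (cplx (commutator A f) (cst 0)).
Proof.
move=> dA hA; exists (cplx (leibniz A f 0%N) (cst 0)).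
apply: (@shift_op_intro (leibniz A f) (fun _ => cst 0)); first exact: chain_leibniz.
- exact: chain0.
- by apply: L2r_commutator => [n|n]; [exact: derivs_continuous|exact: hA].
- exact: L2r_cst0.
- apply: ae_weaken fnu => x fx _; rewrite KPform_leibniz fx leibniz0; ring.
- by apply: aeW => x _; rewrite KPform0 /= mulr0 subr0.
Qed.

Definition dilation (e : R) (n : nat) (x : R) : R := e ^+ n * logistic_n n (e * x).

(** The commutator involves only derivatives of the dilated logistic function, which
    tend to zero pointwise and remain bounded by the weight: dominated convergence
    applies. *)
Lemma commutator_dilation_cvg :
  (fun n => \int[mu]_x (commutator (dilation n.+1%:R^-1) f x ^+ 2)) @ \oo --> (0 : R).
Proof.
have exK n : exists K : R, 0 <= K /\ forall x, `|logistic_n n.+1 x| <= K * decay x.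
  by have [K K0 hK] := logistic_nS_decay (R := R) n; exists K.
have [K hK] := choice exK.
have K0 n : 0 <= K n by case: (hK n).
have e01 n : 0 < (n.+1%:R^-1 : R) <= 1 by rewrite invr_gt0 ltr0n/= invf_le1 ?ler1n ?ltr0n.
pose G x := \sum_(j < 6) K j * (decay x * `|commutator_coef f j.+1 x|).
have LG : L2r [set: R] G.
  apply: (@L2r_sum _ _ 6 (fun j x => K j * (decay x * `|commutator_coef f j.+1 x|))) => // j _.
  apply: L2rZ => //; have [mc [_ ic]] := weighted_commutator j.+1.
  apply: (L2r_dom measurableT _ ic).
    by apply: measurable_funM; [exact: measurable_decay|exact: measurableT_comp].
  by apply: aeW => x _; rewrite !exprMn real_normK ?num_real.
have sc n j x : `|dilation n.+1%:R^-1 j.+1 x| <= K j * decay x /\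
    `|dilation n.+1%:R^-1 j.+1 x| <= K j * n.+1%:R^-1.
  by have [_ hj] := hK j; exact: logistic_n_scaled.
have bd n x : `|commutator (dilation n.+1%:R^-1) f x| <= G x.
  rewrite (le_trans (ler_norm_sum _ _ _))// ler_sum// => j _.
  by rewrite normrM mulrA ler_wpM2r//; have [] := sc n j x.
have cv x : (fun n => commutator (dilation n.+1%:R^-1) f x) @ \oo --> (0 : R).
  apply/norm_cvg0P.
  pose H := \sum_(j < 6) K j * `|commutator_coef f j.+1 x|.
  apply: (@squeeze_cvgr _ _ _ _ (cst 0) (fun n : nat => H * n.+1%:R^-1)).
  - apply: nearW => n; rewrite normr_ge0/= /H mulr_suml.
    rewrite (le_trans (ler_norm_sum _ _ _))// ler_sum// => j _.
    by rewrite normrM mulrAC ler_wpM2r//; have [] := sc n j x.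
  - exact: cvg_cst.
  - by rewrite -(mulr0 H); apply: cvgM; [exact: cvg_cst|exact: cvg_harmonic].
have mcomm n : measurable_fun [set: R] (commutator (dilation n.+1%:R^-1) f).
  have dd : derivs (dilation (n.+1%:R^-1 : R)) by exact: dilation_derivs.
  have [] // : L2r [set: R] (commutator (dilation (n.+1%:R^-1 : R)) f).
  apply: L2r_commutator => [m|m]; first exact: derivs_continuous.
  by exists (K m) => x; have [] := sc n m x.
pose f_ n x := (commutator (dilation n.+1%:R^-1) f x ^+ 2)%:E.
have mf_ n : measurable_fun [set: R] (f_ n).
  by apply/measurable_EFinP; exact: measurable_funX.
have mf : measurable_fun [set: R] (cst 0 : R -> \bar R)%E by exact: measurable_cst.
have cvf : {ae mu, forall x, [set: R] x -> f_ n x @[n --> \oo] --> (cst 0 x : \bar R)}.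
  apply: aeW => x _; apply: cvg_EFin; first exact: nearW.
  have c2 : (fun n => commutator (dilation n.+1%:R^-1) f x ^+ 2) @ \oo --> (0 : R).
    rewrite -(mulr0 (0 : R)); exact: cvgM (cv x) (cv x).
  exact: c2.
have ig : mu.-integrable [set: R] (fun x => (G x ^+ 2)%:E) by case: LG.
have dom : {ae mu, forall x n, [set: R] x -> (`|f_ n x| <= (G x ^+ 2)%:E)%E}.
  apply: aeW => x n _; rewrite lee_fin ger0_norm ?sqr_ge0// -real_normK ?num_real//.
  by rewrite lerXn2r ?nnegrE// (le_trans _ (bd n x)).
have [_ _] := @dominated_convergence _ _ _ mu _ measurableT _ _ _ mf_ mf cvf ig dom.
by rewrite integral0; exact: fine_cvg.
Qed.

Lemma L2dist_real (g h : R -> R) :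
  L2dist [set: R] (cplx g (cst 0)) (cplx h (cst 0)) =
  Num.sqrt (\int[mu]_x ((g x - h x) ^+ 2)).
Proof.
rewrite /L2dist; congr Num.sqrt; apply: eq_Rintegral => x _ /=.
by rewrite subrr expr0n addr0 sqrtr_sqr real_normK ?num_real.
Qed.

(** With [s] the logistic function, the commutator applied to [s] is the limit of the
    commutators applied to the cutoffs, which lie in the range since [cutoff * f] is
    in the domain. A closed range would contain it, say as the image of [u]; then [w =
    s f - u] is a formal eigenfunction whose translation difference is in the domain,
    hence in the kernel, hence null. So [w] is periodic, but along almost every
    progression it tends to [f] on the right and to [0] on the left. *)
Theorem periodic_eigenfunction_not_fredholm : ~ ae_eq mu [set: R] (f 0%N) (cst 0) ->
  ~ fredholm_of_index [set: R] S 0.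
Proof.
move=> fn0 [d [d' [crange dimk _ _]]]; apply: fn0.
have e01 n : 0 < (n.+1%:R^-1 : R) <= 1 by rewrite invr_gt0 ltr0n/= invf_le1 ?ler1n ?ltr0n.
have Lg : L2r [set: R] (commutator logistic_n f).
  apply: L2r_commutator => [n|n]; first by apply: derivs_continuous; exact: logistic_derivs.
  by have [K _ hK] := logistic_nS_decay (R := R) n; exists K.
have [u Su] : range_op S (cplx (commutator logistic_n f) (cst 0)).
  apply: (crange (fun n => cplx (commutator (cutoff n.+1%:R^-1) f) (cst 0))) => [n||].
  - by apply: range_leibniz; [exact: cutoff_derivs|exact: cutoff_decaying].
  - by apply/L2on_parts => //; split => //; exact: L2r_cst0.
  - rewrite (_ : (fun n => _) = (fun n => Num.sqrt
      (\int[mu]_x (commutator (dilation n.+1%:R^-1) f x ^+ 2)))); last first.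
      apply/funext => n; rewrite L2dist_real; congr Num.sqrt.
      apply: eq_Rintegral => x _; rewrite (commutatorB logistic_n (dilation n.+1%:R^-1)).
      by rewrite addrAC subrr add0r sqrrN.
    rewrite -sqrtr0; exact: continuous_cvg _ (@sqrt_continuous R 0) commutator_dilation_cvg.
have [U [_ [[cU _] _ eU _]]] := shift_op_elim Su.
(* The derivatives of [w (x + P) - w x], for the function [w] defined below. *)
pose V n x := leibniz (logistic_shift P) f n x - (U n (x + P) - U n x).
have cV : chain V.
  apply: chainB; last by apply: chainB => //; exact: chain_translate.
  by apply: chain_leibniz; [exact: logistic_shift_derivs|exact: logistic_shift_decaying].
have eV : {ae mu, forall x, form V x = nu * V 0%N x}.
  have a1 := ae_weaken2 (fun x a b => conj a b) fnu commutator_periodic.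
  have a2 := ae_weaken2 (fun x a b => conj a b) eU (ae_translate P eU).
  apply: ae_weaken2 a1 a2 => x [fx cx] [/(_ I) u1 /(_ I) u2].
  rewrite /V KPformB (KPformB (fun n y => U n (y + P))) KPform_translate.
  rewrite KPform_leibniz fx leibniz0.
  have -> : form U (x + P) = nu * U 0%N (x + P) + commutator logistic_n f (x + P).
    have -> : commutator logistic_n f (x + P) = form U (x + P) - nu * U 0%N (x + P) := u2.
    ring.
  have -> : form U x = nu * U 0%N x + commutator logistic_n f x.
    have -> : commutator logistic_n f x = form U x - nu * U 0%N x := u1.
    ring.
  have -> : commutator (logistic_shift P) f x =
      commutator logistic_n f (x + P) - commutator logistic_n f x.
    rewrite /commutator -sumrB; apply: eq_bigr => j _.
    by rewrite /logistic_shift cx mulrBl.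
  ring.
have V0 := kernel_null dimk cV eV.
pose w x := logistic x * f 0%N x - U 0%N x.
have wP : ae_eq mu [set: R] (fun x => w (x + P)) w.
  apply: ae_weaken2 V0 fP => x /(_ I) v0 /(_ I) f0 _.
  move: v0; rewrite /V leibniz0 /logistic_shift !logistic_n0 /w f0 /= => v0.
  by apply/eqP; rewrite -subr_eq0 -[X in _ == X]v0; apply/eqP; ring.
have LU : L2r [set: R] (U 0%N) by have [_ _ /(_ 0%N isT)[]] := cU.
have a1 := ae_weaken2 (fun x a b => conj a b) (ae_periodic_iter wP) (ae_periodic_iter fP).
apply: ae_weaken2 a1 (L2r_tails P0 LU) => x [wx fx] [U1 U2] _.
have [s1 s2] := logistic_cvg x P0.
have w1 : w x = 1 * f 0%N x - 0.
  have cv : (fun n : nat => logistic (x + n%:R * P) * f 0%N x - U 0%N (x + n%:R * P))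
      @ \oo --> 1 * f 0%N x - 0.
    by apply: cvgB => //; apply: cvgM => //; exact: cvg_cst.
  have E : (fun n : nat => logistic (x + n%:R * P) * f 0%N x - U 0%N (x + n%:R * P)) =
      cst (w x).
    by apply/funext => n; rewrite /= -(wx n).1 /w (fx n).1.
  by rewrite E in cv; rewrite -(cvg_lim _ cv)// lim_cst.
have w2 : w x = 0 * f 0%N x - 0.
  have cv : (fun n : nat => logistic (x - n%:R * P) * f 0%N x - U 0%N (x - n%:R * P))
      @ \oo --> 0 * f 0%N x - 0.
    by apply: cvgB => //; apply: cvgM => //; exact: cvg_cst.
  have E : (fun n : nat => logistic (x - n%:R * P) * f 0%N x - U 0%N (x - n%:R * P)) =
      cst (w x).
    by apply/funext => n; rewrite /= -(wx n).2 /w (fx n).2.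
  by rewrite E in cv; rewrite -(cvg_lim _ cv)// lim_cst.
by move: w1; rewrite w2 mul0r mul1r !subr0 => <-.
Qed.

End EssentialSpectrum.

(** * Eigenfunctions of the periodic problem *)
Section PeriodicProblem.
Context {R : realType}.
Local Notation mu := (@lebesgue_measure R).

(** The last iterate that is not null is an eigenvector. *)
Lemma ker_pow_eigenfunction (D : set R) (S : operator R) (n : nat) (u : R -> R[i]) :
  ker_pow D S n u -> ~ null_on D u -> exists2 v, ker_pow D S 1 v & ~ null_on D v.
Proof.
elim: n u => [//|n IH] u [g Sug kg] un0.
by have [g0|g0] := pselect (null_on D g); [exists u => //; exists g|exact: IH kg g0].
Qed.

Lemma simple_eigenvalue_eigenfunction (D : set R) (T : operator R) (nu : R[i]) :
  simple_eigenvalue D T nu ->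
  exists2 u, ker_pow D (shift_op T nu) 1 u & ~ null_on D u.
Proof.
move=> [e [Ee _ ind]]; have [n _ ke] := Ee ord0.
apply: ker_pow_eigenfunction ke _ => e0.
suff /eqP : (1 : R[i]) = 0 by rewrite oner_eq0.
by apply: (ind (fun=> 1) _ ord0); rewrite big_ord1 scale1r.
Qed.

Lemma ae_neq (a : R) : {ae mu, forall x, x != a}.
Proof.
exists [set a]; split; first exact: measurable_set1.
  exact: lebesgue_measure_set1.
by move=> x /= /negP; rewrite negbK => /eqP.
Qed.

Lemma ae_periodic_extend (P : R) (G : R -> R) : 0 < P ->
  ae_eq mu [set: R] (fun x => G (x + P)) G -> ae_eq mu `]0, P[%classic G (cst 0) ->
  ae_eq mu [set: R] G (cst 0).
Proof.
move=> P0 GP G0.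
have G0' : {ae mu, forall x, 0 <= x < P -> G x = 0}.
  apply: ae_weaken2 G0 (ae_neq 0) => x Gx x0 /andP[x1 x2]; apply: Gx.
  by rewrite /= in_itv/= x2 andbT lt_neqAle eq_sym x0.
have all := ae_weaken2 (fun x a b => conj a b)
  (ae_foralln (fun n : nat => ae_translate (n%:R * P) G0'))
  (ae_foralln (fun n : nat => ae_translate (- (n%:R * P)) G0')).
apply: ae_weaken2 all (ae_periodic_iter GP) => x [px nx] Gx _ /=.
have [n [/andP[f1 f2]|/andP[f1 f2]]] := periodic_cell x P0.
  by rewrite -(Gx n).2 nx// subr_ge0 f1/= ltrBlDl.
rewrite -(Gx n.+1).1 px//; apply/andP; split; first by rewrite addrC -lerBlDl sub0r.
by rewrite -ltrBrDr addrC.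
Qed.

(** The real or the imaginary part is a nonzero real eigenfunction, and the eigenvalue
    equation extends from one cell to the line by periodicity. *)
Lemma periodic_eigenchain (P k c L nu : R) (Q : nat -> R -> R) (u : R -> R[i]) :
  0 < P -> derivs Q -> (forall n x, Q n (x + P) = Q n x) ->
  Hloc 6 u -> (forall x, u (x + P) = u x) -> ~ null_on `]0, P[ u ->
  (exists2 h, KPop `]0, P[ (fun v => Hloc 6 v) L%:C%C k c (Q 0%N) u h &
     null_on `]0, P[ (fun x => h x - nu%:C%C * u x)) ->
  exists f, [/\ sobolev_chain L2locr f (f 0%N), forall x, f 0%N (x + P) = f 0%N x,
    {ae mu, forall x, KPform k c L Q f x = nu * f 0%N x} &
    ~ ae_eq mu [set: R] (f 0%N) (cst 0)].
Proof.
move=> P0 dQ QP Hu uP un0 [h Th hn].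
have [F1 [F2 [s1 s2]]] := Hloc_parts Hu.
have [e1 e2] := KPop_parts dQ s1 s2 Th.
have [r0 i0] := (null_on_parts _ _).1 hn.
have ext F : sobolev_chain L2locr F (F 0%N) -> (forall x, F 0%N (x + P) = F 0%N x) ->
    ae_eq mu `]0, P[%classic (fun x => KPform k c L Q F x - nu * F 0%N x) (cst 0) ->
    {ae mu, forall x, KPform k c L Q F x = nu * F 0%N x}.
  move=> sF FP F0.
  suff : ae_eq mu [set: R] (fun x => KPform k c L Q F x - nu * F 0%N x) (cst 0).
    by apply: ae_weaken => x /(_ I)/eqP; rewrite subr_eq0 => /eqP.
  apply: ae_periodic_extend F0 => //.
  have FPae : ae_eq mu [set: R] (fun x => F 0%N (x + P)) (F 0%N).
    by apply: aeW => x _; exact: FP.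
  have H : {ae mu, forall x, forall i : nat, (i <= 6)%N -> F i (x + P) = F i x}.
    apply: ae_foralln => i; have [i6|i6] := pselect (i <= 6)%N.
      have h' := eigenfunction_periodic sF FPae i6.
      by apply: ae_weaken h' => x h' _; exact: h'.
    by apply: aeW => x /i6.
  apply: ae_weaken H => x H _; rewrite -KPform_translate//.
  rewrite FP; congr (_ - _); rewrite /KPform /bracket2 !H//.
  rewrite /leibniz; congr (_ - (_ + _)); apply: eq_bigr => i _.
  by rewrite H//; have := ltn_ord i; lia.
have [z1 c1 l1] := s1; have [z2 c2 l2] := s2.
have s1' : sobolev_chain L2locr F1 (F1 0%N) by split.
have s2' : sobolev_chain L2locr F2 (F2 0%N) by split.
have P1 x : F1 0%N (x + P) = F1 0%N x by rewrite z1 /re uP.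
have P2 x : F2 0%N (x + P) = F2 0%N x by rewrite z2 /im uP.
have E1 : {ae mu, forall x, KPform k c L Q F1 x = nu * F1 0%N x}.
  apply: ext => //; apply: ae_weaken2 e1 r0 => x e1 r0 xP.
  rewrite -e1//; move: (r0 xP); rewrite /re raddfB/= ReM_real -/(re u x) -z1 => ->.
  by [].
have E2 : {ae mu, forall x, KPform k c L Q F2 x = nu * F2 0%N x}.
  apply: ext => //; apply: ae_weaken2 e2 i0 => x e2 i0 xP.
  rewrite -e2//; move: (i0 xP); rewrite /im raddfB/= ImM_real -/(im u x) -z2 => ->.
  by [].
have [f1|f1] := pselect (ae_eq mu [set: R] (F1 0%N) (cst 0)); last by exists F1.
have [f2|f2] := pselect (ae_eq mu [set: R] (F2 0%N) (cst 0)); last by exists F2.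
exfalso; apply: un0; apply/null_on_parts; rewrite -z1 -z2.
by split; [apply: ae_weaken f1 => x h1 _|apply: ae_weaken f2 => x h2 _]; [exact: h1|exact: h2].
Qed.

(** Only [k ^ 2] enters the operator, so the dilation factor may be the absolute value
    of [k]. *)
Lemma KPform_dilation (ka k c L : R) (Q f : nat -> R -> R) x : ka ^+ 2 = k ^+ 2 ->
  KPform 1 c (ka * L) (fun n y => ka ^+ n * Q n (ka * y))
    (fun n y => ka ^+ n * f n (ka * y)) x = ka ^+ 2 * KPform k c L Q f (ka * x).
Proof.
move=> kk; rewrite /KPform /bracket2 /leibniz !big_ord_recr !big_ord0 /=.
have k4 : k ^+ 4 = ka ^+ 2 * ka ^+ 2 by rewrite kk; ring.
by rewrite k4 -kk !subn0 !subnn (_ : (2 - 1 = 1)%N)//; ring.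
Qed.

Lemma sobolev_chain_dilation (ka : R) (f : nat -> R -> R) : 0 < ka ->
  sobolev_chain L2locr f (f 0%N) ->
  sobolev_chain L2locr (fun n x => ka ^+ n * f n (ka * x)) (fun x => ka ^+ 0 * f 0%N (ka * x)).
Proof.
move=> ka0 [_ cf lf]; have E u : (fun x => u (ka * x)) = (fun x => u (ka * x + 0)) :> (R -> R).
  by apply/funext => x; rewrite addr0.
split=> // [|i i6].
  have := weak_chain_affine 0 ka0 cf.
  rewrite (_ : (fun i x => _) = (fun n x => ka ^+ n * f n (ka * x)))//.
  by apply/funext => n; apply/funext => x; rewrite addr0.
have [l li] := lf i i6; split.
  by apply: L2locrZ; rewrite E; exact: L2locr_affine.
by apply: locintZ; rewrite E; exact: locint_affine.
Qed.

(** ** Smoothness of the wave *)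

(** The wave equation expresses the fourth derivative by lower ones, and can be
    differentiated again and again. *)
Lemma wave_smooth (c : R) (u : R -> R) : solves_wave_eq c u -> smooth u.
Proof.
move=> [du eu]; pose A n := derive1n n u.
pose rhs n x := - A n.+2 x + c * A n x - 2^-1 * leibniz A A n x.
have dA n x : derivable (A n) x 1 -> is_derive x (1 : R) (A n) (A n.+1 x).
  by move=> d; rewrite /A derive1nS derive1E; exact/derivableP.
suff H n : (forall m x, (m <= n + 3)%N -> derivable (A m) x 1) /\ A (n + 4)%N = rhs n.
  by move=> n x; apply: (H n).1; rewrite leq_addr.
elim: n => [|n [IHd IHe]].
  split=> [m x m3|]; first exact: du.
  apply/funext => x; rewrite /rhs leibniz0 /A add0n !derive1n0.
  have := eu x; rewrite expr2; set w := derive1n 4 u x; set w2 := derive1n 2 u x => e.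
  by apply/eqP; rewrite -subr_eq0 -[X in _ == X]e; apply/eqP; ring.
have drhs x : is_derive x (1 : R) (rhs n) (rhs n.+1 x).
  apply: is_deriveB.
    apply: is_deriveD; last by apply: is_deriveZ; apply: dA; apply: IHd; lia.
    by apply: is_deriveN; apply: dA; apply: IHd; lia.
  apply: is_deriveZ; apply: is_derive_leibniz => i ni; apply: dA; apply: IHd; lia.
split=> [m x|].
  rewrite leq_eqVlt => /orP[/eqP->|mn]; last by apply: IHd; lia.
  by rewrite (_ : (n.+1 + 3 = n + 4)%N) ?IHe; [case: (drhs x)|lia].
apply/funext => x; rewrite (_ : (n.+1 + 4 = (n + 4).+1)%N) ?addSn//.
rewrite {1}/A derive1nS derive1E -/(A _) IHe.
by have [_ ->] := drhs x.
Qed.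

Lemma smooth_dilation (ka : R) (u : R -> R) : smooth u -> smooth (fun x => u (ka * x)).
Proof.
move=> su; have := smooth_affine (al := ka) (be := 0) su.
by rewrite (_ : (fun x => u (ka * x + 0)) = (fun x => u (ka * x)))//; apply/funext => x; rewrite addr0.
Qed.

Lemma derivs_dilation (ka : R) (A : nat -> R -> R) : derivs A ->
  derivs (fun n x => ka ^+ n * A n (ka * x)).
Proof.
move=> dA; have := derivs_affine ka 0 dA.
rewrite (_ : (fun n x => _) = (fun n x => ka ^+ n * A n (ka * x)))//.
by apply/funext => n; apply/funext => x; rewrite addr0.
Qed.

Lemma derive1n_periodic (P : R) (q : R -> R) n x : smooth q -> (forall x, q (x + P) = q x) ->
  derive1n n q (x + P) = derive1n n q x.
Proof.
move=> sq qP; have := derive1n_affine n 1 P sq.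
rewrite (_ : (fun x => q (1 * x + P)) = q); last by apply/funext => y; rewrite mul1r qP.
by move=> /(congr1 (fun g => g x)) ->; rewrite expr1n !mul1r.
Qed.

End PeriodicProblem.

(** * Zeros of analytic functions of one real variable *)
Section AnalyticZeros.
Context {R : realType}.

(** At the center of the second variable only the terms with [m = 0] survive. *)
Lemma analytic2_slice (V : lmodType R) (S : set V) (N : V -> R) (a0 c0 : R)
    (F : R -> R -> V) : analytic2 S N a0 c0 F ->
  forall a1 c : R, `|a1| < a0 -> `|c| < c0 -> exists (r M : R) (q : nat -> V),
    [/\ 0 < r, forall n, S (q n) /\ N (q n) * r ^+ n <= M &
        forall a, `|a| < a0 -> `|a - a1| < r ->
          (fun n0 => N (F a c - \sum_(n < n0) (a - a1) ^+ n *: q n)) @ \oo --> (0 : R)].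
Proof.
move=> an a1 c a1a cc; have [r [M [q [r0 qM cv]]]] := an a1 c a1a cc.
exists r, M, (fun n => q n 0%N); split => // [n|a aa ar].
  by have := qM n 0%N; rewrite addn0.
have := cv a c aa cc ar; rewrite !subrr normr0 => /(_ r0).
rewrite (_ : (fun n0 => N (F a c - \sum_(n < n0) \sum_(m < n0) _)) =
             (fun n0 => N (F a c - \sum_(n < n0) (a - a1) ^+ n *: q n 0%N)))//.
apply/funext => -[|n0]; first by rewrite !big_ord0.
congr (N (_ - _)); apply: eq_bigr => n _.
rewrite big_ord_recl expr0 mulr1 big1 ?addr0// => m _.
by rewrite /= expr0n/= mulr0 scale0r.
Qed.

Lemma geometric_le2 (t : R) (n : nat) : 0 <= t <= 2^-1 -> \sum_(i < n) t ^+ i <= 2.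
Proof.
move=> /andP[t0 t2].
suff H : \sum_(i < n) t ^+ i <= 2 - 2 * 2^-1 ^+ n.
  by apply: le_trans H _; rewrite gerBl mulr_ge0// exprn_ge0.
elim: n => [|n IH]; first by rewrite big_ord0 expr0 mulr1 subrr.
have tn : t ^+ n <= 2^-1 ^+ n by apply: lerXn2r t2; rewrite nnegrE.
rewrite big_ord_recr/=; apply: le_trans (lerD IH tn) _.
rewrite exprS; have : 2^-1 ^+ n = 2 * (2^-1 * 2^-1 ^+ n) :> R.
  by rewrite mulrA divff ?mul1r// pnatr_eq0.
set u := (2^-1 ^+ n); set v := 2^-1 * u => ->; lra.
Qed.

(** Comparison with a geometric series of ratio at most [1 / 2]. *)
Lemma power_tail_le (q : nat -> R) (r M d : R) (N m : nat) : 0 < r ->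
  (forall n, q n * r ^+ n <= M) -> (forall n, 0 <= q n) -> `|d| <= r / 2 ->
  \sum_(N <= n < m) `|d| ^+ n * q n <= 2 * M * (`|d| / r) ^+ N.
Proof.
move=> r0 qM q0 dr.
have M0 : 0 <= M by apply: le_trans (qM 0%N); rewrite mulr_ge0.
have t01 : 0 <= `|d| / r <= 2^-1.
  by rewrite divr_ge0 ?(ltW r0)//= ler_pdivrMr// mulrC.
have term n : `|d| ^+ n * q n <= M * (`|d| / r) ^+ n.
  rewrite exprMn mulrCA ler_wpM2l ?exprn_ge0//.
  by rewrite exprVn ler_pdivlMr ?exprn_gt0.
apply: (@le_trans _ _ (\sum_(N <= n < m) M * (`|d| / r) ^+ n)).
  by apply: ler_sum => n _; exact: term.
rewrite -mulr_sumr -mulrA mulrCA ler_wpM2l//.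
have [mN|Nm] := leqP m N.
  by rewrite big_geq// mulr_ge0// exprn_ge0//; case/andP: t01.
rewrite -{1}[N]add0n big_addn big_mkord.
under eq_bigr do rewrite exprD.
rewrite -mulr_suml ler_wpM2r ?exprn_ge0//; first by case/andP: t01.
exact: geometric_le2.
Qed.

Variables (a0 : R) (g : R -> R).

(** The conclusion of [analytic2_slice] for real values. *)
Definition power_series_at (b : R) : Prop := exists (r M : R) (q : nat -> R),
  [/\ 0 < r, forall n, `|q n| * r ^+ n <= M &
      forall a, `|a| < a0 -> `|a - b| < r ->
        (fun n0 => `|g a - \sum_(n < n0) (a - b) ^+ n * q n|) @ \oo --> (0 : R)].

Definition isolated_zeros (b : R) : Prop := exists2 rho : R, 0 < rho &
  forall a, `|a| < a0 -> 0 < `|a - b| < rho -> g a != 0.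

Definition vanishes_near (b : R) : Prop := exists2 rho : R, 0 < rho &
  forall a, `|a| < a0 -> `|a - b| < rho -> g a = 0.

(** If some coefficient is nonzero, the first such term dominates all later ones near
    the center. *)
Lemma power_series_zeros b : power_series_at b -> isolated_zeros b \/ vanishes_near b.
Proof.
move=> [r [M [q [r0 qM cv]]]].
have [q0|] := pselect (forall n, q n = 0).
  right; exists r => // a aa ar; have := cv a aa ar.
  rewrite (_ : (fun n0 => _) = cst `|g a|); last first.
    apply/funext => n0; rewrite big1 ?subr0// => n _.
    by rewrite q0 mulr0.
  by move=> /(cvg_lim (@Rhausdorff R)); rewrite lim_cst//= => /eqP; rewrite normr_eq0 => /eqP.
move=> /existsNP[n1 /eqP qn1]; left.
have ex : exists n, q n != 0 by exists n1.
pose N := ex_minn ex.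
have [qN qmin] : q N != 0 /\ forall n, (n < N)%N -> q n = 0.
  rewrite /N; case: ex_minnP => m qm mmin; split => // n nm.
  by apply/eqP; apply: contraTT nm => qn; rewrite -leqNgt mmin.
have M0 : 0 <= M by apply: le_trans (qM 0%N); rewrite mulr_ge0.
(* For [|a - b| < rho] the terms of index greater than [N] add up to at most half of
   the term of index [N]. *)
pose rho := Num.min (r / 2) (`|q N| * r ^+ N.+1 / (4 * (M + 1))).
have rho0 : 0 < rho.
  rewrite lt_min divr_gt0//= divr_gt0//; first by rewrite mulr_gt0 ?normr_gt0 ?exprn_gt0.
  by rewrite mulr_gt0// ltr_wpDl.
exists rho => // a aa /andP[d0 drho].
set d := a - b in d0 drho.
have dr2 : `|d| <= r / 2 by rewrite (le_trans (ltW drho))// ge_min lexx.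
have dr : `|d| < r by rewrite (le_lt_trans dr2)// ltr_pdivrMr// ltr_pMr// ltr1n.
have dq : `|d| * (4 * (M + 1)) <= `|q N| * r ^+ N.+1.
  rewrite -ler_pdivlMr; last by rewrite mulr_gt0// ltr_wpDl.
  by rewrite (le_trans (ltW drho))// ge_min lexx orbT.
pose e := `|d| ^+ N * `|q N| / 2.
have qN0 : 0 < `|q N| by rewrite normr_gt0.
have e0 : 0 < e by rewrite divr_gt0// mulr_gt0// exprn_gt0.
have low m : (N < m)%N -> e <= `|\sum_(n < m) d ^+ n * q n|.
  move=> Nm; rewrite -(big_mkord xpredT (fun n => d ^+ n * q n)).
  rewrite (big_cat_nat (n := N))//=; last exact: ltnW.
  rewrite big_nat_cond big1 ?add0r => [|n /andP[/andP[_ nN] _]]; last by rewrite qmin// mulr0.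
  rewrite big_ltn//.
  have tail : `|\sum_(N.+1 <= n < m) d ^+ n * q n| <= 2 * M * (`|d| / r) ^+ N.+1.
    apply: le_trans (ler_norm_sum _ _ _) _.
    under eq_bigr do rewrite normrM normrX.
    by apply: (power_tail_le (q := fun n => `|q n|)).
  apply: le_trans (lerB_normD _ _); apply: le_trans (lerB (lexx _) tail).
  rewrite normrM normrX /e exprS.
  have rN : 0 < r ^+ N.+1 by rewrite exprn_gt0.
  have -> : 2 * M * (`|d| / r * (`|d| / r) ^+ N) =
      `|d| ^+ N * (2 * M * `|d| / r ^+ N.+1).
    by rewrite exprMn exprVn exprS; field; rewrite !gt_eqF ?exprn_gt0.
  rewrite -mulrA -mulrBr ler_wpM2l ?exprn_ge0// lerBrDr -lerBrDl.
  rewrite ler_pdivrMr// (_ : `|q N| - `|q N| / 2 = `|q N| / 2); last by field.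
  rewrite [leRHS](_ : _ = (`|q N| * r ^+ N.+1) / 2); last by ring.
  rewrite ler_pdivlMr//; apply: le_trans dq.
  have := mulr_ge0 M0 (ltW d0); have := ltW d0; lra.
apply/eqP => ga; have := cv a aa dr; rewrite ga.
move=> /cvgr0_norm_lt/(_ _ e0)[m0 _ hm0].
have := hm0 (maxn m0 N.+1) (leq_maxl _ _) => /=.
rewrite sub0r normrN normr_id; apply/negP; rewrite -leNgt; apply: low.
exact: leq_maxr.
Qed.

(** On an interval the points near which an analytic function vanishes form a set that
    is both open and closed. *)
Lemma zeros_isolated : (forall b, `|b| < a0 -> power_series_at b) -> 0 < a0 -> g 0 != 0 ->
  forall b, `|b| < a0 -> isolated_zeros b.
Proof.
move=> ser a00 g0 b ba.
have alt t : 0 <= t <= 1 -> isolated_zeros (t * b) \/ vanishes_near (t * b).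
  move=> /andP[t0 t1]; apply: power_series_zeros; apply: ser.
  rewrite normrM (ger0_norm t0) (le_lt_trans _ ba)// ler_piMl//.
have inI t : 0 <= t <= 1 -> `|t * b| < a0.
  by move=> /andP[t0 t1]; rewrite normrM (ger0_norm t0) (le_lt_trans _ ba)// ler_piMl.
have [//|bad] := power_series_zeros (ser b ba); exfalso.
have b0 : b != 0.
  apply/eqP => b0; move: bad; rewrite b0 => -[rho rho0 /(_ 0)].
  by rewrite normr0 subrr normr0 => /(_ a00 rho0) /eqP; rewrite (negbTE g0).
pose E := [set t : R | 0 <= t <= 1 /\ ~ vanishes_near (t * b)].
have E0 : E 0.
  split; first by rewrite lexx ler01.
  rewrite mul0r => -[rho rho0 /(_ 0)].
  by rewrite normr0 subrr normr0 => /(_ a00 rho0) /eqP; rewrite (negbTE g0).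
have supE : has_sup E.
  by split; [exists 0|exists 1 => t [/andP[_ ->] _]].
pose s := sup E.
have s0 : 0 <= s by apply: ub_le_sup => //; case: supE.
have s1 : s <= 1 by apply: ge_sup => [|t [/andP[_ ->] _]]; [exists 0|].
have s01 : 0 <= s <= 1 by rewrite s0 s1.
have nb : 0 < `|b| by rewrite normr_gt0.
have dst t : `|t * b - s * b| = `|t - s| * `|b| by rewrite -mulrBl normrM.
have [[rho rho0 iso]|[rho rho0 van]] := alt s s01.
  have sE : ~ vanishes_near (s * b).
    move=> [rho' rho'0 van].
    have m0 : 0 < Num.min rho rho' by rewrite lt_min rho0.
    have a0s : 0 < a0 - `|s * b| by rewrite subr_gt0 inI.
    pose h := Num.min (Num.min rho rho') (a0 - `|s * b|) / 2.
    have h0 : 0 < h by rewrite divr_gt0// lt_min m0.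
    have hlt : h < Num.min (Num.min rho rho') (a0 - `|s * b|).
      by rewrite ltr_pdivrMr// ltr_pMr ?ltr1n// lt_min m0.
    have [hr hr' ha] : [/\ h < rho, h < rho' & h < a0 - `|s * b|].
      by move: hlt; rewrite !lt_min => /andP[/andP[-> ->] ->].
    have aa : `|s * b + h| < a0.
      rewrite (le_lt_trans (ler_normD _ _))// (gtr0_norm h0); lra.
    have hh : `|s * b + h - s * b| = h by rewrite addrAC subrr add0r gtr0_norm.
    have nz := iso _ aa; rewrite hh h0 hr in nz.
    by move: (nz isT); rewrite van ?hh// eqxx.
  have slt1 : s < 1.
    rewrite lt_neqAle s1 andbT; apply/eqP => s1'; apply: sE; rewrite s1' mul1r.
    exact: bad.
  pose h := Num.min (1 - s) (rho / `|b|) / 2.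
  have m0 : 0 < Num.min (1 - s) (rho / `|b|) by rewrite lt_min subr_gt0 slt1 divr_gt0.
  have h0 : 0 < h by rewrite divr_gt0.
  have hlt : h < Num.min (1 - s) (rho / `|b|) by rewrite ltr_pdivrMr// ltr_pMr ?ltr1n.
  have [h1 hr] : h < 1 - s /\ h < rho / `|b| by move: hlt; rewrite lt_min => /andP[].
  have sh : E (s + h).
    have sh01 : 0 <= s + h <= 1 by apply/andP; split; lra.
    split => // -[rho' rho'0 van].
    have dd : `|(s + h) * b - s * b| = h * `|b|.
      by rewrite dst addrAC subrr add0r gtr0_norm.
    have := iso _ (inI _ sh01); rewrite dd mulr_gt0//= -ltr_pdivlMr// hr => /(_ isT).
    rewrite van ?inI ?subrr ?normr0//.
    by rewrite eqxx.
  have : s + h <= s by apply: ub_le_sup => //; case: supE.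
  by rewrite gerDl leNgt h0.
have rb : 0 < rho / `|b| by rewrite divr_gt0.
have [t [t01 nt] st] := sup_adherent rb supE.
have ts : t <= s by apply: ub_le_sup; [case: supE|split].
apply: nt; exists (rho - `|t * b - s * b|).
  rewrite subr_gt0 dst -ltr_pdivlMr//.
  rewrite distrC ger0_norm ?subr_ge0//.
  by move: st; rewrite -/s; lra.
move=> a aa ar; apply: van => //.
rewrite (_ : a - s * b = (a - t * b) + (t * b - s * b)); last by ring.
by rewrite (le_lt_trans (ler_normD _ _))// -ltrBrDr.
Qed.

End AnalyticZeros.

(** * Norms and limits *)
Section Norms.
Context {R : realType}.
Local Notation mu := (@lebesgue_measure R).
Local Notation locint F := (locally_integrable [set: R] F).
Implicit Types (D : set R) (f g : R -> R).

Definition L2norm D f : R := Num.sqrt (\int[mu]_(x in D) (f x ^+ 2)).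

Lemma L2norm_ge0 D f : 0 <= L2norm D f.
Proof. exact: sqrtr_ge0. Qed.

Lemma L2norm_sqr D f : L2norm D f ^+ 2 = \int[mu]_(x in D) (f x ^+ 2).
Proof. by rewrite sqr_sqrtr// Rintegral_ge0// => x _; exact: sqr_ge0. Qed.

Lemma L2r_mul_integrable D f g : measurable D -> L2r D f -> L2r D g ->
  mu.-integrable D (EFin \o (fun x => f x * g x)).
Proof.
move=> mD [mf if2] [mg ig2].
apply: (@le_integrable _ _ _ mu _ mD _ _ _ _ (integrable_addr mD if2 ig2)).
  by apply/measurable_EFinP; exact: measurable_funM.
move=> x _; rewrite /= lee_fin normrM (ger0_norm (addr_ge0 (sqr_ge0 _) (sqr_ge0 _))).
rewrite -[f x ^+ 2]real_normK ?num_real// -[g x ^+ 2]real_normK ?num_real//.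
have := sqr_ge0 (`|f x| - `|g x|); have := mulr_ge0 (normr_ge0 (f x)) (normr_ge0 (g x)).
rewrite !expr2; nra.
Qed.

Lemma RintegralD_L2 D (u v : R -> R) : measurable D ->
  mu.-integrable D (EFin \o u) -> mu.-integrable D (EFin \o v) ->
  \int[mu]_(x in D) (u x + v x) = \int[mu]_(x in D) u x + \int[mu]_(x in D) v x.
Proof. by move=> mD iu iv; rewrite RintegralD. Qed.

Lemma L2norm_expand D f g (t : R) : measurable D -> L2r D f -> L2r D g ->
  L2norm D (fun x => f x + t * g x) ^+ 2 =
  L2norm D f ^+ 2 + 2 * t * \int[mu]_(x in D) (f x * g x) + t ^+ 2 * L2norm D g ^+ 2.
Proof.
move=> mD Lf Lg; rewrite !L2norm_sqr.
have ifg := L2r_mul_integrable mD Lf Lg.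
have [_ if2] := Lf; have [_ ig2] := Lg.
have i1 : mu.-integrable D (EFin \o (fun x => 2 * t * (f x * g x))).
  exact: (integrable_mull _ mD ifg).
have i2 : mu.-integrable D (EFin \o (fun x => t ^+ 2 * g x ^+ 2)).
  exact: (integrable_mull _ mD ig2).
rewrite -[X in _ + X + _]RintegralZl// -[X in _ + _ + X]RintegralZl//.
rewrite -RintegralD_L2// -RintegralD_L2//; last exact: (integrable_addr mD if2 i1).
by apply: eq_Rintegral => x _; ring.
Qed.

(** The square of the norm of [f + t g] is a nonnegative polynomial in [t]. It is
    evaluated at its minimum or, if [g] is null, at a value of [t] that would make it
    negative. *)
Lemma cauchy_schwarz D f g : measurable D -> L2r D f -> L2r D g ->
  `|\int[mu]_(x in D) (f x * g x)| <= L2norm D f * L2norm D g.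
Proof.
move=> mD Lf Lg; set B := \int[mu]_(x in D) (f x * g x).
have pos t : 0 <= L2norm D f ^+ 2 + 2 * t * B + t ^+ 2 * L2norm D g ^+ 2.
  by rewrite -L2norm_expand// sqr_ge0.
set a := L2norm D f in pos *; set b := L2norm D g in pos *.
have a0 : 0 <= a := L2norm_ge0 D f; have b0 : 0 <= b := L2norm_ge0 D g.
have [bz|bn] := eqVneq b 0.
  rewrite bz mulr0 normr_le0; apply: contraT => Bn.
  have := pos (- (a ^+ 2 + 1) / (2 * B)); rewrite bz expr0n mulr0 addr0.
  rewrite (_ : 2 * _ * B = - (a ^+ 2 + 1)); last by field.
  by rewrite opprD addrA subrr sub0r oppr_ge0 ler10.
have b1 : 0 < b by rewrite lt_neqAle eq_sym bn.
have := pos (- B / b ^+ 2).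
rewrite (_ : _ + _ = a ^+ 2 - B ^+ 2 / b ^+ 2); last by field.
rewrite subr_ge0 ler_pdivrMr ?exprn_gt0// -exprMn => h.
by rewrite -(@ler_pXn2r _ 2) ?nnegrE ?mulr_ge0// real_normK ?num_real.
Qed.

Lemma L2normD D f g : measurable D -> L2r D f -> L2r D g ->
  L2norm D (fun x => f x + g x) <= L2norm D f + L2norm D g.
Proof.
move=> mD Lf Lg.
rewrite -(@ler_pXn2r _ 2) ?nnegrE ?addr_ge0 ?L2norm_ge0//.
have := L2norm_expand 1 mD Lf Lg; rewrite expr1n !mul1r mulr1.
under eq_fun do rewrite mul1r.
move=> ->; rewrite sqrrD lerD2r lerD2l -[leRHS]mulr_natl ler_wpM2l//.
exact: le_trans (ler_norm _) (cauchy_schwarz mD Lf Lg).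
Qed.

Lemma L2normZ D f (k : R) : measurable D -> L2r D f ->
  L2norm D (fun x => k * f x) = `|k| * L2norm D f.
Proof.
move=> mD [_ if2]; rewrite /L2norm; under eq_Rintegral do rewrite exprMn.
by rewrite RintegralZl// sqrtrM ?sqr_ge0// sqrtr_sqr.
Qed.

Lemma L2norm_ae D f g : measurable D -> measurable_fun D f -> measurable_fun D g ->
  ae_eq mu D f g -> L2norm D f = L2norm D g.
Proof.
move=> mD mf mg fg; rewrite /L2norm; congr Num.sqrt; apply: Rintegral_ae => //.
- exact: measurable_funX.
- exact: measurable_funX.
- by apply: ae_weaken fg => x h Dx; rewrite h.
Qed.

(** The series converges with respect to [N]; the estimate concerns a smaller seminorm
    [nrm], for which the triangle inequality is available. *)
Lemma power_series_lipschitz (V : lmodType R) (S : set V) (N nrm : V -> R) (a0 a1 : R)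
    (F : R -> V) (q : nat -> V) (r M : R) :
  (forall u v, S u -> S v -> S (u + v)) -> (forall k u, S u -> S (k *: u)) -> S 0 ->
  (forall u v, S u -> S v -> nrm (u + v) <= nrm u + nrm v) ->
  (forall k u, S u -> nrm (k *: u) = `|k| * nrm u) ->
  (forall u, S u -> nrm u <= N u) -> (forall u, 0 <= nrm u) ->
  (forall a, `|a| < a0 -> S (F a)) -> `|a1| < a0 -> 0 < r ->
  (forall n, S (q n) /\ N (q n) * r ^+ n <= M) ->
  (forall a, `|a| < a0 -> `|a - a1| < r ->
     (fun n0 => N (F a - \sum_(n < n0) (a - a1) ^+ n *: q n)) @ \oo --> (0 : R)) ->
  forall a, `|a| < a0 -> `|a - a1| <= r / 2 -> nrm (F a - F a1) <= 2 * M / r * `|a - a1|.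
Proof.
move=> SD SZ S0 nD nZ nN nge0 SF a1a r0 qM cv a aa ar.
have ar' : `|a - a1| < r by rewrite (le_lt_trans ar)// ltr_pdivrMr// ltr_pMr// ltr1n.
have SB u v : S u -> S v -> S (u - v).
  by move=> Su Sv; apply: SD => //; rewrite -scaleN1r; exact: SZ.
have Ssum m (w : nat -> V) : (forall n, S (w n)) -> S (\sum_(n < m) w n).
  by move=> Sw; elim/big_ind : _ => // n _.
have nsum m (w : nat -> V) : (forall n, S (w n)) ->
    nrm (\sum_(n < m) w n) <= \sum_(n < m) nrm (w n).
  move=> Sw; elim: m => [|m IH]; first by rewrite !big_ord0 -(scale0r (0 : V)) nZ// normr0 mul0r.
  rewrite !big_ord_recr/=; apply: le_trans (nD _ _ _ _) _ => //; first exact: Ssum.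
  by rewrite lerD2r.
have center : nrm (q 0%N - F a1) <= 0.
  have := cv a1 a1a; rewrite subrr normr0 => /(_ r0) cv1.
  have Sq : S (F a1 - q 0%N) by apply: SB; [exact: SF|case: (qM 0%N)].
  rewrite -opprB -scaleN1r nZ// normrN1 mul1r (le_trans (nN _ Sq))//.
  suff -> : N (F a1 - q 0%N) = 0 by [].
  move: cv1; rewrite -cvg_shiftS /=.
  rewrite (_ : (fun n0 => _) = cst (N (F a1 - q 0%N))); last first.
    apply/funext => n0; rewrite big_ord_recl expr0 scale1r big1 ?addr0// => i _.
    by rewrite /= expr0n/= scale0r.
  by move=> /(cvg_lim (@Rhausdorff R)); rewrite lim_cst.
have Sq n : S (q n) by case: (qM n).
have qM' n : nrm (q n) * r ^+ n <= M.
  by have [_] := qM n; apply: le_trans; rewrite ler_wpM2r ?exprn_ge0 ?(ltW r0)// nN.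
set d := a - a1 in ar ar' *.
have SZq n : S (d ^+ n *: q n) by exact: SZ.
have step n0 : nrm (F a - F a1) <=
    N (F a - \sum_(n < n0.+1) d ^+ n *: q n) + 2 * M / r * `|d|.
  set s := \sum_(n < n0.+1) d ^+ n *: q n.
  have Ss : S s by exact: (Ssum _ (fun n => d ^+ n *: q n)).
  have -> : F a - F a1 = (F a - s) + ((s - q 0%N) + (q 0%N - F a1)).
    by rewrite [s - _ + _]addrA subrK addrA subrK.
  have S1 : S (F a - s) by apply: SB => //; exact: SF.
  have S2 : S (s - q 0%N) by exact: SB.
  have S3 : S (q 0%N - F a1) by apply: SB => //; exact: SF.
  apply: le_trans (nD _ _ S1 (SD _ _ S2 S3)) _; apply: lerD; first exact: nN.
  apply: le_trans (nD _ _ S2 S3) _; rewrite -[leRHS]addr0; apply: lerD => //.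
  rewrite /s big_ord_recl expr0 scale1r addrAC subrr add0r.
  apply: le_trans (nsum _ (fun i => d ^+ i.+1 *: q i.+1) (fun i => SZq i.+1)) _.
  have := power_tail_le 1 n0.+1 r0 qM' (fun n => nge0 (q n)) ar.
  rewrite big_add1/= big_mkord expr1 => h.
  rewrite [leRHS](_ : _ = 2 * M * (`|d| / r)); last by ring.
  by apply: le_trans h; apply: ler_sum => i _; rewrite nZ// normrX.
apply/ler_addgt0Pr => e e0.
have /cvgr0_norm_lt/(_ _ e0)[m _ hm] := cv a aa ar'.
rewrite [leRHS]addrC; apply: le_trans (step m) _; rewrite lerD2r.
by apply: le_trans (ler_norm _) (ltW (hm m.+1 _)) => /=.
Qed.


(** ** Smooth functions have weak derivatives *)
Lemma Rintegral_derive1_test phi : test_function phi -> \int[mu]_x (derive1 phi x) = 0.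
Proof.
move=> tphi; have /test_functionE[sphi [M M0 hM]] := tphi.
have /test_functionE[sphi' [M' M'0 hM']] := test_derive1 tphi.
pose B := Num.max M M'.
have B0 : 0 < B by rewrite lt_max M0.
have -> : \int[mu]_x (derive1 phi x) = \int[mu]_(x in `[- B, B]) (derive1 phi x).
  rewrite [RHS]Rintegral_mkcond; apply: eq_Rintegral => x _; rewrite patchE.
  case: ifPn => // /negP; rewrite inE/= in_itv/= -ler_norml => /negP; rewrite -ltNge => xB.
  by rewrite hM'// (le_trans _ (ltW xB))// le_max lexx orbT.
rewrite /Rintegral (@continuous_FTC2 _ _ phi)//.
- have hB : phi B = 0 by apply: hM; rewrite gtr0_norm// le_max lexx.
  have hNB : phi (- B) = 0 by apply: hM; rewrite normrN gtr0_norm// le_max lexx.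
  by rewrite hB hNB /= subrr.
- by rewrite -subr_gt0 opprK addr_gt0.
- by apply: continuous_subspaceT; exact: smooth_continuous.
- have dphi x : derivable phi x 1 := sphi 0%N x.
  have cphi := smooth_continuous sphi.
  split => //.
  + exact: (cvg_at_right_filter (cphi _)).
  + exact: (cvg_at_left_filter (cphi _)).
Qed.

Lemma wder_cst1 : wder 1 (cst 1 : R -> R) (cst 0).
Proof.
have lc (k : R) : locint (cst k) by apply: locint_continuous => x; exact: cvg_cst.
split=> // phi tphi; under eq_Rintegral do rewrite mul1r.
under [in RHS]eq_Rintegral do rewrite mul0r.
by rewrite derive1n1 Rintegral_derive1_test// Rintegral_cst// mul0r mulr0.
Qed.

(** The product rule applied to the constant function [1]. *)
Lemma wder_smooth (A : nat -> R -> R) n : derivs A -> wder 1 (A n) (A n.+1).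
Proof.
move=> dA; have dS : derivs (fun m => A (n + m)%N) by move=> m x; rewrite addnS; exact: dA.
have := wder_mul dS wder_cst1; rewrite addn0 addn1.
under eq_fun do rewrite mulr1.
by under [X in wder _ _ X -> _]eq_fun do rewrite mulr1 mulr0 addr0.
Qed.

Lemma L2locr_continuous f : continuous f -> L2locr f.
Proof.
move=> cf; have mf := continuous_measurable_fun cf; split => // M.
split; first exact: measurable_funS mf.
have cf2 : continuous (fun x => f x ^+ 2).
  by move=> x; apply: cvgM; exact: cf.
exact: locint_itv (locint_continuous cf2).
Qed.

Lemma smooth_chain (A : nat -> R -> R) : derivs A -> sobolev_chain L2locr A (A 0%N).
Proof.
move=> dA; split=> // [i _|i _]; first exact: wder_smooth.
have cA : continuous (A i) by exact: derivs_continuous.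
by split; [exact: L2locr_continuous|exact: locint_continuous].
Qed.

(** ** Limits of integrals against rapidly decaying functions *)
Local Notation wnorm u := (L2norm [set: R] (fun x => decay x * u x)).

(** The functions against which products of two weighted functions can be integrated. *)
Definition pairable (psi : R -> R) : Prop := measurable_fun [set: R] psi /\
  exists2 C : R, 0 <= C & forall x, `|psi x| <= C * decay x ^+ 2.

Lemma test_pairable phi : test_function phi -> pairable phi.
Proof.
move=> tphi; have /test_functionE[sphi [M M0 hM]] := tphi.
have cphi := smooth_continuous sphi.
split; first exact: continuous_measurable_fun.
have [B B0 hB] := itv_bounded (- M) M cphi.
exists (B * (1 + M) ^+ 2) => [|x]; first by rewrite mulr_ge0// sqr_ge0.
have [xM|/ltW/hM ->] := leP `|x| M; last first.
  by rewrite normr0 mulr_ge0 ?sqr_ge0// mulr_ge0// sqr_ge0.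
have := xM; rewrite ler_norml => /hB hx; apply: le_trans hx _.
rewrite -mulrA ler_peMr// -exprMn exprn_ege1// /decay ler_pdivlMr ?ltr_pwDl//.
by rewrite mul1r lerD2l.
Qed.

Lemma pairing_integrable u v psi : weighted u -> weighted v -> pairable psi ->
  mu.-integrable [set: R] (EFin \o (fun x => u x * v x * psi x)) /\
  forall C, 0 <= C -> (forall x, `|psi x| <= C * decay x ^+ 2) ->
  `|\int[mu]_x (u x * v x * psi x)| <= C * (wnorm u * wnorm v).
Proof.
move=> [mu_ Lu] [mv Lv] [mpsi [C0 C00 hC0]].
pose a x := psi x / decay x ^+ 2.
have ma : measurable_fun [set: R] a.
  have d0 x : decay x != 0 by rewrite gt_eqF// decay_gt0.
  have -> : a = fun x => psi x * (1 + `|x|) ^+ 2.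
    by apply/funext => x; rewrite /a /decay exprVn invrK.
  apply: measurable_funM => //; apply: continuous_measurable_fun => x.
  by apply: cvgM; apply: cvgD; (exact: cvg_cst || exact: norm_continuous).
have aC C : (forall x, `|psi x| <= C * decay x ^+ 2) -> forall x, `|a x| <= C.
  move=> hC x; rewrite normrM normfV (ger0_norm (sqr_ge0 (decay x))).
  by rewrite ler_pdivrMr ?exprn_gt0 ?decay_gt0.
have E : (fun x => u x * v x * psi x) = (fun x => (a x * (decay x * u x)) * (decay x * v x)).
  by apply/funext => x; rewrite /a; field; rewrite gt_eqF// decay_gt0.
have La C : (forall x, `|psi x| <= C * decay x ^+ 2) ->
    L2r [set: R] (fun x => a x * (decay x * u x)).
  by move=> /aC hC; apply: (L2r_bounded (B := C)) => // x _.
rewrite E; split; first by apply: L2r_mul_integrable => //; exact: La hC0.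
move=> C C1 hC; apply: le_trans (cauchy_schwarz measurableT (La _ hC) Lv) _.
rewrite mulrA ler_wpM2r ?L2norm_ge0//.
rewrite -(@ler_pXn2r _ 2) ?nnegrE ?mulr_ge0 ?L2norm_ge0// exprMn !L2norm_sqr.
have [_ iu] := Lu; have [_ iau] := La _ hC.
rewrite -RintegralZl// le_Rintegral//; first exact: integrable_mull.
move=> x _; rewrite exprMn ler_wpM2r ?sqr_ge0// -real_normK ?num_real//.
by rewrite lerXn2r ?nnegrE// aC.
Qed.

Lemma weighted_cst1 : weighted (cst 1 : R -> R).
Proof.
split; first exact: measurable_cst.
apply: (@periodic_weighted R 1) => //; last by apply: aeW.
by apply: L2locr_continuous => x; exact: cvg_cst.
Qed.

Lemma pairing_cvg (u_ v_ : nat -> R -> R) (u v psi : R -> R) :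
  (forall n, weighted (u_ n)) -> (forall n, weighted (v_ n)) ->
  weighted u -> weighted v -> pairable psi ->
  (fun n => wnorm (fun x => u_ n x - u x)) @ \oo --> (0 : R) ->
  (fun n => wnorm (fun x => v_ n x - v x)) @ \oo --> (0 : R) ->
  (fun n => \int[mu]_x (u_ n x * v_ n x * psi x)) @ \oo --> \int[mu]_x (u x * v x * psi x).
Proof.
move=> wu_ wv_ wu wv ppsi cu cv.
have [_ [C C0 hC]] := ppsi.
have wdu n : weighted (fun x => u_ n x - u x) by exact: weightedB.
have wdv n : weighted (fun x => v_ n x - v x) by exact: weightedB.
apply/subr_cvg0; apply/norm_cvg0P.
pose b n := C * (wnorm (fun x => u_ n x - u x) * wnorm (fun x => v_ n x - v x)
  + wnorm (fun x => u_ n x - u x) * wnorm v + wnorm u * wnorm (fun x => v_ n x - v x)).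
apply: (@squeeze_cvgr _ _ _ _ (cst 0) b).
- apply: nearW => n; rewrite normr_ge0/=.
  have [i1 h1] := pairing_integrable (wdu n) (wdv n) ppsi.
  have [i2 h2] := pairing_integrable (wdu n) wv ppsi.
  have [i3 h3] := pairing_integrable wu (wdv n) ppsi.
  have [i4 _] := pairing_integrable (wu_ n) (wv_ n) ppsi.
  have [i5 _] := pairing_integrable wu wv ppsi.
  rewrite -RintegralB//.
  have -> : \int[mu]_x (u_ n x * v_ n x * psi x - u x * v x * psi x) =
      \int[mu]_x ((u_ n x - u x) * (v_ n x - v x) * psi x) +
      \int[mu]_x ((u_ n x - u x) * v x * psi x) +
      \int[mu]_x (u x * (v_ n x - v x) * psi x).
    rewrite -RintegralD// -RintegralD//; last exact: (integrable_addr measurableT i1 i2).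
    by apply: eq_Rintegral => x _; ring.
  rewrite (le_trans (ler_normD _ _))// /b !mulrDr lerD ?h3//.
  by rewrite (le_trans (ler_normD _ _))// lerD ?h1 ?h2.
- exact: cvg_cst.
- have -> : (0 : R) = C * (0 * 0 + 0 * wnorm v + wnorm u * 0) by ring.
  apply: cvgM; first exact: cvg_cst.
  apply: cvgD; last by apply: cvgM => //; exact: cvg_cst.
  by apply: cvgD; apply: cvgM => //; exact: cvg_cst.
Qed.

End Norms.

(** * Mollification *)
Section Mollification.
Context {R : realType}.
Local Notation mu := (@lebesgue_measure R).
Local Notation locint F := (locally_integrable [set: R] F).
Implicit Types (f g p eta : R -> R).

Definition mollify f eta (x : R) : R := \int[mu]_y (f y * eta (x - y)).

Lemma test_reflect eta (x : R) : test_function eta -> test_function (fun y => eta (x - y)).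
Proof.
move=> te; have n1 : (-1 : R) != 0 by rewrite oppr_eq0 oner_eq0.
have := test_affine x n1 te.
by rewrite (_ : (fun y => eta (-1 * y + x)) = (fun y => eta (x - y)))//;
  apply/funext => y; rewrite mulN1r addrC.
Qed.

Lemma derive1_reflect eta (x y : R) : smooth eta ->
  derive1 (fun y => eta (x - y)) y = - derive1 eta (x - y).
Proof.
move=> se; have := derive1_affine (-1) x y se.
rewrite (_ : (fun y => eta (-1 * y + x)) = (fun y => eta (x - y))).
  by rewrite !mulN1r addrC.
by apply/funext => z; rewrite mulN1r addrC.
Qed.

(** The definition of the weak derivative, applied to a reflected mollifier. *)
Lemma mollify_wder f g eta x : wder 1 f g -> test_function eta ->
  mollify f (derive1 eta) x = mollify g eta x.
Proof.
move=> [lf lg fg] te; have := fg _ (test_reflect x te).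
rewrite expr1 mulN1r derive1n1 /mollify => h.
apply: oppr_inj; rewrite -h -mulN1r -RintegralZ_test//; last exact: test_reflect (test_derive1 te).
by apply: eq_Rintegral => y _; rewrite derive1_reflect ?mulrN ?mulN1r//; exact: test_smooth.
Qed.

Lemma is_derive_mollify f eta x : locint f -> test_function eta ->
  is_derive x (1 : R) (mollify f eta) (mollify f (derive1 eta) x).
Proof.
move=> lf te; have se := test_smooth te.
have te1 := test_derive1 te.
have /test_functionE[se1 [M M0 hM]] := te1.
have [B B0 hB] := itv_bounded (- M) M (smooth_continuous se1).
pose h (z y : R) := f y * eta (z - y).
pose K := `|x| + 1 + M.
pose G := (fun y => B * `|f y|) \_ `[- K, K].
have dh z y : is_derive z (1 : R) (h ^~ y) (f y * derive1 eta (z - y)).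
  apply: is_deriveZ.
  have := derivs_affine 1 (- y) (smooth_derivs se) 0%N z.
  rewrite expr1 !mul1r derive1n1.
  by rewrite (_ : (fun z => _) = (fun z => eta (z - y)))//; apply/funext => w; rewrite expr0 !mul1r.
have partial z y : partial1of2 h z y = f y * derive1 eta (z - y).
  by rewrite partial1of2E; have [_ ->] := dh z y.
have xI : `]x - 1, x + 1[%classic x by rewrite /= in_itv/= gtrDl ltrDl ltrN10 ltr01.
have ih z : `]x - 1, x + 1[%classic z -> mu.-integrable [set: R] (EFin \o h z).
  by move=> _; exact: integrable_mul_test lf (test_reflect z te).
have dh' z y : `]x - 1, x + 1[%classic z -> [set: R] y -> derivable (h ^~ y) z 1.
  by move=> _ _; case: (dh z y).
have G0 y : 0 <= G y by rewrite /G patchE; case: ifP => // _; rewrite mulr_ge0.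
have iG : mu.-integrable [set: R] (EFin \o G).
  have i0 := integrable_mull B (measurable_itv _) (integrable_norm (locint_itv (- K) K lf)).
  have := (@integrable_mkcond _ _ _ mu _ _ (measurable_itvR _)).1 i0.
  apply: eq_integrable => // y _; rewrite /= /G !patchE.
  by case: ifP.
have Gub z y : `]x - 1, x + 1[%classic z -> [set: R] y -> `|partial1of2 h z y| <= G y.
  rewrite /= in_itv/= => /andP[z1 z2] _; rewrite partial normrM /G patchE.
  have [zy|/ltW/hM ->] := leP `|z - y| M; last first.
    by rewrite normr0 mulr0; case: ifP => // _; rewrite mulr_ge0.
  have yK : y \in `[- K, K]%classic.
    rewrite inE/= in_itv/= -ler_norml /K.
    have zx : `|z| <= `|x| + 1.
      rewrite -[z](subrK x) addrC (le_trans (ler_normD _ _))// lerD2l ler_norml.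
      by apply/andP; split; lra.
    rewrite -[y](subKr z) (le_trans (ler_normB _ _))// lerD//.
  by rewrite yK mulrC ler_wpM2r// hB// -ler_norml.
have cv := @cvg_differentiation_under_integral _ _ _ mu h [set: R] measurableT x _ _ xI ih dh' G G0 iG Gub.
have E : \int[mu]_(y in [set: R]) partial1of2 h x y = mollify f (derive1 eta) x.
  by apply: eq_Rintegral => y _; exact: partial.
rewrite E in cv.
have cv' : (fun t : R => t^-1 *: (mollify f eta (t *: (1 : R) + x) - mollify f eta x)) @ 0^'
    --> mollify f (derive1 eta) x.
  by under eq_fun do rewrite /GRing.scale/= mulr1; exact: cv.
split; first by apply/cvg_ex; exists (mollify f (derive1 eta) x).
exact: cvg_lim.
Qed.

Lemma mollify_translate f eta (x h : R) : locint f -> test_function eta ->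
  mollify f eta (x + h) = mollify (fun y => f (y + h)) eta x.
Proof.
move=> lf te; rewrite /mollify (@Rintegral_affine _ 1 h)//; last first.
  exact: integrable_mul_test lf (test_reflect _ te).
rewrite mul1r preimage_setT; apply: eq_Rintegral => y _.
by rewrite /affine mul1r; congr (_ * eta _); ring.
Qed.

(** Every test function is the reflection of a test function. *)
Lemma mollify_eq0 f (x : R) : locint f ->
  (forall eta, test_function eta -> mollify f eta x = 0) -> ae_eq mu [set: R] f (cst 0).
Proof.
move=> lf f0; apply: du_bois_reymond => // phi tphi.
have := f0 _ (test_reflect x tphi); rewrite /mollify => <-.
by apply: eq_Rintegral => y _; rewrite subKr.
Qed.

Lemma is_derive0_cst (u : R -> R) : (forall x, is_derive x (1 : R) u 0) ->
  forall x y, u x = u y.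
Proof.
move=> du; have cu : continuous u.
  by move=> x; apply/differentiable_continuous/derivable1_diffP; case: (du x).
suff lt x y : x < y -> u x = u y.
  by move=> x y; have [/lt//|/lt<-//|->//] := ltgtP x y.
move=> xy; have [z _] := @MVT R u (cst 0) x y xy (fun t _ => du t) (continuous_subspaceT cu).
by rewrite mul0r => /eqP; rewrite subr_eq0 => /eqP.
Qed.

(** The averages over balls of a given radius do not depend on the center, and they
    converge at Lebesgue points. *)
Lemma ae_translations_cst p : locint p ->
  (forall h : R, ae_eq mu [set: R] (fun x => p (x + h)) p) ->
  exists k : R, ae_eq mu [set: R] p (cst k).
Proof.
move=> lp ph.
have Lp : {ae mu, forall x, lebesgue_pt p x} := lebesgue_differentiation lp.
have [x0 Lx0] : exists x0, lebesgue_pt p x0.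
  have mT : (mu [set: R] > 0)%E.
    have m1 : (0 < mu `[0%R, 1%R]%classic)%E.
      by rewrite lebesgue_measure_itv/= lte_fin ltr01 -EFinD subr0 lte_fin ltr01.
    apply: lt_le_trans m1 _.
    by apply: (@le_measure _ _ _ mu); rewrite ?inE//; exact: measurable_itvR.
  exact: (@filter_ex _ _ (ae_properfilter_algebraOfSetsType mT) _ Lp).
exists (p x0).
pose E (x : R) (n : nat) : set R := ball x n.+1%:R^-1.
have same x n : ((mu (E x n))^-1 * \int[mu]_(y in E x n) (p y)%:E =
    (mu (E x0 n))^-1 * \int[mu]_(y in E x0 n) (p y)%:E)%E.
  have mE y : mu (E y n) = (n.+1%:R^-1 *+ 2)%:E by exact: lebesgue_measure_ball.
  rewrite !mE /E !ball_itv.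
  suff -> : (\int[mu]_(y in `](x - n.+1%:R^-1)%R, (x + n.+1%:R^-1)%R[) (p y)%:E =
    \int[mu]_(y in `](x0 - n.+1%:R^-1)%R, (x0 + n.+1%:R^-1)%R[) (p y)%:E)%E by [].
  rewrite (@integral_affine _ 1 (x - x0))//; last first.
    have := locint_itv (x - n.+1%:R^-1) (x + n.+1%:R^-1) lp.
    by apply: integrableS => //; exact: subset_itv_oo_cc.
  rewrite mul1e (_ : _ @^-1` _ = `]x0 - n.+1%:R^-1, x0 + n.+1%:R^-1[%classic); last first.
    set e := n.+1%:R^-1; move: e => e.
    by apply/seteqP; split => y /=; rewrite !in_itv/= /affine mul1r => /andP[y1 y2];
      apply/andP; split; lra.
  have mp : measurable_fun [set: R] p := locint_measurable lp.
  apply: ae_eq_integral => //.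
  - apply/measurable_EFinP.
    have mp' := @measurable_fun_affine _ 1 (x - x0) p mp.
    exact: measurable_funS mp'.
  - by apply/measurable_EFinP; exact: measurable_funS mp.
  - by apply: ae_weaken (ph (x - x0)) => y /(_ I) h _; rewrite /affine mul1r h.
apply: ae_weaken Lp => x Lx _ /=.
have c1 := ball_averages_cvg lp Lx.
have c0 := ball_averages_cvg lp Lx0.
have E1 : (fun n => (mu (E x n))^-1 * \int[mu]_(y in E x n) (p y)%:E)%E =
    (fun n => (mu (E x0 n))^-1 * \int[mu]_(y in E x0 n) (p y)%:E)%E.
  by apply/funext => n; exact: same.
rewrite E1 in c1.
have e1 : (p x)%:E = (p x0)%:E.
  exact: (cvg_unique (@ereal_hausdorff R) c1 c0).
by case: e1.
Qed.

(** The mollifications of [p] have zero derivative, so [p] and its translates have the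
    same mollifications. *)
Lemma wder_cst p : wder 1 p (cst 0) -> exists k : R, ae_eq mu [set: R] p (cst k).
Proof.
move=> wp; have [lp l0 _] := wp; apply: ae_translations_cst => // h.
have lph : locint (fun x => p (x + h)).
  have := locint_affine h ltr01 lp.
  by rewrite (_ : (fun x => _) = (fun x => p (x + h)))//; apply/funext => x; rewrite mul1r.
have lB : locint (fun x => p (x + h) - p x) by exact: locally_integrableB.
suff : ae_eq mu [set: R] (fun x => p (x + h) - p x) (cst 0).
  by apply: ae_weaken => x /(_ I)/eqP; rewrite subr_eq0 => /eqP.
apply: (mollify_eq0 (x := 0)) => // eta te.
have -> : mollify (fun x => p (x + h) - p x) eta 0 = mollify p eta (0 + h) - mollify p eta 0.
  rewrite mollify_translate// /mollify -RintegralB//.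
  - by apply: eq_Rintegral => y _; rewrite mulrBl.
  - exact: integrable_mul_test lph (test_reflect 0 te).
  - exact: integrable_mul_test lp (test_reflect 0 te).
apply/eqP; rewrite subr_eq0; apply/eqP.
apply: is_derive0_cst => x.
have := is_derive_mollify x lp te; rewrite (mollify_wder x wp te).
rewrite {2}/mollify; under eq_Rintegral do rewrite mul0r.
by rewrite Rintegral_cst// mul0r.
Qed.

(** A mollification [u] of [f 0] is a smooth periodic solution of [L u' - d u'' = nu
    u]. The energy [d u' ^ 2 + nu u ^ 2] has derivative [2 L u' ^ 2]; being periodic
    it is constant, hence [u' = 0] and [nu u = 0]. *)
Lemma periodic_constant_coefficients (P L d nu : R) (f : nat -> R -> R) :
  0 < P -> 0 < L -> nu != 0 -> locint (f 0%N) ->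
  wder 1 (f 0%N) (f 1%N) -> wder 1 (f 1%N) (f 2%N) ->
  (forall x, f 0%N (x + P) = f 0%N x) ->
  {ae mu, forall x, L * f 1%N x - d * f 2%N x = nu * f 0%N x} ->
  ae_eq mu [set: R] (f 0%N) (cst 0).
Proof.
move=> P0 L0 nu0 l0 w1 w2 fP fE; have [_ l1 _] := w1; have [_ l2 _] := w2.
apply: (mollify_eq0 (x := 0)) => // eta te.
have te1 := test_derive1 te; have te2 := test_derive1 te1.
pose u := mollify (f 0%N) eta; pose u1 := mollify (f 0%N) (derive1 eta).
pose u2 := mollify (f 0%N) (derive1 (derive1 eta)).
have du x : is_derive x (1 : R) u (u1 x) by exact: is_derive_mollify.
have du1 x : is_derive x (1 : R) u1 (u2 x) by exact: is_derive_mollify.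
have ode x : L * u1 x - d * u2 x = nu * u x.
  rewrite /u1 /u2 (mollify_wder x w1 te1) (mollify_wder x w2 te) (mollify_wder x w1 te).
  rewrite /u /mollify -!RintegralZ_test//; try exact: test_reflect.
  rewrite -RintegralB//; first last.
  - have := integrable_mul_test (locintZ d l2) (test_reflect x te).
    by under eq_fun do rewrite -mulrA.
  - have := integrable_mul_test (locintZ L l1) (test_reflect x te).
    by under eq_fun do rewrite -mulrA.
  have mte : measurable_fun [set: R] (fun y => eta (x - y)).
    exact: continuous_measurable_fun (smooth_continuous (test_smooth (test_reflect x te))).
  have m0 := locint_measurable l0; have m1 := locint_measurable l1.
  have m2 := locint_measurable l2.
  apply: Rintegral_ae => //.
  - by apply: measurable_funB; apply: measurable_funM => //; exact: measurable_funM.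
  - by apply: measurable_funM => //; exact: measurable_funM.
  - by apply: ae_weaken fE => y fy _; rewrite [RHS]mulrA -fy; ring.
pose En x := d * u1 x ^+ 2 + nu * u x ^+ 2.
have dE x : is_derive x (1 : R) En (2 * L * u1 x ^+ 2).
  have e1 := is_deriveZ d (is_deriveM (du1 x) (du1 x)).
  have e2 := is_deriveZ nu (is_deriveM (du x) (du x)).
  have := is_deriveD e1 e2.
  rewrite (_ : _ + _ = En); last by apply/funext => y; rewrite /En !expr2.
  move=> e; apply: is_derive_eq e _; rewrite /GRing.scale/=.
  have -> : 2 * L * u1 x ^+ 2 = 2 * u1 x * (nu * u x + d * u2 x) by rewrite -ode; ring.
  by ring.
have cE : continuous En.
  by move=> x; apply/differentiable_continuous/derivable1_diffP; case: (dE x).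
have mono x y : x <= y -> En x <= En y.
  rewrite le_eqVlt => /predU1P[->//|xy].
  have [z _ e] := @MVT R En (fun t => 2 * L * u1 t ^+ 2) x y xy (fun t _ => dE t) (continuous_subspaceT cE).
  by rewrite -subr_ge0 e mulr_ge0 ?subr_ge0 ?(ltW xy)// mulr_ge0 ?sqr_ge0// mulr_ge0 ?(ltW L0).
have moP (eta' : R -> R) x : test_function eta' -> mollify (f 0%N) eta' (x + P) = mollify (f 0%N) eta' x.
  by move=> te'; rewrite mollify_translate//; apply: eq_Rintegral => y _; rewrite fP.
have EP x : En (x + P) = En x by rewrite /En /u1 /u !moP.
have EPn x (n : nat) : En (x + n%:R * P) = En x.
  elim: n => [|n IH]; first by rewrite mul0r addr0.
  by rewrite -natr1 mulrDl mul1r addrA EP.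
have Ecst x y : x <= y -> En x = En y.
  move=> xy; apply/eqP; rewrite eq_le mono//= -(EPn x (Num.Def.archi_bound ((y - x) / P))).
  apply: mono; rewrite -lerBlDl -ler_pdivrMr// ltW// Num.Theory.archi_boundP//.
  by rewrite divr_ge0 ?subr_ge0// ltW.
have u10 x : u1 x = 0.
  have E0 : En = cst (En 0).
    by apply/funext => y; have [/Ecst//|/ltW/Ecst//] := leP y 0.
  have := dE x; rewrite E0 => -[_]; rewrite derive_cst => /esym/eqP.
  by rewrite mulf_eq0 mulf_eq0 pnatr_eq0 (gt_eqF L0)/= sqrf_eq0 => /eqP.
have u20 x : u2 x = 0.
  have [_ <-] := du1 x; rewrite (_ : u1 = cst 0) ?derive_cst//.
  by apply/funext => y; rewrite u10.
have := ode 0; rewrite u10 u20 !mulr0 subrr => /esym/eqP.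
by rewrite mulf_eq0 (negbTE nu0)/= => /eqP.
Qed.

End Mollification.

(** * Periodic Sobolev norms *)
Section PeriodicSobolev.
Context {R : realType}.
Local Notation mu := (@lebesgue_measure R).
Local Notation locint F := (locally_integrable [set: R] F).
Implicit Types (q u v : R -> R).

Lemma Hper_real (j : nat) q : Hper j (of_real q) <->
  (forall i, (i <= j)%N -> exists2 g, L2locr g & wder i q g) /\
  forall x, q (x + 2 * pi) = q x.
Proof.
split=> [[H qP]|[H qP]]; split.
- move=> i ij; have [g Lg qg] := H i ij; have [w _] := (weak_deriv_parts _ _ _).1 qg.
  exists (re g) => //; have [_ lg _] := w.
  split; first exact: locint_measurable.
  by move=> M; have [] := (L2on_parts g (measurable_itv _)).1 (Lg M).
- by move=> x; have := congr1 (@complex.Re R) (qP x).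
- move=> i ij; have [g [mg Lg] w] := H i ij; exists (of_real g).
    move=> M; apply/(L2on_parts _ (measurable_itv _)); split; first exact: Lg.
    by apply: L2r_cst0; exact: measurable_itv.
  by apply/weak_deriv_parts; split => //; exact: wder_cst0.
- by move=> x; rewrite /of_real qP.
Qed.

Lemma Hper_realD (j : nat) u v : Hper j (of_real u) -> Hper j (of_real v) ->
  Hper j (of_real (fun x => u x + v x)).
Proof.
move=> /Hper_real[Hu uP] /Hper_real[Hv vP]; apply/Hper_real; split => [i ij|x]; last first.
  by rewrite uP vP.
have [g [mg Lg] ug] := Hu i ij; have [h [mh Lh] vh] := Hv i ij.
exists (fun x => g x + h x); last exact: wderD.
by split; [exact: measurable_funD|move=> M; exact: L2rD].
Qed.

Lemma Hper_realZ (j : nat) (k : R) u : Hper j (of_real u) ->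
  Hper j (of_real (fun x => k * u x)).
Proof.
move=> /Hper_real[Hu uP]; apply/Hper_real; split => [i ij|x]; last by rewrite uP.
by have [g Lg ug] := Hu i ij; exists (fun x => k * g x); [exact: L2locrZ|exact: wderZ].
Qed.

Lemma Hper_real0 (j : nat) : Hper j (of_real (cst 0 : R -> R)).
Proof.
apply/Hper_real; split => // i _; exists (cst 0); last exact: wder_cst0.
by split; [exact: measurable_cst|move=> M; exact: L2r_cst0].
Qed.

(** The weak derivatives of a real function, as selected by [wD]. *)
Definition weakD (i : nat) q : R -> R := re (wD i (of_real q)).

Lemma Hper_wD (j i : nat) q : (i <= j)%N -> Hper j (of_real q) ->
  [/\ weak_deriv i (of_real q) (wD i (of_real q)), wder i q (weakD i q) &
      L2locr (weakD i q)].
Proof.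
move=> ij [H _]; have [g Lg qg] := H i ij; have w := wD_weak_deriv qg.
have [w1 _] := (weak_deriv_parts _ _ _).1 w; have [g1 _] := (weak_deriv_parts _ _ _).1 qg.
split=> //; have [_ lw _] := w1; have [_ lg _] := g1.
apply: (L2locr_ae (locint_measurable lw) (wder_unique g1 w1)).
split; first exact: locint_measurable.
by move=> M; have [] := (L2on_parts g (measurable_itv _)).1 (Lg M).
Qed.

Lemma cell_measurable : measurable (period_cell R).
Proof. exact: measurable_itv. Qed.

Lemma L2locr_cell q : L2locr q -> L2r (period_cell R) q.
Proof.
move=> /(L2locr_itv 0 (2 * pi)); apply: L2rS; try exact: measurable_itv.
exact: subset_itv_oo_cc.
Qed.

Lemma weakDD (j i : nat) u v : (i <= j)%N -> Hper j (of_real u) -> Hper j (of_real v) ->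
  ae_eq mu [set: R] (weakD i (fun x => u x + v x)) (fun x => weakD i u x + weakD i v x).
Proof.
move=> ij Hu Hv; have [_ w1 _] := Hper_wD ij (Hper_realD Hu Hv).
have [_ wu _] := Hper_wD ij Hu; have [_ wv _] := Hper_wD ij Hv.
exact: wder_unique w1 (wderD wu wv).
Qed.

Lemma weakDZ (j i : nat) (k : R) u : (i <= j)%N -> Hper j (of_real u) ->
  ae_eq mu [set: R] (weakD i (fun x => k * u x)) (fun x => k * weakD i u x).
Proof.
move=> ij Hu; have [_ w1 _] := Hper_wD ij (Hper_realZ k Hu); have [_ wu _] := Hper_wD ij Hu.
exact: wder_unique w1 (wderZ k wu).
Qed.

Lemma weakDB (j i : nat) u v : (i <= j)%N -> Hper j (of_real u) -> Hper j (of_real v) ->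
  ae_eq mu [set: R] (weakD i (fun x => u x - v x)) (fun x => weakD i u x - weakD i v x).
Proof.
move=> ij Hu Hv; have [_ wu _] := Hper_wD ij Hu; have [_ wv _] := Hper_wD ij Hv.
have HB : Hper j (of_real (fun x => u x - v x)).
  have := Hper_realD Hu (Hper_realZ (-1) Hv); congr (Hper _ (of_real _)).
  by apply/funext => x; rewrite mulN1r.
have [_ w1 _] := Hper_wD ij HB; exact: wder_unique w1 (wderB wu wv).
Qed.

Lemma weakD_periodic (j i : nat) q : (i <= j)%N -> Hper j (of_real q) ->
  ae_eq mu [set: R] (fun x => weakD i q (x + 2 * pi)) (weakD i q).
Proof.
move=> ij Hq; have [_ w _] := Hper_wD ij Hq; have /Hper_real[_ qP] := Hq.
have := wder_affine (2 * pi) ltr01 w.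
have -> : (fun x => q (1 * x + 2 * pi)) = q by apply/funext => x; rewrite mul1r qP.
have -> : (fun x => 1 ^+ i * weakD i q (1 * x + 2 * pi)) = (fun x => weakD i q (x + 2 * pi)).
  by apply/funext => x; rewrite expr1n !mul1r.
by move=> w'; exact: wder_unique w' w.
Qed.

Definition cell_norm (i : nat) q : R := L2norm (period_cell R) (weakD i q).

Lemma cell_normD (j i : nat) u v : (i <= j)%N -> Hper j (of_real u) -> Hper j (of_real v) ->
  cell_norm i (fun x => u x + v x) <= cell_norm i u + cell_norm i v.
Proof.
move=> ij Hu Hv; have [_ wu Lu] := Hper_wD ij Hu; have [_ wv Lv] := Hper_wD ij Hv.
have [_ _ Ls] := Hper_wD ij (Hper_realD Hu Hv).
rewrite /cell_norm (@L2norm_ae _ _ _ (fun x => weakD i u x + weakD i v x)).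
- by apply: L2normD; [exact: cell_measurable|exact: L2locr_cell|exact: L2locr_cell].
- exact: cell_measurable.
- exact: L2r_measurable (L2locr_cell Ls).
- by apply: measurable_funD; apply: L2r_measurable; exact: L2locr_cell.
- by apply: ae_weaken (weakDD ij Hu Hv) => x h _; exact: h.
Qed.

Lemma cell_normZ (j i : nat) (k : R) u : (i <= j)%N -> Hper j (of_real u) ->
  cell_norm i (fun x => k * u x) = `|k| * cell_norm i u.
Proof.
move=> ij Hu; have [_ wu Lu] := Hper_wD ij Hu.
have [_ _ Ls] := Hper_wD ij (Hper_realZ k Hu).
rewrite /cell_norm (@L2norm_ae _ _ _ (fun x => k * weakD i u x)).
- by apply: L2normZ; [exact: cell_measurable|exact: L2locr_cell].
- exact: cell_measurable.
- exact: L2r_measurable (L2locr_cell Ls).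
- by apply: measurable_funM => //; apply: L2r_measurable; exact: L2locr_cell.
- by apply: ae_weaken (weakDZ k ij Hu) => x h _; exact: h.
Qed.

Lemma cell_norm_le (j i : nat) u : (i <= j)%N -> Hper j (of_real u) ->
  cell_norm i u <= Hper_norm j (of_real u).
Proof.
move=> ij Hu; apply: ler_wsqrtr.
have pos (l : nat) : 0 <= \int[mu]_(x in period_cell R) (Normc.normc (wD l (of_real u) x) ^+ 2).
  by apply: Rintegral_ge0 => x _; exact: sqr_ge0.
have ij' : (i < j.+1)%N by [].
rewrite (bigD1 (Ordinal ij'))//= -[leLHS]addr0; apply: lerD; last first.
  by apply: sumr_ge0 => l _; exact: pos.
have [w wr Lr] := Hper_wD ij Hu.
have [_ wi] := (weak_deriv_parts _ _ _).1 w.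
have i0 : ae_eq mu [set: R] (im (wD i (of_real u))) (cst 0).
  by apply: wder_unique wi _; exact: wder_cst0.
have Li : L2locr (im (wD i (of_real u))).
  have [_ l _] := wi; apply: (L2locr_ae (locint_measurable l) (ae_eq_sym i0)).
  by split; [exact: measurable_cst|move=> M; exact: L2r_cst0].
have [_ _ iF] : L2on (period_cell R) (wD i (of_real u)).
  by apply/(L2on_parts _ cell_measurable); split; exact: L2locr_cell.
have [_ ir] := L2locr_cell Lr.
apply: le_Rintegral => //; first exact: cell_measurable.
move=> x _; rewrite /weakD /re; case: (wD _ _ _) => a b /=.
by rewrite sqr_sqrtr ?lerDl ?addr_ge0 ?sqr_ge0.
Qed.

Lemma cell_norm_ge0 i u : 0 <= cell_norm i u.
Proof. exact: L2norm_ge0. Qed.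

(** A Lipschitz estimate at every center, transferred to sequences. *)
Lemma analytic2_continuous (V : lmodType R) (S : set V) (N nrm : V -> R) (a0 c0 : R)
    (F : R -> R -> V) : analytic2 S N a0 c0 F ->
  (forall u v : V, S u -> S v -> S (u + v)) -> (forall k (u : V), S u -> S (k *: u)) -> S 0 ->
  (forall u v : V, S u -> S v -> nrm (u + v) <= nrm u + nrm v) ->
  (forall k (u : V), S u -> nrm (k *: u) = `|k| * nrm u) ->
  (forall u : V, S u -> nrm u <= N u) -> (forall u : V, 0 <= nrm u) ->
  forall a c : R, `|a| < a0 -> `|c| < c0 -> (forall b, `|b| < a0 -> S (F b c)) ->
  forall a_ : nat -> R, (forall n, `|a_ n| < a0) -> a_ @ \oo --> a ->
  (fun n => nrm (F (a_ n) c - F a c)) @ \oo --> (0 : R).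
Proof.
move=> an SD SZ S0 nD nZ nN nge0 a c aa cc SF a_ ha_ cva.
have [r [M [q [r0 qM cv]]]] := analytic2_slice an aa cc.
have lip := power_series_lipschitz SD SZ S0 nD nZ nN nge0 SF aa r0 qM cv.
have cv0 : (fun n => `|a_ n - a|) @ \oo --> (0 : R).
  by apply/norm_cvg0P; apply/subr_cvg0.
have r20 : 0 < r / 2 by rewrite divr_gt0.
apply: (@squeeze_cvgr _ _ _ _ (cst 0) (fun n => 2 * M / r * `|a_ n - a|)).
- have /cvgr0_norm_le/(_ _ r20) := cv0; apply: filterS => n /=; rewrite normr_id => h.
  by rewrite nge0/=; exact: lip.
- exact: cvg_cst.
- by rewrite -[X in _ --> X](mulr0 (2 * M / r)); apply: cvgM => //; exact: cvg_cst.
Qed.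

(** Integrals against test functions extend over many periods, whereas the Sobolev
    norms are taken over a single one. *)
Lemma periodic_wnorm_le : exists2 C : R, 0 <= C & forall f, L2locr f ->
  ae_eq mu [set: R] (fun x => f (x + 2 * pi)) f ->
  L2norm [set: R] (fun x => decay x * f x) <= C * L2norm (period_cell R) f.
Proof.
have P0 : 0 < 2 * pi :> R by rewrite mulr_gt0 ?pi_gt0.
have C0 : 0 <= 8 * (1 + (2 * pi)^-2) :> R.
  by rewrite mulr_ge0// addr_ge0// invr_ge0 exprn_ge0 ?ltW.
exists (Num.sqrt (8 * (1 + (2 * pi)^-2))) => [|f Lf fP]; first exact: sqrtr_ge0.
have [mf _] := Lf.
have := periodic_weighted_le P0 mf fP.
rewrite /L2norm -sqrtrM//; set C := 8 * _ in C0 *.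
have [_ i1] := periodic_weighted P0 Lf fP; have [_ i2] := L2locr_cell Lf.
have mcell := L2r_measurable (L2locr_cell Lf).
rewrite -(@integral_itv_obnd_cbnd _ 0 (BLeft (2 * pi)) (fun x => (f x ^+ 2)%:E)); last first.
  by apply/measurable_EFinP; exact: measurable_funX.
move=> h; apply: ler_wsqrtr; rewrite -lee_fin EFinM /Rintegral !fineK//.
- exact: (@integrable_fin_num _ _ _ mu _ cell_measurable _ i2).
- exact: (@integrable_fin_num _ _ _ mu _ measurableT _ i1).
Qed.

End PeriodicSobolev.

(** * Waves of wave number zero *)
Section DegenerateWave.
Context {R : realType}.
Local Notation mu := (@lebesgue_measure R).
Local Notation locint F := (locally_integrable [set: R] F).
Local Notation wnorm u := (L2norm [set: R] (fun x => decay x * u x)).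

Lemma pairing_cvg1 (u_ : nat -> R -> R) (u psi : R -> R) :
  (forall n, weighted (u_ n)) -> weighted u -> pairable psi ->
  (fun n => wnorm (fun x => u_ n x - u x)) @ \oo --> (0 : R) ->
  (fun n => \int[mu]_x (u_ n x * psi x)) @ \oo --> \int[mu]_x (u x * psi x).
Proof.
move=> wu_ wu ppsi cu.
have z : wnorm (fun x => cst 1 x - cst 1 x) = 0 :> R.
  rewrite /L2norm; under eq_Rintegral do rewrite subrr mulr0 expr0n/=.
  by rewrite Rintegral_cst// mul0r sqrtr0.
have e v : \int[mu]_x (v x * cst 1 x * psi x) = \int[mu]_x (v x * psi x).
  by apply: eq_Rintegral => x _; rewrite mulr1.
have h : (fun n => \int[mu]_x (u_ n x * cst 1 x * psi x)) @ \oo -->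
    \int[mu]_x (u x * cst 1 x * psi x).
  apply: (@pairing_cvg R u_ (fun=> cst 1)) => // [n||]; try exact: weighted_cst1.
  by rewrite z; exact: cvg_cst.
by move: h; rewrite e (funext (fun n => e (u_ n))).
Qed.

Lemma L2locr_mul (f g : R -> R) : L2locr f -> L2locr g -> locint (fun x => f x * g x).
Proof.
move=> [mf Lf] [mg Lg]; apply: itv_locint => [|M]; first exact: measurable_funM.
exact: L2r_mul_integrable (measurable_itvR _) (Lf M) (Lg M).
Qed.

Lemma cvg_eq (u_ v_ : nat -> R) (l m : R) : u_ =1 v_ -> u_ @ \oo --> l -> v_ @ \oo --> m ->
  l = m.
Proof.
move=> /funext -> cu cv; exact: (cvg_unique (@Rhausdorff R) cu cv).
Qed.

(** In the limit of vanishing wave number the wave equation becomes [p^2 = 2 c p], whose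
    derivative reads [(p - c) p' = 0]; since [p = c] is incompatible with the first
    equation, [p' = 0]. *)
Lemma degenerate_wave_cst (c : R) (k_ : nat -> R) (A_ : nat -> nat -> R -> R) (p p1 : R -> R) :
  c != 0 -> (forall n, derivs (A_ n)) -> (forall n, weighted (A_ n 0%N)) ->
  (forall n, weighted (A_ n 1%N)) -> L2locr p -> L2locr p1 -> weighted p -> weighted p1 ->
  wder 1 p p1 ->
  (forall n x, k_ n ^+ 4 * A_ n 4%N x + k_ n ^+ 2 * A_ n 2%N x - c * A_ n 0%N x
     + 2^-1 * A_ n 0%N x ^+ 2 = 0) ->
  k_ @ \oo --> (0 : R) ->
  (fun n => wnorm (fun x => A_ n 0%N x - p x)) @ \oo --> (0 : R) ->
  (fun n => wnorm (fun x => A_ n 1%N x - p1 x)) @ \oo --> (0 : R) ->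
  exists kap : R, ae_eq mu [set: R] p (cst kap).
Proof.
move=> c0 dA w0 w1 Lp Lp1 wp wp1 dp ode ck cv0 cv1.
have lp := L2locr_locint Lp; have lpp := L2locr_mul Lp Lp; have lpp1 := L2locr_mul Lp Lp1.
have cA n i : continuous (A_ n i) by exact: derivs_continuous.
have lA n i : locint (A_ n i) by apply: locint_continuous.
have lAA n i j : locint (fun x => A_ n i x * A_ n j x) by exact: locint_mul.
have dAn n j : (j <= 6)%N -> wder j (A_ n 0%N) (A_ n j).
  by move=> j6; have [_ ch _] := smooth_chain (dA n); exact: (weak_chain_wder ch).
have sq : {ae mu, forall x, p x * p x = 2 * c * p x}.
  have l : locint (fun x => 2^-1 * (p x * p x) - c * p x).
    by apply: locally_integrableB; exact: locintZ.
  suff : ae_eq mu [set: R] (fun x => 2^-1 * (p x * p x) - c * p x) (cst 0).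
    by apply: ae_weaken => x /(_ I)/= h; move: h; lra.
  apply: du_bois_reymond => // phi tphi.
  have E : \int[mu]_x ((2^-1 * (p x * p x) - c * p x) * phi x) =
      2^-1 * \int[mu]_x (p x * p x * phi x) - c * \int[mu]_x (p x * phi x).
    rewrite -!RintegralZ_test// -RintegralB//.
    - by apply: eq_Rintegral => x _; ring.
    - have := integrable_mul_test (locintZ 2^-1 lpp) tphi.
      by under eq_fun do rewrite -mulrA.
    - have := integrable_mul_test (locintZ c lp) tphi.
      by under eq_fun do rewrite -mulrA.
  rewrite E.
  have pj j : pairable (derive1n j phi) by apply: test_pairable; exact: test_derive1n.
  have p0 : pairable phi := test_pairable tphi.
  pose I_ j n := \int[mu]_x (A_ n 0%N x * derive1n j phi x).
  have cI j : I_ j @ \oo --> \int[mu]_x (p x * derive1n j phi x) by exact: pairing_cvg1.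
  have cS : (fun n => \int[mu]_x (A_ n 0%N x * A_ n 0%N x * phi x)) @ \oo -->
      \int[mu]_x (p x * p x * phi x) by exact: pairing_cvg.
  have ibp n j : (j <= 6)%N -> ~~ odd j -> I_ j n = \int[mu]_x (A_ n j x * phi x).
    move=> j6 oj; have [_ _ h] := dAn n j j6; rewrite /I_ h//.
    by rewrite -signr_odd (negbTE oj) expr0 mul1r.
  have eqn n : k_ n ^+ 4 * I_ 4%N n + k_ n ^+ 2 * I_ 2%N n - c * I_ 0%N n
      + 2^-1 * \int[mu]_x (A_ n 0%N x * A_ n 0%N x * phi x) = 0.
    rewrite !ibp// -!RintegralZ_test//.
    have i4 j (d : R) : mu.-integrable [set: R] (EFin \o (fun x => d * (A_ n j x * phi x))).
      have := integrable_mul_test (locintZ d (lA n j)) tphi.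
      by under eq_fun do rewrite -mulrA.
    have i0 : mu.-integrable [set: R]
        (EFin \o (fun x => 2^-1 * (A_ n 0%N x * A_ n 0%N x * phi x))).
      have := integrable_mul_test (locintZ 2^-1 (lAA n 0%N 0%N)) tphi.
      by under eq_fun do rewrite -mulrA.
    rewrite -RintegralD// -RintegralB//; last exact: (integrable_addr measurableT (i4 _ _) (i4 _ _)).
    rewrite -RintegralD//; last first.
      apply: (@integrableB _ _ _ mu _ measurableT (EFin \o _) (EFin \o _)) => //.
      exact: (integrable_addr measurableT (i4 _ _) (i4 _ _)).
    under eq_Rintegral => x _.
      rewrite (_ : _ + _ = (k_ n ^+ 4 * A_ n 4%N x + k_ n ^+ 2 * A_ n 2%N x - c * A_ n 0%N x
        + 2^-1 * A_ n 0%N x ^+ 2) * phi x); last by ring.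
      rewrite ode mul0r; over.
    by rewrite Rintegral_cst// mul0r.
  have lim : (fun n => k_ n ^+ 4 * I_ 4%N n + k_ n ^+ 2 * I_ 2%N n - c * I_ 0%N n
      + 2^-1 * \int[mu]_x (A_ n 0%N x * A_ n 0%N x * phi x)) @ \oo -->
      0 ^+ 4 * (\int[mu]_x (p x * derive1n 4 phi x)) + 0 ^+ 2 * (\int[mu]_x (p x * derive1n 2 phi x))
      - c * (\int[mu]_x (p x * derive1n 0 phi x)) + 2^-1 * \int[mu]_x (p x * p x * phi x).
    have cX j : (fun n => k_ n ^+ j) @ \oo --> (0 : R) ^+ j.
      elim: j => [|j IH]; first by under eq_fun do rewrite expr0; rewrite expr0; exact: cvg_cst.
      by under eq_fun do rewrite exprS; rewrite exprS; exact: cvgM.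
    apply: cvgD; last by apply: cvgM => //; exact: cvg_cst.
    apply: cvgB; last by apply: cvgM => //; exact: cvg_cst.
    by apply: cvgD; apply: cvgM.
  have lin (t4 t2 t0 s : R) : 0 ^+ 4 * t4 + 0 ^+ 2 * t2 - c * t0 + 2^-1 * s =
      2^-1 * s - c * t0 by ring.
  exact: etrans (esym (lin _ _ _ _)) (cvg_eq eqn lim (cvg_cst 0)).
have dpp : wder 1 (fun x => p x * p x) (fun x => 2 * (p x * p1 x)).
  split => [//||phi tphi]; first exact: locintZ.
  have tphi1 := test_derive1 tphi.
  have c1 : (fun n => \int[mu]_x (A_ n 0%N x * A_ n 0%N x * derive1 phi x)) @ \oo -->
      \int[mu]_x (p x * p x * derive1 phi x).
    by apply: pairing_cvg => //; exact: test_pairable.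
  have c2 : (fun n => -1 * (2 * \int[mu]_x (A_ n 0%N x * A_ n 1%N x * phi x))) @ \oo -->
      -1 * (2 * \int[mu]_x (p x * p1 x * phi x)).
    apply: cvgM; first exact: cvg_cst.
    apply: cvgM; first exact: cvg_cst.
    by apply: pairing_cvg => //; exact: test_pairable.
  have eqn n : \int[mu]_x (A_ n 0%N x * A_ n 0%N x * derive1 phi x) =
      -1 * (2 * \int[mu]_x (A_ n 0%N x * A_ n 1%N x * phi x)).
    have [_ _ /(_ _ tphi)] := wder_mul (dA n) (dAn n 1%N isT).
    rewrite derive1n1 expr1 => ->; rewrite -(RintegralZ_test 2 (lAA n 0%N 1%N) tphi); congr (_ * _).
    by apply: eq_Rintegral => x _; ring.
  rewrite derive1n1 expr1 (cvg_eq eqn c1 c2) -(RintegralZ_test 2 lpp1 tphi); congr (_ * _).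
  by apply: eq_Rintegral => x _; rewrite mulrA.
have dcp : wder 1 (fun x => p x * p x) (fun x => 2 * c * p1 x).
  have w := wderZ (2 * c) dp; apply: (wder_ae _ _ _ (ae_eq_refl _ _ _) w).
  - exact: locint_measurable.
  - by have [_ l _] := w; exact: locint_measurable.
  - by apply: ae_weaken sq => x h _; rewrite h.
apply: wder_cst.
apply: (wder_ae _ _ (ae_eq_refl _ _ _) _ dp).
- exact: locint_measurable.
- exact: measurable_cst.
apply: ae_weaken2 sq (wder_unique dpp dcp) => x hp /(_ I) hd _ /=.
have : (p x - c) * p1 x = 0 by move: hd => /= hd; lra.
move=> /eqP; rewrite mulf_eq0 subr_eq0 => /orP[/eqP pc|/eqP//].
move: hp; rewrite pc => /eqP; rewrite -mulrA -subr_eq0 => /eqP h.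
have : c * c = 0 by lra.
by move=> /eqP; rewrite mulf_eq0 orbb (negbTE c0).
Qed.

End DegenerateWave.

(** * The wave number does not vanish *)
Section WaveNumber.
Context {R : realType}.
Local Notation mu := (@lebesgue_measure R).
Local Notation locint F := (locally_integrable [set: R] F).
Local Notation wnorm u := (L2norm [set: R] (fun x => decay x * u x)).
Variables (a0 c0 : R) (k : R -> R -> R) (p : R -> R -> R -> R).
Hypothesis fam : KP_family a0 c0 k p.
Implicit Types a c : R.

(** The profile is a dilation of the wave. *)
Lemma profile_smooth a c : `|a| < a0 -> `|c| < c0 -> k a c != 0 -> smooth (p a c).
Proof.
move=> aa cc k0; have := smooth_dilation (ka := (k a c)^-1) (wave_smooth (KP_solution fam aa cc)).
rewrite (_ : (fun x => _) = p a c)//; apply/funext => z.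
by rewrite /wave mulrA divff// mul1r.
Qed.

Lemma profile_equation a c z : `|a| < a0 -> `|c| < c0 -> k a c != 0 ->
  k a c ^+ 4 * derive1n 4 (p a c) z + k a c ^+ 2 * derive1n 2 (p a c) z - c * p a c z
    + 2^-1 * p a c z ^+ 2 = 0.
Proof.
move=> aa cc k0; have sp := profile_smooth aa cc k0.
have [_ /(_ ((k a c)^-1 * z))] := KP_solution fam aa cc.
have E n : derive1n n (wave k p a c) = fun x => k a c ^+ n * derive1n n (p a c) (k a c * x).
  have := derive1n_affine n (k a c) 0 sp; under eq_fun do rewrite addr0; move=> ->.
  by apply/funext => x; rewrite addr0.
by rewrite !E /wave mulrA divff// mul1r.
Qed.

Lemma profile_periodic a c z : `|a| < a0 -> `|c| < c0 -> p a c (z + 2 * pi) = p a c z.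
Proof. by move=> aa cc; have /Hper_real[_] := KP_p_Hper fam aa cc. Qed.

Lemma wave_number_center c : `|c| < c0 -> k 0 c != 0.
Proof.
move=> cc; have a00 := KP_a0_gt0 fam.
have [rho0 [K0 [C0 [_ _ _ [kt [_ kE]] _]]]] := KP_expansions fam.
have [|ktilde cv ->] := kE 0 c _ cc; first by rewrite normr0.
have -> : ktilde = 0.
  have z : (fun n0 => \sum_(1 <= n < n0) kt n c * 0 ^+ (2 * n)) @ \oo --> (0 : R).
    rewrite (_ : (fun n0 => _) = cst 0); first exact: cvg_cst.
    apply/funext => n; rewrite big_nat_cond big1// => m /andP[/andP[m1 _] _].
    by rewrite expr0n muln_eq0/= -leqn0 leqNgt m1 mulr0.
  exact: (cvg_unique (@Rhausdorff R) cv z).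
rewrite mulr0 addr0 gt_eqF// /k_zero sqrtr_gt0 divr_gt0// ltr_pwDl// sqrtr_ge0.
Qed.

(** The wave number is analytic in the amplitude and positive at zero amplitude. *)
Lemma wave_number_isolated_zeros a c : `|a| < a0 -> `|c| < c0 ->
  isolated_zeros a0 (k ^~ c) a.
Proof.
move=> aa cc; apply: zeros_isolated aa.
- move=> b ba; have [r [M [q [r0 qM cv]]]] := analytic2_slice (KP_k_analytic fam) ba cc.
  by exists r, M, q; split => // n; have [] := qM n.
- exact: KP_a0_gt0 fam.
- exact: wave_number_center.
Qed.

Lemma nonzero_wave_numbers a c : `|a| < a0 -> `|c| < c0 -> exists a_ : nat -> R,
  [/\ forall n, `|a_ n| < a0, forall n, k (a_ n) c != 0 & a_ @ \oo --> a].
Proof.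
move=> aa cc; have [rho rho0 iso] := wave_number_isolated_zeros aa cc.
have m0 : 0 < Num.min rho (a0 - `|a|) by rewrite lt_min rho0 subr_gt0.
pose e := Num.min rho (a0 - `|a|) / 2.
have e0 : 0 < e by rewrite divr_gt0.
have elt : e < Num.min rho (a0 - `|a|) by rewrite ltr_pdivrMr// ltr_pMr ?ltr1n.
have [er ea] : e < rho /\ e < a0 - `|a| by move: elt; rewrite lt_min => /andP[].
have t01 (n : nat) : 0 < e * n.+1%:R^-1 <= e.
  by rewrite mulr_gt0 ?invr_gt0//= ler_piMr ?(ltW e0)// invf_le1 ?ltr0n// ler1n.
have aa_ n : `|a + e * n.+1%:R^-1| < a0.
  have /andP[t0 t1] := t01 n.
  rewrite (le_lt_trans (ler_normD _ _))// (gtr0_norm t0) (@le_lt_trans _ _ (`|a| + e))//.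
    by rewrite lerD2l.
  by rewrite -ltrBrDl.
exists (fun n => a + e * n.+1%:R^-1); split => // [n|].
  apply: iso; first exact: aa_.
  have /andP[t0 t1] := t01 n; rewrite addrAC subrr add0r gtr0_norm// t0/=.
  exact: le_lt_trans er.
rewrite -[X in _ --> X]addr0 -[X in _ + X](mulr0 e); apply: cvgD; first exact: cvg_cst.
by apply: cvgM; [exact: cvg_cst|exact: cvg_harmonic].
Qed.

Lemma wave_number_continuous a c (a_ : nat -> R) : `|a| < a0 -> `|c| < c0 ->
  (forall n, `|a_ n| < a0) -> a_ @ \oo --> a -> (fun n => k (a_ n) c) @ \oo --> k a c.
Proof.
move=> aa cc ha_ cva; apply/subr_cvg0/norm_cvg0P.
apply: (analytic2_continuous (KP_k_analytic fam) _ _ _ _ _ _ _ aa cc _ ha_ cva) => //.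
- by move=> u v _ _; exact: ler_normD.
- by move=> t u _; exact: normrM.
Qed.

(** The profile is analytic in the amplitude with respect to the Sobolev norm over a
    period. *)
Lemma profile_continuous a c (a_ : nat -> R) (i : nat) : (i <= 6)%N ->
  `|a| < a0 -> `|c| < c0 -> (forall n, `|a_ n| < a0) -> a_ @ \oo --> a ->
  (fun n => wnorm (fun x => weakD i (p (a_ n) c) x - weakD i (p a c) x)) @ \oo --> (0 : R).
Proof.
move=> i6 aa cc ha_ cva.
have Hp b : `|b| < a0 -> Hper 6 (of_real (p b c)) by move=> ba; exact: (KP_p_Hper fam).
have cv : (fun n => cell_norm i (p (a_ n) c - p a c)) @ \oo --> (0 : R).
  apply: (analytic2_continuous (nrm := cell_norm i) (KP_p_analytic fam) _ _ _ _ _ _ _ aa cc _ ha_ cva) => //.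
  - by move=> u v; exact: Hper_realD.
  - by move=> t u; exact: Hper_realZ.
  - exact: Hper_real0.
  - by move=> u v; exact: (cell_normD i6).
  - by move=> t u; exact: (cell_normZ t i6).
  - by move=> u; exact: (cell_norm_le i6).
  - by move=> u; exact: cell_norm_ge0.
have [C C0 hC] := periodic_wnorm_le (R := R).
apply: (@squeeze_cvgr _ _ _ _ (cst 0) (fun n => C * cell_norm i (p (a_ n) c - p a c))).
- apply: nearW => n; rewrite L2norm_ge0/=.
  have Hn := Hp _ (ha_ n); have Ha := Hp _ aa.
  have [_ _ Ln] := Hper_wD i6 Hn; have [_ _ La] := Hper_wD i6 Ha.
  have Pn := weakD_periodic i6 Hn; have Pa := weakD_periodic i6 Ha.
  have LB : L2locr (fun x => weakD i (p (a_ n) c) x - weakD i (p a c) x).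
    have [mn LMn] := Ln; have [ma LMa] := La.
    by split; [exact: measurable_funB|move=> M; exact: L2rB].
  have HB : Hper 6 (of_real (fun x => p (a_ n) c x - p a c x)).
    have := Hper_realD Hn (Hper_realZ (-1) Ha); congr (Hper _ (of_real _)).
    by apply/funext => x; rewrite mulN1r.
  have [_ _ LB'] := Hper_wD i6 HB.
  apply: le_trans (hC _ LB _) _.
    by apply: ae_weaken2 Pn Pa => x e1 e2 _; rewrite e1// e2.
  rewrite ler_wpM2l// /cell_norm (@L2norm_ae _ _ _ (weakD i (p (a_ n) c - p a c)))//.
  - exact: cell_measurable.
  - exact: L2r_measurable (L2locr_cell LB).
  - exact: L2r_measurable (L2locr_cell LB').
  - by apply: ae_weaken (weakDB i6 Hn Ha) => x h _; rewrite -h.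
- exact: cvg_cst.
- by rewrite -[X in _ --> X](mulr0 C); apply: cvgM => //; exact: cvg_cst.
Qed.

Lemma Hper_weighted a c (i : nat) : (i <= 6)%N -> `|a| < a0 -> `|c| < c0 ->
  weighted (weakD i (p a c)).
Proof.
move=> i6 aa cc; have Hp := KP_p_Hper fam aa cc; have [_ _ L] := Hper_wD i6 Hp.
split; first by case: L.
have P0 : 0 < 2 * pi :> R by rewrite mulr_gt0 ?pi_gt0.
exact: periodic_weighted P0 L (weakD_periodic i6 Hp).
Qed.

(** A parameter of zero wave number is a limit of parameters of nonzero wave number,
    along which the profiles and their derivatives converge. *)
Lemma zero_wave_number_cst a c : `|a| < a0 -> `|c| < c0 -> c != 0 -> k a c = 0 ->
  exists kap : R, ae_eq mu [set: R] (p a c) (cst kap).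
Proof.
move=> aa cc cn0 k0; have [a_ [ha_ hk cva]] := nonzero_wave_numbers aa cc.
have Hp b : `|b| < a0 -> Hper 6 (of_real (p b c)) by move=> ba; exact: (KP_p_Hper fam).
have Lp b : `|b| < a0 -> L2locr (p b c) /\ ae_eq mu [set: R] (weakD 0 (p b c)) (p b c).
  move=> ba; have [_ w L] := Hper_wD (leq0n 6) (Hp _ ba).
  have [l _ _] := w; have e := wder_unique w (wder0 l).
  by split => //; exact: (L2locr_ae (locint_measurable l) e).
have P0 : 0 < 2 * pi :> R by rewrite mulr_gt0 ?pi_gt0.
have wp b : `|b| < a0 -> weighted (p b c).
  move=> ba; have [L _] := Lp b ba; split; first by case: L.
  by apply: periodic_weighted P0 L _; apply: aeW => x _; exact: profile_periodic.
have dA n := smooth_derivs (profile_smooth (ha_ n) cc (hk n)).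
have e1 n : ae_eq mu [set: R] (weakD 1 (p (a_ n) c)) (derive1n 1 (p (a_ n) c)).
  have [_ w _] := Hper_wD (isT : (1 <= 6)%N) (Hp _ (ha_ n)).
  by apply: wder_unique w _; have := wder_smooth 0 (dA n).
have m1 n : measurable_fun [set: R] (derive1n 1 (p (a_ n) c)).
  by apply: continuous_measurable_fun; exact: (@derivs_continuous _ _ 1%N (dA n)).
have [_ w1 L1] := Hper_wD (isT : (1 <= 6)%N) (Hp _ aa).
have [Lpa ea] := Lp _ aa; have wpa := wp _ aa.
have W1 := Hper_weighted (isT : (1 <= 6)%N) aa cc.
have mdecay := @measurable_decay R.
apply: (@degenerate_wave_cst R c (fun n => k (a_ n) c) (fun n m => derive1n m (p (a_ n) c))
  (p a c) (weakD 1 (p a c))) => //.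
- by move=> n; rewrite derive1n0; exact: wp.
- move=> n; have [_ Lw] := Hper_weighted (isT : (1 <= 6)%N) (ha_ n) cc.
  split => //; apply: L2r_ae Lw => //; first exact: measurable_funM.
  by apply: ae_weaken (e1 n) => x h _; rewrite h.
- by move=> n x; exact: profile_equation.
- by rewrite -k0; exact: wave_number_continuous.
- have := profile_continuous (leq0n 6) aa cc ha_ cva.
  rewrite (_ : (fun n => _) = (fun n => wnorm (fun x => derive1n 0 (p (a_ n) c) x - p a c x)))//.
  apply/funext => n; have [Ln en] := Lp _ (ha_ n).
  have [mn _] := Ln; have [ma _] := Lpa.
  have [_ _ [mn' _]] := Hper_wD (leq0n 6) (Hp _ (ha_ n)).
  have [_ _ [ma' _]] := Hper_wD (leq0n 6) (Hp _ aa).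
  apply: L2norm_ae => //.
  + by apply: measurable_funM => //; exact: measurable_funB.
  + by rewrite derive1n0; apply: measurable_funM => //; exact: measurable_funB.
  + by apply: ae_weaken2 en ea => x h1 h2 _; rewrite h1// h2.
- have := profile_continuous (isT : (1 <= 6)%N) aa cc ha_ cva.
  rewrite (_ : (fun n => _) =
    (fun n => wnorm (fun x => derive1n 1 (p (a_ n) c) x - weakD 1 (p a c) x)))//.
  apply/funext => n; have [_ _ [mn' _]] := Hper_wD (isT : (1 <= 6)%N) (Hp _ (ha_ n)).
  have [ma' _] := L1.
  apply: L2norm_ae => //.
  + by apply: measurable_funM => //; exact: measurable_funB.
  + by apply: measurable_funM => //; exact: measurable_funB.
  + by apply: ae_weaken (e1 n) => x h1 _; rewrite h1.
Qed.

End WaveNumber.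

(** * Transverse instability *)
Section Instability.
Context {R : realType}.
Local Notation mu := (@lebesgue_measure R).
Local Notation locint F := (locally_integrable [set: R] F).

(** The product of the coefficient and the function is the same almost everywhere. *)
Lemma KPop_ae (D : set R) dom (L : R[i]) (k c : R) (q q' : R -> R) (u v : R -> R[i]) :
  measurable_fun [set: R] q -> measurable_fun [set: R] q' -> ae_eq mu [set: R] q q' ->
  loc_integrableC u -> KPop D dom L k c q u v -> KPop D dom L k c q' u v.
Proof.
move=> mq mq' qq' [/locint_measurable mr /locint_measurable mi] [du Lv [h wh vh]].
split=> //; exists h => //.
pose E s z := (k ^+ 4)%:C%C * wD 4 u z + (k ^+ 2)%:C%C * wD 2 u z
              - c%:C%C * u z + (s z)%:C%C * u z.
have [w1 w2] := (weak_deriv_parts 2 (E q) h).1 wh.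
have eE z : E q' z = E q z + (q' z - q z)%:C%C * u z by rewrite /E rmorphB/=; ring.
have reE : re (E q') = fun z => re (E q) z + (q' z - q z) * re u z.
  by apply/funext => z; rewrite {1}/re eE raddfD/= ReM_real.
have imE : im (E q') = fun z => im (E q) z + (q' z - q z) * im u z.
  by apply/funext => z; rewrite {1}/im eE raddfD/= ImM_real.
have [l1 lh1 _] := w1; have [l2 lh2 _] := w2.
have m1 := locint_measurable l1; have m2 := locint_measurable l2.
apply/weak_deriv_parts; split.
  apply: (wder_ae _ (locint_measurable lh1) _ (ae_eq_refl _ _ _) w1); rewrite -/(E q') reE.
    by apply: measurable_funD => //; apply: measurable_funM => //; exact: measurable_funB.
  by apply: ae_weaken qq' => x e _; rewrite e// subrr mul0r addr0.
apply: (wder_ae _ (locint_measurable lh2) _ (ae_eq_refl _ _ _) w2); rewrite -/(E q') imE.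
  by apply: measurable_funD => //; apply: measurable_funM => //; exact: measurable_funB.
by apply: ae_weaken qq' => x e _; rewrite e// subrr mul0r addr0.
Qed.

Lemma simple_eigenvalue_eigenchain (k c L nu : R) (q : R -> R) (Q : nat -> R -> R) :
  derivs Q -> (forall n x, Q n (x + 2 * pi) = Q n x) ->
  measurable_fun [set: R] q -> ae_eq mu [set: R] q (Q 0%N) ->
  simple_eigenvalue (period_cell R) (KPop_per L%:C%C k c q) nu%:C%C ->
  exists f, [/\ sobolev_chain L2locr f (f 0%N), forall x, f 0%N (x + 2 * pi) = f 0%N x,
    {ae mu, forall x, KPform k c L Q f x = nu * f 0%N x} &
    ~ ae_eq mu [set: R] (f 0%N) (cst 0)].
Proof.
move=> dQ QP mq qQ /simple_eigenvalue_eigenfunction[u [g [h Th ->] gn] un0].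
have P0 : 0 < 2 * pi :> R by rewrite mulr_gt0 ?pi_gt0.
have mQ : measurable_fun [set: R] (Q 0%N).
  by apply: continuous_measurable_fun; exact: derivs_continuous.
have [[Hu uP] _ _] := Th.
have lu : loc_integrableC u by have [? _ [? _]] := Hu 0%N isT.
have [_ Lh wh] := KPop_ae mq mQ qQ lu Th.
apply: (periodic_eigenchain P0 dQ QP Hu uP un0).
by exists h.
Qed.

Variables (a0 c0 : R) (k : R -> R -> R) (p : R -> R -> R -> R).
Hypothesis fam : KP_family a0 c0 k p.

(** Otherwise the profile would be constant almost everywhere and the periodic
    operator would be [L d_z + (c - kap) d_z ^ 2], which has no negative eigenvalue. *)
Lemma wave_number_neq0 (a c L nu : R) : `|a| < a0 -> `|c| < c0 -> c != 0 ->
  0 < L -> nu < 0 ->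
  simple_eigenvalue (period_cell R) (KPop_per L%:C%C (k a c) c (p a c)) nu%:C%C ->
  k a c != 0.
Proof.
move=> aa cc cn0 L0 nu0 ev; apply/eqP => k0.
have [kap pk] := zero_wave_number_cst fam aa cc cn0 k0.
have mp : measurable_fun [set: R] (p a c).
  have [_ [l _ _] _] := Hper_wD (leq0n 6) (KP_p_Hper fam aa cc).
  exact: locint_measurable.
have P0 : 0 < 2 * pi :> R by rewrite mulr_gt0 ?pi_gt0.
pose Q : nat -> R -> R := fun n => if n is 0%N then cst kap else cst 0.
have QP n x : Q n (x + 2 * pi) = Q n x by case: n.
have [f [sf fP fE fn0]] := simple_eigenvalue_eigenchain (derivs_cst kap : derivs Q) QP mp pk ev.
apply: fn0; have [_ cf lf] := sf; have [_ l0] := lf 0%N isT.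
apply: (periodic_constant_coefficients (d := kap - c) P0 L0 (negbT (lt_eqF nu0)) l0
  (cf 0%N isT) (cf 1%N isT) fP).
apply: ae_weaken fE => x <-; rewrite /KPform /bracket2 /leibniz k0.
by rewrite !big_ord_recr big_ord0/= /cst/= binn; ring.
Qed.

(** The rescaled eigenfunction solves the problem in the original variable; since the
    wave is even, its wave number may be replaced by the absolute value. *)
Lemma wave_unstable (a c L nu : R) : `|a| < a0 -> `|c| < c0 -> k a c != 0 ->
  0 < L -> nu < 0 ->
  simple_eigenvalue (period_cell R) (KPop_per L%:C%C (k a c) c (p a c)) nu%:C%C ->
  ess_spectrum [set: R] (KPop_line L%:C%C (k a c) c (p a c)) nu%:C%C /\
  transversely_essentially_unstable c (wave k p a c).
Proof.
move=> aa cc k0 L0 nu0 ev.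
have sp := profile_smooth fam aa cc k0; have dQ := smooth_derivs sp.
have pP x : p a c (x + 2 * pi) = p a c x by exact: (profile_periodic fam x aa cc).
have QP n x := derive1n_periodic n x sp pP.
have mp : measurable_fun [set: R] (p a c).
  by apply: continuous_measurable_fun; exact: smooth_continuous.
have P0 : 0 < 2 * pi :> R by rewrite mulr_gt0 ?pi_gt0.
have [f [sf fP fE fn0]] := simple_eigenvalue_eigenchain dQ QP mp (ae_eq_refl _ _ _) ev.
have fPae : ae_eq mu [set: R] (fun x => f 0%N (x + 2 * pi)) (f 0%N).
  by apply: aeW => x _; exact: fP.
split; first exact: (periodic_eigenfunction_not_fredholm P0 dQ QP sf fPae fE fn0).
pose ka := `|k a c|.
have ka0 : 0 < ka by rewrite normr_gt0.
have kan0 : ka != 0 by rewrite gt_eqF.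
have ka2 : ka ^+ 2 = k a c ^+ 2 by rewrite real_normK ?num_real.
pose Q' n x := ka ^+ n * derive1n n (p a c) (ka * x).
pose f' n x := ka ^+ n * f n (ka * x).
have dil (x : R) : ka * (x + 2 * pi / ka) = ka * x + 2 * pi by field.
have P0' : 0 < 2 * pi / ka by rewrite divr_gt0.
have dQ' : derivs Q' := derivs_dilation ka dQ.
have QP' n x : Q' n (x + 2 * pi / ka) = Q' n x by rewrite /Q' dil QP.
have sf' : sobolev_chain L2locr f' (f' 0%N) := sobolev_chain_dilation ka0 sf.
have fP' : ae_eq mu [set: R] (fun x => f' 0%N (x + 2 * pi / ka)) (f' 0%N).
  by apply: aeW => x _; rewrite /f' dil fP.
have fE' : {ae mu, forall x, KPform 1 c (ka * L) Q' f' x = (ka ^+ 2 * nu) * f' 0%N x}.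
  have := ae_affine 0 ka0 fE; apply: ae_weaken => x; rewrite /affine addr0 => e.
  by rewrite (KPform_dilation c L _ _ x ka2) e /f' expr0 mul1r mulrA.
have fn0' : ~ ae_eq mu [set: R] (f' 0%N) (cst 0).
  move=> f0; apply: fn0; have kai : 0 < ka^-1 by rewrite invr_gt0.
  have := ae_affine 0 kai f0; apply: ae_weaken => x; rewrite /affine addr0 => /(_ I).
  by rewrite /f' expr0 mul1r mulrA divff// mul1r.
have := periodic_eigenfunction_not_fredholm P0' dQ' QP' sf' fP' fE' fn0'.
have -> : Q' 0%N = wave k p a c.
  apply/funext => x; rewrite /Q' expr0 mul1r derive1n0 /ka.
  have [k1|k1] := leP 0 (k a c); first by rewrite ger0_norm.
  by rewrite ltr0_norm// -(KP_even fam x aa cc) /wave mulrN mulNr.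
move=> nF; exists (ka * L)%:C%C, (ka * Num.sqrt (- nu)).
have om : - (ka * Num.sqrt (- nu)) ^+ 2 = ka ^+ 2 * nu.
  by rewrite exprMn sqr_sqrtr ?oppr_ge0 ?(ltW nu0)// mulrN opprK.
by rewrite om; split => //=; [rewrite mulr_gt0|rewrite pmulr_rlt0// exprn_gt0].
Qed.

End Instability.

Local Open Scope complex_scope.

Theorem theorem2 (R : realType) (a0 c0 : R) (k : R -> R -> R)
    (p : R -> R -> R -> R) (hfam : KP_family a0 c0 k p)
    (a3 c3 : R) (ha3 : 0 < a3 <= a0) (hc3 : 0 < c3 <= c0)
    (Lam : R -> R -> R)
    (hLam : forall a c : R, `|a| < a3 -> a != 0 -> `|c| < c3 -> c != 0 ->
      0 < Lam a c /\
      forall L : R, 0 < L < Lam a c ->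
        exists2 nu : R, nu < 0 &
          simple_eigenvalue (period_cell R)
            (KPop_per L%:C (k a c) c (p a c)) nu%:C) :
  forall a c : R, `|a| < a3 -> a != 0 -> `|c| < c3 -> c != 0 ->
    (forall L : R, 0 < L < Lam a c ->
       exists2 nu : R, nu < 0 &
         ess_spectrum [set: R] (KPop_line L%:C (k a c) c (p a c)) nu%:C) /\
    transversely_essentially_unstable c (wave k p a c).
Proof.
move=> a c aa an0 cc cn0; have [Lam0 ev] := hLam a c aa an0 cc cn0.
have aa0 : `|a| < a0 by case/andP: ha3 => _; exact: lt_le_trans.
have cc0 : `|c| < c0 by case/andP: hc3 => _; exact: lt_le_trans.
have unstable L : 0 < L < Lam a c -> exists2 nu : R, nu < 0 &
    ess_spectrum [set: R] (KPop_line L%:C (k a c) c (p a c)) nu%:C /\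
    transversely_essentially_unstable c (wave k p a c).
  move=> LL; have [nu nu0 evL] := ev L LL; exists nu => //.
  have /andP[L0 _] := LL; have k0 := wave_number_neq0 hfam aa0 cc0 cn0 L0 nu0 evL.
  exact: (wave_unstable hfam aa0 cc0 k0 L0 nu0 evL).
split=> [L /unstable[nu nu0 [ess _]]|]; first by exists nu.
have [|nu _ []//] := unstable (Lam a c / 2).
by rewrite divr_gt0// ltr_pdivrMr// ltr_pMr// ltr1n.
Qed.
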